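(* Let $m\ge 1$ be an integer and, for real $H>1$, let $\mathcal S_m(H)$ be the set of Salem numbers $\alpha$ of degree $2(m+1)$ with $\alpha\le H$. Then \[ \#\mathcal S_m(H)=\omega_m\,H^{m+1}+O\!\left(H^{m}\right),\qquad H\to\infty, \] where \[ \omega_m:=\frac{2^{m(m+1)}}{m+1}\,\prod_{k=0}^{m-1}\frac{(k!)^2}{(2k+1)!}. \] The implied constant in $O(\cdot)$ may depend on $m$.
   Context: A Salem number is a real algebraic integer $\alpha>1$ all of whose Galois conjugates (other than $\alpha$) have absolute value at most $1$, with at least one of them of absolute value exactly $1$. Its minimal polynomial is monic, self-reciprocal, of even degree $2(m+1)$, and its roots are $\alpha,\alpha^{-1}$ and $m$ pairs of complex conjugate numbers on the unit circle. *)

(* Defs.v *)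
From HB Require Import structures.
From mathcomp Require Import all_boot all_order all_algebra.
From mathcomp Require Import reals.
From mathcomp Require Import complex.
Set Implicit Arguments. Unset Strict Implicit. Unset Printing Implicit Defensive.
Import Order.TTheory GRing.Theory Num.Theory ComplexField.
Local Open Scope ring_scope.

(* [p] is the minimal polynomial of the real algebraic integer [alpha]:
   a monic integer polynomial, irreducible over Q, having alpha as a root.
   (By Gauss' lemma the minimal polynomial over Q of an algebraic integer
   has integer coefficients.) *)
Definition is_int_minpoly (R : realType) (p : {poly int}) (alpha : R) :=
  [/\ p \is monic,
      irreducible_poly (map_poly (intr : int -> rat) p)
    & root (map_poly (intr : int -> R) p) alpha].

Definition salem_of_degree (R : realType) (d : nat) (alpha : R) :=
  exists p : {poly int},
    [/\ is_int_minpoly p alpha,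
        (size p).-1 = d,
        1 < alpha,
        (forall z : R[i], root (map_poly (intr : int -> R[i]) p) z ->
            z != (alpha%:C)%C -> `|z| <= 1)
      & (exists z : R[i], [/\ root (map_poly (intr : int -> R[i]) p) z,
            z != (alpha%:C)%C & `|z| = 1])].

Definition omega (R : realType) (m : nat) : R :=
  (2 ^ (m * (m + 1)))%:R / (m + 1)%:R *
  \prod_(k < m) (((k`!) ^ 2)%:R / ((2 * k + 1)`!)%:R).

(* Main.v *)
(* In the variable x + 1/x + 2, Salem numbers of degree 2(m + 1) correspond to monic integer
   polynomials q = X^(m+1) - T X^m - i_1 X^(m-1) - ... - i_m with m distinct roots in (0, 4) and
   one root gam = (alpha + 1)^2 / alpha > 4.  Since gam = T + O(1), it suffices to count, for each
   T, the integer vectors i such that P = - q / T = - X^(m+1) / T + X^m + ... has m distinct roots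
   in (0, 4), up to O(T^(m-1)), and to sum over T <= H + O(1).

   This count is done by induction on m.  When all the coefficients but the constant one are
   fixed, P = Q + c is admissible exactly when c = - Q(x) with x, the largest root below 4, in
   some interval (by Rolle's theorem), so the sum over c is a Riemann sum, turned by c = - Q(x)
   into an integral over x.  For fixed x the quotient P / (X - x) runs over a family of the same
   kind, whose constants are shifted triangularly; hence the induction is on sums over arbitrarily
   shifted lattices, weighted by products of values P(y).  The main term is the integral of the
   Vandermonde product over 0 < t_m < ... < t_1 < 4, i.e. a Selberg integral with exponent 1/2.
   Expanding the determinant, it is evaluated by Schur's identity
     sum_s sgn(s) prod_k 1 / (x_s(1) + ... + x_s(k)) = prod_i 1 / x_i prod_(i<j) (x_j - x_i) / (x_i + x_j).

   Finally, if the polynomial x^(m+1) q(x + 1/x + 2) is reducible, one of its factors has all its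
   roots on the unit circle and leading and constant coefficients +-1; there are finitely many
   such factors, and each of them forces a root of q, i.e. a linear relation that determines i_m
   from the other coordinates, so that only O(H^m) polynomials are lost. *)
Require Import Defs.
From HB Require Import structures.
From mathcomp Require Import all_boot all_order all_algebra.
From mathcomp Require Import reals.
From mathcomp Require Import complex.
From mathcomp Require Import boolp classical_sets polyrcf ring lra zify.
Import Order.TTheory GRing.Theory Num.Theory ComplexField.
Local Open Scope ring_scope.
Set Implicit Arguments.
Unset Strict Implicit.
Unset Printing Implicit Defensive.

(** * The ordered Vandermonde integral *)

(** All integrands are piecewise polynomial, so an integral is a difference of values of primitives,
    and estimates come from the mean value theorem. The family of polynomials has to be stable under
    the induction. With c = - Q(x) one has dc = - Q'(x) dx, and Q'(x) is the value at x of the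
    quotient of Q - Q(x) by X - x. So passing to the quotients adds x to the list of points at which
    values are taken as weights, replaces the second coefficient u by u - x / T, and makes the
    shifts depend on x. As x is then integrated over, every estimate must be uniform in the shifts,
    in u, in the bound X on the roots and in the weight points. The small leading term - X^(m+1) / T
    is kept throughout: for large T it only puts one more root beyond 4, and the divisions stay
    exact. The interval of roots starts at 0 so that the limiting integral is homogeneous in its
    upper end, which is where the power of 2 in the constant comes from. *)

Section Primitive.
Variable R : numFieldType.

Definition prim (p : {poly R}) : {poly R} := \poly_(i < (size p).+1) (p`_i.-1 / i%:R).

Lemma coef_prim p i : (prim p)`_i = p`_i.-1 / i%:R.
Proof.
rewrite coef_poly; case: ltnP => // hi.
by rewrite nth_default ?mul0r //; case: i hi.
Qed.

Lemma deriv_prim p : (prim p)^`() = p.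
Proof.
apply/polyP => i; rewrite coef_deriv coef_prim /= -[LHS]mulr_natr mulfVK //.
by rewrite pnatr_eq0.
Qed.

Lemma prim_root0 p : (prim p).[0] = 0.
Proof. by rewrite horner_coef0 coef_prim invr0 mulr0. Qed.

Lemma prim_lin (c : R) p q : prim (c *: p + q) = c *: prim p + prim q.
Proof.
by apply/polyP => i; rewrite !(coef_prim, coefD, coefZ) mulrDl mulrA.
Qed.

Lemma prim0 : prim 0 = 0.
Proof. by apply/polyP => i; rewrite coef_prim coef0 mul0r coef0. Qed.

Lemma primZ (c : R) p : prim (c *: p) = c *: prim p.
Proof. by have := prim_lin c p 0; rewrite !addr0 prim0 addr0. Qed.

Lemma primD p q : prim (p + q) = prim p + prim q.
Proof. by have := prim_lin 1 p q; rewrite !scale1r. Qed.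

Lemma prim_sum (I : Type) (r : seq I) (P : pred I) (F : I -> {poly R}) :
  prim (\sum_(i <- r | P i) F i) = \sum_(i <- r | P i) prim (F i).
Proof. exact: (big_morph _ primD prim0). Qed.

Lemma primXn (c : R) n : prim (c *: 'X^n) = (c / n.+1%:R) *: 'X^(n.+1).
Proof.
apply/polyP => i; rewrite coef_prim !coefZ !coefXn.
case: i => [|i] /=; first by rewrite invr0 !mulr0.
by rewrite eqSS; case: eqP => [->|_]; rewrite ?mulr1 // !mulr0 mul0r.
Qed.

End Primitive.

Section OrderedIntegral.
Variable R : numFieldType.

Definition evdet m (f : nat -> {poly R}) (ts : nat -> R) : R :=
  \det (\matrix_(i < m, j < m) (f j).[ts i]).

Lemma evdetS m f ts :
  evdet m.+1 f ts = \sum_(j < m.+1) (-1) ^+ j * (f j).[ts 0%N]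
     * evdet m (f \o bump j) (fun i => ts i.+1).
Proof.
rewrite /evdet (expand_det_row _ ord0); apply: eq_bigr => j _.
rewrite mxE /cofactor add0n mulrCA mulrA; congr (_ * \det _).
by apply/matrixP => i k; rewrite !mxE.
Qed.

(* [(ordint m f).[x]] is the integral of [evdet m f] over the simplex
   [x > t_0 > ... > t_(m-1) > 0], expanded along the row of [t_0]. *)
Fixpoint ordint m (f : nat -> {poly R}) : {poly R} :=
  if m is m'.+1 then
    prim (\sum_(j < m) (-1) ^+ j *: (f j * ordint m' (f \o bump j)))
  else 1.

Lemma horner_eq0 (p : {poly R}) : (forall t, p.[t] = 0) -> p = 0.
Proof.
move=> h; apply: (@roots_geq_poly_eq0 _ _ [seq k%:R | k <- iota 0 (size p)]).
- by apply/allP => t _; apply/rootP.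
- by rewrite map_inj_uniq ?iota_uniq // => i j /eqP; rewrite eqr_nat => /eqP.
- by rewrite size_map size_iota.
Qed.

(** Plays the part of linearity of the integral: [ordint m f] depends only on the function
    [evdet m f]. Fixing t_0 = t turns the relation into one between minors, indexed by the pairs (k,
    j), whose coefficients absorb the entries of the first row. This is why the induction runs over
    arbitrary finite relations. *)
Lemma ordint_rel m (K : finType) (c : K -> R) (f : K -> nat -> {poly R}) :
  (forall ts, \sum_k c k * evdet m (f k) ts = 0) ->
  \sum_k c k *: ordint m (f k) = 0.
Proof.
elim: m K c f => [|m IH] K c f h.
  have {h}:= h (fun=> 0); rewrite /evdet /=.
  under eq_bigr => k _ do rewrite det_mx00 mulr1.
  by move=> h; rewrite -scaler_suml h scale0r.
rewrite /=; under eq_bigr => k _ do rewrite -primZ.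
rewrite -prim_sum [X in prim X](_ : _ = 0) ?prim0 //.
apply: horner_eq0 => t; rewrite horner_sum.
pose c' (p : K * 'I_m.+1) := c p.1 * ((-1) ^+ p.2 * (f p.1 p.2).[t]).
have h' ts : \sum_k c' k * evdet m (f k.1 \o bump k.2) ts = 0.
  rewrite -[RHS](h (fun i => if i is i'.+1 then ts i' else t)).
  rewrite -(pair_bigA _ (fun k j => c' (k, j) * evdet m (f k \o bump j) ts)) /=.
  apply: eq_bigr => k _; rewrite evdetS mulr_sumr; apply: eq_bigr => j _ /=.
  by rewrite /c' /= !mulrA.
have /(congr1 (horner^~ t)) := IH _ c' _ h'; rewrite horner_sum horner0 => h2; rewrite -[RHS]h2.
rewrite -(pair_bigA _ (fun k j => (c' (k, j) *: ordint m (f k \o bump j)).[t])) /=.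
apply: eq_bigr => k _; rewrite hornerZ horner_sum mulr_sumr.
by apply: eq_bigr => j _; rewrite !hornerE /c' /= !mulrA.
Qed.

Definition wt (ys : seq R) : {poly R} := \prod_(y <- ys) (y%:P - 'X).

(** Powers of - X rather than X make the determinant a product of differences t_i - t_j with i < j,
    positive on the simplex of decreasing t. *)
Definition vdm (ys : seq R) (j : nat) : {poly R} := (- 'X) ^+ j * wt ys.

(* [simplexint m x ys] is the integral over [x > t_0 > ... > t_(m-1) > 0] of
   [\prod_(i < j) (t_i - t_j) * \prod_(i, y) (y - t_i)]. *)
Definition simplexint m (x : R) (ys : seq R) := (ordint m (vdm ys)).[x].

Definition simplexint_dens m (ys : seq R) : {poly R} :=
  \sum_(j < m.+1) (-1) ^+ j *: (vdm ys j * ordint m (vdm ys \o bump j)).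

Lemma simplexintS m x ys :
  simplexint m.+1 x ys = (prim (simplexint_dens m ys)).[x].
Proof. by []. Qed.

Lemma evdet_vdm m ys ts : evdet m (vdm ys) ts =
  (\prod_(i < m) (wt ys).[ts i]) *
  \prod_(i < m) \prod_(j < m | (i < j)%N) (ts i - ts j).
Proof.
have := det_Vandermonde (\row_(i < m) - ts i); rewrite -det_tr.
have -> : \prod_(i < m) \prod_(j < m | (i < j)%N) 
   ((\row_(i < m) - ts i) 0 j - (\row_(i < m) - ts i) 0 i) =
   \prod_(i < m) \prod_(j < m | (i < j)%N) (ts i - ts j).
  by apply: eq_bigr => i _; apply: eq_bigr => j _; rewrite !mxE opprK addrC.
move=> <-.
have <- : \det (diag_mx (\row_(i < m) (wt ys).[ts i])) = \prod_(i < m) (wt ys).[ts i].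
  by rewrite det_diag; apply: eq_bigr => i _; rewrite mxE.
rewrite -det_mulmx; congr (\det _); apply/matrixP => i j.
by rewrite mul_diag_mx !mxE hornerM mulrC !hornerE.
Qed.

Lemma horner_wt ys t : (wt ys).[t] = \prod_(y <- ys) (y - t).
Proof. by rewrite horner_prod; apply: eq_bigr => y _; rewrite !hornerE. Qed.

(** Once t_0 = t is fixed, the Vandermonde factors t - t_i act on the other variables as one more
    weight point y = t. This matches, on the side of the integral, the division of P by X - x. The
    relation fed to [ordint_rel] has the Vandermonde family with weights t :: ys as term 0 and the
    minors of the expansion along the first row as the other terms. *)
Lemma simplexint_densE m ys t :
  (simplexint_dens m ys).[t] = (\prod_(y <- ys) (y - t)) * simplexint m t (t :: ys).
Proof.
pose c (k : nat) :=
  if k is j.+1 then (-1) ^+ j * (vdm ys j).[t] else - \prod_(y <- ys) (y - t).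
pose f (k : nat) := if k is j.+1 then vdm ys \o bump j else vdm (t :: ys).
have h : \sum_(k < m.+2) c k *: ordint m (f k) = 0.
  apply: (@ordint_rel _ 'I_m.+2 c f) => ts.
  rewrite big_ord_recl /=.
  have := evdetS m (vdm ys) (fun i => if i is i'.+1 then ts i' else t).
  rewrite /= => <-; rewrite !evdet_vdm /= big_ord_recl /=.
  rewrite [X in _ + _ * X]big_ord_recl /=.
  rewrite [X in _ + _ * (X * _)](_ : _ = \prod_(i < m) (t - ts i)); last first.
    by rewrite big_mkcond big_ord_recl /= mul1r.
  rewrite [X in _ + _ * (_ * X)](_ : _ = \prod_(i < m) \prod_(j < m | (i < j)%N) (ts i - ts j)); last first.
    by apply: eq_bigr => i _; rewrite big_mkcond big_ord_recl /= mul1r [RHS]big_mkcond.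
  have -> : \prod_(i < m) (wt (t :: ys)).[ts i] =
      (\prod_(i < m) (t - ts i)) * \prod_(i < m) (wt ys).[ts i].
    by rewrite -big_split; apply: eq_bigr => i _; rewrite /wt big_cons !hornerE.
  by rewrite -horner_wt; ring.
move/(congr1 (horner^~ t)): h; rewrite big_ord_recl /= hornerD horner0 => /eqP.
rewrite scaleNr hornerN hornerZ addrC subr_eq0 => /eqP <-.
rewrite /simplexint_dens !horner_sum; apply: eq_bigr => j _.
by rewrite add0n !hornerZ hornerM mulrA.
Qed.

End OrderedIntegral.

(** * Schur's identity and the value of the ordered Vandermonde integral *)

Section ClosedForm.
Variable R : numFieldType.

(** Compares the coefficients of X^m in the Lagrange interpolation of [p] at m + 1 nodes. *)
Lemma lagrange_lead m (x : nat -> R) (p : {poly R}) :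
  injective x -> (size p <= m.+1)%N ->
  \sum_(j < m.+1) p.[x j] / \prod_(i < m) (x j - x (bump j i)) = p`_m.
Proof.
move=> xinj szp.
pose l j := \prod_(i < m) ('X - (x (bump j i))%:P).
pose w j := \prod_(i < m) (x j - x (bump j i)).
have lE j y : (l j).[y] = \prod_(i < m) (y - x (bump j i)).
  by rewrite horner_prod; apply: eq_bigr => i _; rewrite !hornerE.
have w0 j : w j != 0.
  apply/prodf_neq0 => i _; rewrite subr_eq0; apply/eqP => /xinj h.
  by have := neq_bump j i; rewrite -h eqxx.
have szl j : size (l j) = m.+1 by rewrite size_prod_XsubC /index_enum -enumT size_enum_ord.
pose L := \sum_(j < m.+1) (p.[x j] / w j) *: l j.
have pL : p = L.
  apply/eqP; rewrite -subr_eq0; apply/eqP.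
  apply: (@roots_geq_poly_eq0 _ _ [seq x k | k <- iota 0 m.+1]).
  - apply/allP => y /mapP[k]; rewrite mem_iota add0n => /andP[_ km] ->.
    rewrite rootE !hornerE horner_sum (bigD1 (Ordinal km)) //= big1 => [|j jk].
      by rewrite hornerZ lE addr0 divfK ?subrr.
    rewrite hornerZ lE.
    have /unlift_some[i ij _] : j != Ordinal km by [].
    rewrite (bigD1 i) //= (_ : bump j i = k) ?subrr ?mul0r ?mulr0 //.
    by have := congr1 val ij.
  - by rewrite map_inj_uniq ?iota_uniq.
  - rewrite size_map size_iota (leq_trans (size_polyD _ _)) // geq_max szp size_polyN.
    apply: (leq_trans (size_sum _ _ _)); apply/bigmax_leqP => j _.
    by rewrite (leq_trans (size_scale_leq _ _)) // szl.
rewrite [in RHS]pL coef_sum; apply: eq_bigr => j _; rewrite coefZ.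
have -> : (l j)`_m = 1.
  have := monic_prod_XsubC (index_enum 'I_m) xpredT (fun i : 'I_m => x (bump j i)).
  by rewrite monicE lead_coefE -/(l j) szl => /eqP.
by rewrite mulr1.
Qed.

(** Take for p in [lagrange_lead] half the difference of the products g of X + x_j and f of X - x_j.
    At a node f vanishes and g contributes 2 x_j times the numerators, while the coefficient of X^m
    in g - f is twice the sum of the x_j. *)
Lemma sum_prod_ratio m (x : nat -> R) : injective x ->
  \sum_(j < m.+1) x j *
    \prod_(i < m) ((x j + x (bump j i)) / (x j - x (bump j i))) =
  \sum_(j < m.+1) x j.
Proof.
move=> xinj.
pose f := \prod_(j < m.+1) ('X - (x j)%:P).
pose g := \prod_(j < m.+1) ('X - (- x j)%:P).
have fm : f \is monic by exact: monic_prod_XsubC.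
have gm : g \is monic by exact: monic_prod_XsubC.
have szf : size f = m.+2 by rewrite size_prod_XsubC /index_enum -enumT size_enum_ord.
have szg : size g = m.+2 by rewrite size_prod_XsubC /index_enum -enumT size_enum_ord.
have coefm (y : nat -> R) : (\prod_(j < m.+1) ('X - (y j)%:P))`_m = - \sum_(j < m.+1) y j.
  have := @coefPn_prod_XsubC _ [seq y (val j) | j <- index_enum 'I_m.+1].
  by rewrite !big_map size_map /index_enum -enumT size_enum_ord => ->.
have := @lagrange_lead m x (2^-1 *: (g - f)) xinj.
have szgf : (size (2^-1 *: (g - f)) <= m.+1)%N.
  apply: (leq_trans (size_scale_leq _ _)); apply/leq_sizeP => i.
  rewrite leq_eqVlt => /predU1P[<-|mi]; last first.
    by rewrite coefB !nth_default ?subrr // ?szf ?szg.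
  rewrite coefB; move: fm gm; rewrite !monicE !lead_coefE szf szg /=.
  by move=> /eqP -> /eqP ->; rewrite subrr.
move=> /(_ szgf); rewrite coefZ coefB (coefm (fun j => - x j)) (coefm x) sumrN !opprK -mulr2n.
rewrite -[X in _ = _ * X]mulr_natl mulrA mulVf ?pnatr_eq0 // mul1r => <-.
apply: eq_bigr => j _; rewrite big_split /= prodfV mulrA; congr (_ / _).
rewrite hornerZ hornerD hornerN.
have -> : f.[x j] = 0.
  by rewrite horner_prod (bigD1 j) //= !hornerE subrr mul0r.
rewrite horner_prod (bigD1_ord j) //= !hornerE.
rewrite subr0 opprK (_ : \prod_(i < m) ('X - (- x (bump j i))%:P).[x j] =
  \prod_(i < m) (x j + x (bump j i))); first by field.
by apply: eq_bigr => i _; rewrite !hornerE opprK.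
Qed.

(** The right side of Schur's identity, with the differences x_i - x_j for i < j reversed because
    t_0 is here the largest variable. *)
Definition schur_prod m (x : nat -> R) : R :=
  (\prod_(j < m) (x j)^-1) *
  \prod_(i < m) \prod_(j < m | (i < j)%N) ((x i - x j) / (x i + x j)).

(** Omitting x_j from the full product multiplies it, up to the sign (-1)^j, by x_j and by the
    ratios (x_j + x_k) / (x_j - x_k), so the sum over j is the one in [sum_prod_ratio]. *)
Lemma schur_prod_rec m (x : nat -> R) : injective x -> (forall i, 0 < x i) ->
  \sum_(j < m.+1) (-1) ^+ j * schur_prod m (x \o bump j) =
  (\sum_(j < m.+1) x j) * schur_prod m.+1 x.
Proof.
move=> xinj xpos; rewrite -sum_prod_ratio // mulr_suml; apply: eq_bigr => j _.
pose h i k := (x i - x k) / (x i + x k).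
have hN i k : h k i = - h i k by rewrite /h -mulNr opprB (addrC (x k) (x i)).
have x0 i : x i != 0 by rewrite gt_eqF.
have x1 i k : x i + x k != 0 by rewrite gt_eqF ?addr_gt0.
have x2 i k : i != k -> x i - x k != 0.
  by move=> ik; rewrite subr_eq0; apply: contra ik => /eqP/xinj ->.
rewrite /schur_prod [\prod_(i < m.+1) (x i)^-1](bigD1_ord j) //= -/(bump j _).
have -> : \prod_(i < m.+1) \prod_(k < m.+1 | (i < k)%N) h i k =
   (\prod_(i < m) ((-1) ^+ (i < j)%N * h j (bump j i))) *
   \prod_(i < m) \prod_(k < m | (i < k)%N) h (bump j i) (bump j k).
  pose H i k := if (i < k)%N then h i k else 1.
  have -> : \prod_(i < m.+1) \prod_(k < m.+1 | (i < k)%N) h i k =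
      \prod_(i < m.+1) \prod_(k < m.+1) H i k.
    by apply: eq_bigr => i _; rewrite big_mkcond.
  have H1 : H j j = 1 by rewrite /H ltnn.
  rewrite (bigD1_ord j) //= (bigD1_ord j) //= H1 mul1r.
  under [X in _ * X = _]eq_bigr => i _ do rewrite (bigD1_ord j) //=.
  rewrite big_split /= mulrA -big_split /=.
  congr (_ * _); apply: eq_bigr => i _; last first.
    rewrite [RHS]big_mkcond /=; apply: eq_bigr => k _.
    by rewrite /H !ltnNge leq_bump2.
  rewrite /H /bump; case: (leqP j i) => ji; rewrite /= ?add1n ?add0n ?ltnS ?ji.
    by rewrite ltnNge leqW // mulr1 mul1r.
  by rewrite ltnNge ltnW //= mul1r mulN1r hN.
(* The j indices below j meet x_j in the opposite order, and each of them changes the sign of its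
   difference. *)
have sgn : \prod_(i < m) (-1) ^+ (i < j)%N = (-1) ^+ j :> R.
  rewrite prodrXr; congr (_ ^+ _).
  have : (j <= m)%N by rewrite -ltnS.
  elim: (m) (val j) => [|n IHn] [|k] //; rewrite ?big_ord0 // => kn; first by rewrite big1.
  by rewrite big_ord_recl /= (IHn k).
have inv1 : (\prod_(i < m) ((x j + x (bump j i)) / (x j - x (bump j i)))) *
   (\prod_(i < m) h j (bump j i)) = 1.
  rewrite -big_split /=; apply: big1 => i _; rewrite /h.
  by have := x1 j (bump j i); have := x2 _ _ (neq_bump j i) => ? ?; field; apply/andP.
rewrite [\prod_(i < m) ((-1) ^+ _ * _)]big_split /= sgn.
move: inv1; set P1 := \prod_(i < m) ((x j + _) / _); set P2 := \prod_(i < m) h j _.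
set P3 := \prod_(i < m) \prod_(k < m | _) _; set P4 := \prod_(i < m) _^-1 => inv1.
rewrite mulrA (_ : _ * P3 = (x j / x j) * (P1 * P2) * ((-1) ^+ j * P4) * P3) /=.
  by ring.
by rewrite inv1 divff // !mul1r.
Qed.

(** All terms of the expansion have the same degree, so the outer primitive divides by the total of
    the d_j + 1, and [schur_prod_rec] supplies exactly this factor. *)
Lemma ordint_monom m (d : nat -> nat) (c : nat -> R) : injective d ->
  ordint m (fun j => c j *: 'X^(d j)) =
  ((\prod_(j < m) c j) * schur_prod m (fun j => (d j).+1%:R)) *:
     'X^(\sum_(j < m) (d j).+1).
Proof.
elim: m d c => [|m IH] d c dinj.
  by rewrite /schur_prod !big_ord0 /= !mulr1 scale1r.
rewrite /=.
have step (j : 'I_m.+1) : (-1) ^+ j *: (c j *: 'X^(d j) *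
    ordint m ((fun j => c j *: 'X^(d j)) \o bump j)) =
    ((\prod_(i < m.+1) c i) * ((-1) ^+ j * schur_prod m ((fun j => (d j).+1%:R) \o bump j)))
     *: 'X^((\sum_(i < m.+1) (d i).+1).-1).
  have -> : (fun j => c j *: 'X^(d j)) \o bump j =
            (fun i => (c \o bump j) i *: 'X^((d \o bump j) i)) by [].
  rewrite IH; last by move=> a b /dinj /(can_inj (bumpK _)).
  rewrite -scalerAl -scalerAr -exprD !scalerA.
  rewrite [in RHS](bigD1_ord j) //= [X in _ *: 'X^(X.-1)](bigD1_ord j) //=.
  by congr (_ *: 'X^_); rewrite /comp; ring.
under eq_bigr => j _ do rewrite step.
rewrite -scaler_suml -mulr_sumr schur_prod_rec; first last.
- by move=> i; rewrite ltr0n.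
- by move=> a b /eqP; rewrite eqr_nat eqSS => /eqP/dinj.
rewrite primXn prednK; last by rewrite big_ord_recl.
rewrite -natr_sum; congr (_ *: _).
have : (\sum_(i < m.+1) (d i).+1)%:R != 0 :> R by rewrite big_ord_recl pnatr_eq0.
by move=> ?; field.
Qed.

Lemma eq_ordint m (f g : nat -> {poly R}) : f =1 g -> ordint m f = ordint m g.
Proof.
elim: m f g => // m IH f g fg /=; congr prim; apply: eq_bigr => j _.
by rewrite fg (IH _ (g \o bump j)) // => i /=.
Qed.

Lemma schur_prodS m (x : nat -> R) : schur_prod m.+1 x =
  schur_prod m x * (x m)^-1 * \prod_(i < m) ((x i - x m) / (x i + x m)).
Proof.
rewrite /schur_prod big_ord_recr [X in _ * _ * X = _]big_ord_recr /=.
rewrite [X in _ * (_ * X) = _]big1 ?mulr1; last first.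
  by move=> i; rewrite ltnNge -ltnS ltn_ord.
under [X in _ * _ * X = _]eq_bigr => i _ do
  rewrite big_mkcond big_ord_recr /= ltn_ord -big_mkcond.
rewrite big_split /=.
set a := \prod_(i < m) _^-1; set b := \prod_(i < m) \prod_(j < m | _) _.
by set c := \prod_(i < m) _; ring.
Qed.

Lemma schur_prod_nat m :
  (\prod_(j < m) (-1) ^+ j) * schur_prod m (fun j => j.+1%:R) =
  \prod_(k < m) (((k`!) ^ 2)%:R / ((2 * k + 1)`!)%:R).
Proof.
elim: m => [|m IH]; first by rewrite /schur_prod !big_ord0 !mulr1.
rewrite schur_prodS !big_ord_recr /= -IH.
move: (schur_prod m _) => S; rewrite -!mulrA; congr (_ * _).
rewrite mulrCA; congr (_ * _).
have -> : \prod_(i < m) ((i.+1%:R - m.+1%:R) / (i.+1%:R + m.+1%:R)) =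
    (-1) ^+ m * (m`!%:R * m.+1`!%:R / (2 * m + 1)`!%:R) :> R.
  have -> : \prod_(i < m) ((i.+1%:R - m.+1%:R) / (i.+1%:R + m.+1%:R)) =
    (\prod_(i < m) - (m - i)%:R) / \prod_(i < m) (m.+2 + i)%:R :> R.
    rewrite -prodf_div; apply: eq_bigr => i _; congr (_ / _).
      by rewrite natrB ?(ltnW (ltn_ord i)) // -[i.+1%:R]natr1 -[m.+1%:R]natr1; ring.
    by rewrite -natrD; congr _%:R; lia.
  rewrite prodrN card_ord -!natr_prod -mulrA; congr (_ * _).
  have -> : (\prod_(i < m) (m - i) = m`!)%N by rewrite -ffact_prod ffactnn.
  rewrite -mulrA; congr (_ * _).
  have h n k : ((\prod_(i < n) (k.+1 + i)) * k`! = (k + n)`!)%N.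
    elim: n => [|n IHn]; first by rewrite big_ord0 mul1n addn0.
    by rewrite big_ord_recr /= mulnAC IHn addnS factS mulnC.
  have -> : (2 * m + 1 = m.+1 + m)%N by lia.
  rewrite -h natrM invfM mulrCA divff ?mulr1 //.
  by rewrite pnatr_eq0 -lt0n fact_gt0.
have sgn : (-1) ^+ m * (-1) ^+ m = 1 :> R by rewrite -expr2 sqrr_sign.
set s := (-1) ^+ m in sgn *; rewrite factS natrM.
have m0 : m.+1%:R != 0 :> R by rewrite pnatr_eq0.
have f0 : (2 * m + 1)`!%:R != 0 :> R by rewrite pnatr_eq0 -lt0n fact_gt0.
transitivity (s * s * (m`!%:R ^+ 2 / (2 * m + 1)`!%:R)); last by rewrite sgn mul1r natrX.
by field; rewrite f0 nat1r m0.
Qed.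

(** The exponents d_j = j give a monomial of degree m (m + 1) / 2 in the upper end, hence the power
    of 2 at 4. The signs of the powers of - X cancel those of [schur_prod]. *)
Lemma simplexint4 m : simplexint m (4 : R) [::] =
  (2 ^ (m * (m + 1)))%:R * \prod_(k < m) (((k`!) ^ 2)%:R / ((2 * k + 1)`!)%:R).
Proof.
rewrite /simplexint (@eq_ordint _ _ (fun j => (-1) ^+ j *: 'X^j)); last first.
  by move=> j /=; rewrite /vdm /wt big_nil mulr1 (exprNn 'X) -mul_polyC polyC_exp polyCN.
rewrite (@ordint_monom m id) // hornerZ hornerXn schur_prod_nat mulrC.
congr (_ * _); rewrite natrX; elim: m => [|m IH]; first by rewrite big_ord0.
rewrite big_ord_recr exprD IH (_ : 4 = 2 ^+ 2 :> R) -?exprM -?exprD; last by ring.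
by congr (_ ^+ _) => /=; lia.
Qed.

End ClosedForm.
(** * Real roots of the polynomials P *)

Section RootLists.
Variable R : rcfType.
Implicit Types (P Q : {poly R}) (a z : seq R).

Definition roots_in_lt (m : nat) (x : R) P a :=
  [/\ size a = m, sorted <%R a, all (fun y => 0 < y < x) a & all (root P) a].

(* When [P != 0]: [P] has at least [m] distinct roots in the open interval (0, x). *)
Definition good (m : nat) (x : R) P : bool := (m <= size (roots P 0 x))%N.

Lemma goodP m x P : P != 0 -> reflect (exists a, roots_in_lt m x P a) (good m x P).
Proof.
move=> P0; apply: (iffP idP) => [h|[a [<- sa aI aP]]].
  exists (take m (roots P 0 x)); split.
  - by rewrite size_takel.
  - by apply: take_sorted; apply: sorted_roots.
  - by apply/allP => y /mem_take /roots_in; rewrite in_itv.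
  - by apply/allP => y /mem_take /root_roots.
apply: uniq_leq_size; first exact: lt_sorted_uniq.
move=> y ya; rewrite in_roots P0 andbT in_itv /=.
by rewrite (allP aI _ ya) (allP aP _ ya).
Qed.

Lemma exists_seq m (p : nat -> R -> Prop) :
  (forall i, (i < m)%N -> exists c, p i c) ->
  exists2 s, size s = m & forall i, (i < m)%N -> p i (nth 0 s i).
Proof.
elim: m => [|m IH] h; first by exists [::].
have [|s szs hs] := IH; first by move=> i im; apply: h; apply: leqW.
have [c hc] := h m (leqnn _); exists (rcons s c); rewrite ?size_rcons ?szs // => i.
by rewrite nth_rcons szs ltnS leq_eqVlt; case: ltngtP => [/hs| |->].
Qed.

Lemma sorted_interlaced m (s z : seq R) : size s = m.+1 -> size z = m ->
  (forall i, (i < m)%N -> nth 0 s i < nth 0 z i < nth 0 s i.+1) ->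
  sorted <%R s /\ sorted <%R z.
Proof.
move=> szs szz h; split; apply/(sortedP 0) => i; rewrite ?szs ?szz => hi.
  by have /andP[h1 h2] := h i hi; exact: (lt_trans h1 h2).
have /andP[_ h1] := h i (ltnW hi); have /andP[h2 _] := h _ hi.
exact: (lt_trans h1 h2).
Qed.

Lemma rolle_seq m P a : size a = m.+1 -> sorted <%R a -> all (root P) a ->
  exists2 z, size z = m & forall i, (i < m)%N ->
    nth 0 a i < nth 0 z i < nth 0 a i.+1 /\ root P^`() (nth 0 z i).
Proof.
move=> sza sa aP.
apply: (@exists_seq m (fun i c => nth 0 a i < c < nth 0 a i.+1 /\ root P^`() c)) => i im.
have aij : nth 0 a i < nth 0 a i.+1 by have /(sortedP 0) := sa; apply; rewrite sza.
have [||c cI c0] := @poly_rolle _ (nth 0 a i) (nth 0 a i.+1) P; first exact: aij.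
  have r0 k : (k < m.+1)%N -> P.[nth 0 a k] = 0.
    by move=> km; apply/rootP; apply: (allP aP); rewrite mem_nth ?sza.
  by rewrite !r0 // ltnW.
by exists c; move: cI; rewrite in_itv => /= ->; split=> //; apply/rootP.
Qed.

Lemma sum_le (s : seq R) b : all (fun y => y <= b) s -> \sum_(y <- s) y <= (size s)%:R * b.
Proof.
elim: s => [|y s IH] /=; first by rewrite big_nil mul0r.
by case/andP => yb /IH h; rewrite big_cons -nat1r mulrDl mul1r lerD.
Qed.

Variables (T u : R).
Hypothesis T0 : 0 < T.

(* [P] has degree [m + 1] and two leading coefficients [- 1 / T] and [u]. *)
Definition shape m P := [/\ size P = m.+2, P`_m.+1 = - T^-1 & P`_m = u].

Lemma shape_neq0 m P : shape m P -> P != 0.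
Proof. by case=> h _ _; rewrite -size_poly_eq0 h. Qed.

Lemma shape_subC m P c : shape m.+1 P -> shape m.+1 (P - c%:P).
Proof.
case=> h1 h2 h3; split; rewrite ?coefB ?coefC ?subr0 //.
by rewrite size_polyDl ?h1 // size_polyN size_polyC; case: eqP.
Qed.

(** The cofactor of the m roots is linear, and the two prescribed leading coefficients of P
    determine it. *)
Lemma shape_factor m P a : shape m P -> size a = m -> uniq a -> all (root P) a ->
  P = (\prod_(y <- a) ('X - y%:P)) *
      ((u - T^-1 * \sum_(y <- a) y)%:P - T^-1 *: 'X).
Proof.
move=> [szP P1 P2] sza ua aP.
have [|q Pq] := uniq_roots_prod_XsubC aP; first by rewrite uniq_rootsE.
set A := \prod_(y <- a) _ in Pq *.
have Am : A \is monic by exact: monic_prod_XsubC.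
have szA : size A = m.+1 by rewrite size_prod_XsubC sza.
have q0 : q != 0 by apply/eqP => q0; move: szP; rewrite Pq q0 mul0r size_poly0.
have szq : size q = 2.
  by move: szP; rewrite Pq size_Mmonic // szA addnS /= => /eqP; rewrite (_ : m.+2 = (2 + m)%N) // eqn_add2r => /eqP.
have qE : q = (q`_0)%:P + (q`_1) *: 'X.
  apply/polyP => i; rewrite coefD coefC coefZ coefX.
  case: i => [|[|i]] /=; rewrite ?mulr1 ?mulr0 ?addr0 ?add0r //.
  by rewrite nth_default // szq.
have A1 : A`_m = 1 by move: Am; rewrite monicE lead_coefE szA => /eqP.
have A2 : A`_m.+1 = 0 by rewrite nth_default // szA.
have A3 : (A * 'X)`_m = - \sum_(y <- a) y.
  rewrite coefMX; case: m sza {szP P1 P2 szA A1 A2} => [|m] sza /=.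
    by rewrite (size0nil sza) big_nil oppr0.
  by have := @coefPn_prod_XsubC _ a; rewrite sza => ->.
have PE : P = q`_0 *: A + q`_1 *: (A * 'X).
  by rewrite Pq {1}qE mulrDl mul_polyC -scalerAl ['X * A]mulrC.
have q1 : q`_1 = - T^-1.
  by rewrite -P1 PE coefD !coefZ A2 mulr0 add0r coefMX /= A1 mulr1.
have q2 : q`_0 = u - T^-1 * \sum_(y <- a) y.
  by rewrite -P2 PE coefD !coefZ A1 mulr1 A3 q1 mulrNN addrK.
by rewrite Pq mulrC -q2 {1}qE q1 scaleNr.
Qed.

(** The roots add up to at most 4 m, so the constant of the linear cofactor is at least u - 4 m / T
    > 4 / T. The cofactor is thus positive up to 4, and the last root of P lies beyond 4. *)
Lemma shape_pos m P a x : shape m P -> 4 * m.+1%:R / T < u -> x <= 4 ->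
  roots_in_lt m x P a ->
  exists2 c, 4 / T < c &
    P = (\prod_(y <- a) ('X - y%:P)) * (c%:P - T^-1 *: 'X).
Proof.
move=> sh hu x4 [sza sa aI aP].
exists (u - T^-1 * \sum_(y <- a) y); last first.
  apply: (shape_factor sh) => //. exact: lt_sorted_uniq sa.
have := @sum_le a 4; rewrite sza => /(_ _)/wrap[].
  by apply/allP => y /(allP aI)/andP[_ /ltW yx]; apply: le_trans x4.
rewrite -(ler_pM2l (_ : 0 < T^-1)) ?invr_gt0 // => h.
move: hu; rewrite -nat1r; move: h.
by rewrite mulrDr mulr1 mulrDl; lra.
Qed.

End RootLists.

(** * The largest roots of the admissible translates of Q form an interval *)

Section Convexity.
Variable R : rcfType.
Variables (T u : R).
Hypothesis T0 : 0 < T.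
Implicit Types (P Q : {poly R}) (a z : seq R).

(* By Vieta the roots of [Q^`()] have a large sum, so they cannot all lie in (0, 4]. *)
Lemma deriv_roots_le m Q (s : seq R) : shape T u m.+1 Q -> 4 * m.+2%:R / T < u ->
  uniq s -> all (fun y => y <= 4) s -> all (root Q^`()) s -> (size s <= m)%N.
Proof.
move=> [szQ Q1 Q2] hu us s4 sr; rewrite leqNgt; apply/negP => ms.
pose t := take m.+1 s.
have szt : size t = m.+1 by rewrite size_takel.
have dm : Q^`()`_m.+1 = - T^-1 * m.+2%:R by rewrite coef_deriv Q1 mulr_natr.
have szd : size Q^`() = m.+2.
  apply/eqP; rewrite eqn_leq; apply/andP; split.
    by rewrite -ltnS -szQ lt_size_deriv // -size_poly_eq0 szQ.
  rewrite ltnNge; apply/negP => /leq_sizeP/(_ _ (leqnn _)) /eqP.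
  by rewrite dm mulf_eq0 oppr_eq0 invr_eq0 gt_eqF //= pnatr_eq0.
have := @all_roots_prod_XsubC _ Q^`() t.
rewrite szd szt uniq_rootsE => /(_ erefl _ _)/wrap[||].
- by apply/allP => y /mem_take /(allP sr).
- exact: take_uniq.
move/(congr1 (fun p : {poly R} => p`_m)).
rewrite coefZ lead_coefE szd dm coef_deriv Q2.
have := @coefPn_prod_XsubC _ t; rewrite szt => -> //.
rewrite mulNr mulrNN -[u *+ _]mulr_natr => e.
have := @sum_le _ t 4; rewrite szt => /(_ _)/wrap[].
  by apply/allP => y /mem_take /(allP s4).
move=> le1.
have : u * m.+1%:R <= T^-1 * m.+2%:R * (m.+1%:R * 4).
  by rewrite e ler_wpM2l // mulr_ge0 // ?invr_ge0 ?ltW.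
rewrite (_ : _ * _ * (_ * _) = 4 * m.+2%:R / T * m.+1%:R); last by ring.
by rewrite ler_pM2r ?ltr0n // leNgt hu.
Qed.

Lemma roots_in_lt_rcons m y Q s : 0 < y -> roots_in_lt m y (Q - Q.[y]%:P) s ->
  [/\ size (rcons s y) = m.+1, sorted <%R (rcons s y),
      all (fun v => 0 < v <= y) (rcons s y) & all (root (Q - Q.[y]%:P)) (rcons s y)].
Proof.
move=> y0 [szs ss sI sr]; split; first by rewrite size_rcons szs.
- case: s ss sI {szs sr} => //= v s ss /andP[/andP[v0 vy] sI].
  rewrite rcons_path ss /=; have := mem_last v s; rewrite inE => /orP[/eqP -> //|].
  by move/(allP sI)/andP => [].
- rewrite all_rcons y0 lexx /=; apply/allP => v /(allP sI)/andP[-> /ltW]; exact.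
- by rewrite all_rcons sr rootE !hornerE subrr eqxx.
Qed.

(** By [shape_pos], Q - Q(x) is X - x times factors that are all positive at x, the other roots
    being smaller than x and the last one beyond 4. Their product at x is Q'(x). *)
Lemma deriv_top_root m Q x a : shape T u m.+1 Q -> 4 * m.+2%:R / T < u ->
  0 < x < 4 -> roots_in_lt m x (Q - Q.[x]%:P) a -> 0 < Q^`().[x].
Proof.
move=> sh hu /andP[x0 x4] ha.
have [sza sa aI ar] := roots_in_lt_rcons x0 ha.
have rI : roots_in_lt m.+1 4 (Q - (Q.[x])%:P) (rcons a x).
  split=> //; apply/allP => y /(allP aI)/andP[-> yx] /=.
  exact: (le_lt_trans yx).
have [c hc e] := shape_pos T0 (shape_subC Q.[x] sh) hu (lexx 4) rI.
have -> : Q^`() = (Q - Q.[x]%:P)^`() by rewrite derivB derivC subr0.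
rewrite e big_rcons /= derivM hornerD.
rewrite [X in _ + X](_ : _ = 0) ?addr0; last by rewrite !hornerE subrr !(mulr0, mul0r).
rewrite derivM derivXsubC mulr1 hornerM hornerD.
rewrite [X in X + _](_ : _ = 0) ?add0r; last by rewrite !hornerE subrr !(mulr0, mul0r).
have [_ _ aI' _] := ha.
rewrite horner_prod mulr_gt0 //.
  rewrite big_seq; apply: prodr_gt0 => y /(allP aI')/andP[_ yx].
  by rewrite !hornerE subr_gt0.
rewrite !hornerE subr_gt0 (le_lt_trans _ hc) // mulrC.
by rewrite ler_pM2r ?invr_gt0 // ltW.
Qed.

(* Between two admissible values of the largest root, every value is admissible:
   the critical points of [Q] separate both families of roots in the same way. *)
Lemma good_convex m Q (x1 x2 : R) a b (x : R) : shape T u m.+1 Q -> 4 * m.+2%:R / T < u ->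
  0 < x1 -> x2 <= 4 ->
  roots_in_lt m x1 (Q - Q.[x1]%:P) a -> roots_in_lt m x2 (Q - Q.[x2]%:P) b ->
  x1 < x < x2 -> exists c, roots_in_lt m x (Q - Q.[x]%:P) c.
Proof.
move=> sh hu x10 x24 ha hb /andP[x1x xx2].
have x12 : x1 < x2 by apply: lt_trans xx2.
have hur : 4 * m.+1%:R / T < u.
  by apply: le_lt_trans hu; rewrite ler_pM2r ?invr_gt0 // ler_pM2l ?ler_nat ?ltr0n.
have dsub c : (Q - c%:P)^`() = Q^`() by rewrite derivB derivC subr0.
have [sza sa aI ar] := roots_in_lt_rcons x10 ha.
have [szb sb bI br] := roots_in_lt_rcons (lt_trans x10 x12) hb.
have [z szz hz] := rolle_seq sza sa ar.
have [z' szz' hz'] := rolle_seq szb sb br.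
have [_ sz] := sorted_interlaced sza szz (fun i hi => (hz i hi).1).
have [_ sz'] := sorted_interlaced szb szz' (fun i hi => (hz' i hi).1).
have zr : all (root Q^`()) z.
  by apply/(all_nthP 0) => i; rewrite szz => /hz[_]; rewrite dsub.
have zr' : all (root Q^`()) z'.
  by apply/(all_nthP 0) => i; rewrite szz' => /hz'[_]; rewrite dsub.
have zx1 : all (fun y => y < x1) z.
  apply/(all_nthP 0) => i; rewrite szz => im.
  have [/andP[_ h] _] := hz i im; apply: (lt_le_trans h).
  have/(allP aI)/andP[] // : nth 0 (rcons a x1) i.+1 \in rcons a x1.
  by rewrite mem_nth // sza.
have zx2 : all (fun y => y < x2) z'.
  apply/(all_nthP 0) => i; rewrite szz' => im.
  have [/andP[_ h] _] := hz' i im; apply: (lt_le_trans h).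
  have/(allP bI)/andP[] // : nth 0 (rcons b x2) i.+1 \in rcons b x2.
  by rewrite mem_nth // szb.
(* The critical points [z] already exhaust the m roots up to 4 that [deriv_roots_le] allows to
   Q'. *)
have noroot y : y <= 4 -> root Q^`() y -> y \in z.
  move=> y4 ry; apply: contraT => yz.
  have := @deriv_roots_le m Q (y :: z) sh hu; rewrite /= szz ltnn; apply.
  - by rewrite yz lt_sorted_uniq.
  - rewrite y4; apply/allP => v /(allP zx1)/ltW vx; apply: (le_trans vx).
    exact: le_trans (ltW x12) x24.
  - by rewrite ry.
have zz' : z = z'.
  apply: lt_sorted_eq => // v; apply/esym; move: v.
  apply: (uniq_min_size (lt_sorted_uniq sz') _ _).2; last by rewrite szz szz'.
  move=> y yz'; apply: noroot; last exact: (allP zr').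
  by apply: le_trans x24; apply/ltW/(allP zx2).
rewrite -{z' szz' sz' zr' zx2}zz' in hz'.
have x14 : x1 <= 4 by apply: ltW (lt_le_trans x12 x24).
have dpos1 : 0 < Q^`().[x1].
  by apply: deriv_top_root ha => //; rewrite x10 (lt_le_trans x12 x24).
(* A change of sign of Q' on [x1, 4] would be a critical point outside [z], all of whose entries are
   below x1. So Q increases there, and Q(x) lies between Q(x1) and Q(x2). *)
have dpos y : x1 <= y -> y <= 4 -> 0 < Q^`().[y].
  rewrite le_eqVlt => /predU1P[<- //|x1y] y4; rewrite ltNge; apply/negP => dy.
  have [||v] := @polyrcf.poly_ivt _ Q^`() x1 y; first exact: ltW.
    by rewrite pmulr_rle0.
  rewrite in_itv /= => /andP[x1v vy] /(noroot _ (le_trans vy y4))/(allP zx1).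
  by rewrite ltNge x1v.
have incr v w : x1 <= v -> v < w -> w <= 4 -> Q.[v] < Q.[w].
  move=> x1v vw w4; have [c] := poly_mvt Q vw; rewrite in_itv /= => /andP[vc cw] e.
  rewrite -subr_gt0 e mulr_gt0 ?subr_gt0 // dpos //; first exact: le_trans (ltW vc).
  exact: le_trans (ltW cw) w4.
have Qx1 : Q.[x1] < Q.[x] by apply: incr => //; apply: le_trans x24; apply: ltW.
have Qx2 : Q.[x] < Q.[x2] by apply: incr => //; apply: ltW.
have va i : (i <= m)%N -> Q.[nth 0 (rcons a x1) i] = Q.[x1].
  move=> im; apply/eqP; rewrite -subr_eq0.
  have/(allP ar) : nth 0 (rcons a x1) i \in rcons a x1 by rewrite mem_nth // sza.
  by rewrite rootE !hornerE.
have vb i : (i <= m)%N -> Q.[nth 0 (rcons b x2) i] = Q.[x2].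
  move=> im; apply/eqP; rewrite -subr_eq0.
  have/(allP br) : nth 0 (rcons b x2) i \in rcons b x2 by rewrite mem_nth // szb.
  by rewrite rootE !hornerE.
(* The interval from [lo i] to z_i contains the root number i at both levels Q(x1) and Q(x2), so the
   intermediate value theorem gives a point at level Q(x) in it. *)
pose lo i := if i is i'.+1 then nth 0 z i' else 0.
have [c szc hc] : exists2 c, size c = m & forall i, (i < m)%N ->
    lo i < nth 0 c i < nth 0 z i /\ Q.[nth 0 c i] = Q.[x].
  apply: (@exists_seq _ m (fun i c => lo i < c < nth 0 z i /\ Q.[c] = Q.[x])) => i im.
  have aI' : lo i < nth 0 (rcons a x1) i < nth 0 z i.
    have [/andP[h1 _] _] := hz i im; rewrite h1 andbT.
    case: i im h1 => [|i] im h1 /=; last by have [/andP[_ ->] _] := hz i (ltnW im).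
    have/(allP aI)/andP[] // : nth 0 (rcons a x1) 0 \in rcons a x1.
    by rewrite mem_nth // sza.
  have bI' : lo i < nth 0 (rcons b x2) i < nth 0 z i.
    have [/andP[h1 _] _] := hz' i im; rewrite h1 andbT.
    case: i im h1 {aI'} => [|i] im h1 /=; last by have [/andP[_ ->] _] := hz' i (ltnW im).
    have/(allP bI)/andP[] // : nth 0 (rcons b x2) 0 \in rcons b x2.
    by rewrite mem_nth // szb.
  have := va i (ltnW im); have := vb i (ltnW im); move: aI' bI'.
  move: (nth 0 (rcons a x1) i) (nth 0 (rcons b x2) i) => p q /andP[p1 p2] /andP[q1 q2] vq vp.
  have [pq|qp|pq] := ltgtP p q; last by move: Qx1; rewrite ltNge -vp pq vq ltW.
  - have [||v] := @poly_ivtoo _ (Q - Q.[x]%:P) p q; first exact: ltW.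
      by rewrite !hornerE vp vq nmulr_rlt0 ?subr_gt0 ?subr_lt0.
    rewrite in_itv /= => /andP[pv vq']; rewrite rootE !hornerE subr_eq0 => /eqP e.
    by exists v; split=> //; rewrite (lt_trans p1) //= (lt_trans vq').
  - have [||v] := @poly_ivtoo _ (Q - Q.[x]%:P) q p; first exact: ltW.
      by rewrite !hornerE vp vq pmulr_rlt0 ?subr_gt0 ?subr_lt0.
    rewrite in_itv /= => /andP[pv vq']; rewrite rootE !hornerE subr_eq0 => /eqP e.
    by exists v; split=> //; rewrite (lt_trans q1) //= (lt_trans vq').
exists c; split=> //.
- apply/(sortedP 0) => i; rewrite szc => im.
  have [/andP[_ h1] _] := hc i (ltnW im); have [/andP[h2 _] _] := hc i.+1 im.
  exact: lt_trans h1 h2.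
- apply/(all_nthP 0) => i; rewrite szc => im.
  have [/andP[h1 h2] _] := hc i im; apply/andP; split.
    case: i im h1 {h2} => [|i] im //; apply: le_lt_trans.
    have [/andP[h _] _] := hz i (ltnW im); apply: ltW (lt_trans _ h).
    have/(allP aI)/andP[] // : nth 0 (rcons a x1) i \in rcons a x1.
    by rewrite mem_nth // sza ltnS ltnW // ltnW.
  apply: (lt_trans h2); apply: lt_trans x1x; apply: (allP zx1).
  by rewrite mem_nth // szz.
- apply/(all_nthP 0) => i; rewrite szc => im.
  by have [_ e] := hc i im; rewrite rootE !hornerE e subrr.
Qed.
End Convexity.
(** * Families of polynomials indexed by shifted lattices *)

Section Families.
Variable R : realType.
Implicit Types (A B P Q : {poly R}) (sh : {poly R} -> R).

Definition zrange (M : nat) : seq int := [seq j%:Z - M%:Z | j <- iota 0 (2 * M).+1].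
Arguments zrange : simpl never.

Fixpoint box (M m : nat) : seq (seq int) :=
  if m is m'.+1 then [seq rcons i j | i <- box M m', j <- zrange M] else [:: [::]].

Lemma zrange_uniq M : uniq (zrange M).
Proof. by rewrite map_inj_uniq ?iota_uniq // => i j /addIr []. Qed.

Lemma mem_zrange M (j : int) : (j \in zrange M) = (`|j| <= M%:Z).
Proof.
apply/mapP/idP => [[k]|hj]; first by rewrite mem_iota => hk ->; lia.
exists (absz (j + M%:Z)); first by rewrite mem_iota; lia.
by lia.
Qed.

Lemma box_uniq M m : uniq (box M m).
Proof.
elim: m => // m IH; apply: (allpairs_uniq IH (zrange_uniq M)).
by move=> [i j] [i' j'] _ _ /= /rcons_inj [-> ->].
Qed.

Lemma mem_box M m i : (i \in box M m) = (size i == m) && all (fun j => `|j| <= M%:Z) i.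
Proof.
elim: m i => [|m IH] i; first by rewrite inE; case: i.
apply/(@allpairsP _ _ _ (@rcons int))/andP => [[[i' j] /= []]|[]].
  rewrite IH mem_zrange => /andP[/eqP szi ai] hj ->.
  by rewrite size_rcons szi eqxx all_rcons hj.
case/lastP: i => // i j; rewrite size_rcons eqSS all_rcons => szi /andP[hj hi].
by exists (i, j); rewrite IH szi hi mem_zrange.
Qed.

Lemma size_of_box M m i : i \in box M m -> size i = m.
Proof. by rewrite mem_box => /andP[/eqP]. Qed.

Lemma big_box (V : nmodType) M m (F : seq int -> V) :
  \sum_(i <- box M m.+1) F i = \sum_(i <- box M m) \sum_(j <- zrange M) F (rcons i j).
Proof. by rewrite big_allpairs_dep. Qed.

Variable T : R.
Hypothesis T0 : 0 < T.

(* The coefficients are read from the top; [sh] shifts each one by a quantity depending on the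
   previous ones. *)
Definition step sh A (j : int) : {poly R} := 'X * A + (j%:~R / T + sh A)%:P.
Definition fam sh A i := foldl (step sh) A i.
Definition fam0 (u : R) : {poly R} := u%:P - T^-1 *: 'X.

Lemma fam_rcons sh A i j : fam sh A (rcons i j) = step sh (fam sh A i) j.
Proof. by rewrite /fam foldl_rcons. Qed.

Lemma shape_fam0 u : shape T u 0 (fam0 u).
Proof.
have T1 : T^-1 != 0 by rewrite invr_eq0 gt_eqF.
rewrite /fam0 addrC -scaleNr -mul_polyC; split.
- by rewrite size_MXaddC polyC_eq0 oppr_eq0 (negPf T1) size_polyC oppr_eq0 T1.
- by rewrite coefD coefMX !coefC /= addr0.
- by rewrite coefD coefMX !coefC /= add0r.
Qed.

Lemma shape_mulX u m A c : shape T u m A -> shape T u m.+1 ('X * A + c%:P).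
Proof.
move=> sA; have A0 := shape_neq0 sA; case: sA => h1 h2 h3.
rewrite ['X * A]mulrC; split.
- by rewrite size_MXaddC (negPf A0) /= h1.
- by rewrite coefD coefMX coefC addr0.
- by rewrite coefD coefMX coefC addr0.
Qed.

Lemma shape_fam sh u i : shape T u (size i) (fam sh (fam0 u) i).
Proof.
elim/last_ind: i => [|i j IH]; first exact: shape_fam0.
by rewrite fam_rcons size_rcons; apply: shape_mulX.
Qed.

(* Recovers the polynomial [B] from its quotient [B'] in [shear_fam] below. *)
Definition unshear (x : R) A : {poly R} := A - x *: drop_poly 1 A.
(** By synthetic division the constant term of a quotient by X - x is a Horner value: for the new B
    it is j / T + sh B + x B(x), with the same integer j. The shift is the rest. *)
Definition shear sh (x : R) A : R := sh (unshear x A) + x * (unshear x A).[x].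

Lemma drop_poly1_mulX A c : drop_poly 1 ('X * A + c%:P) = A.
Proof.
apply/polyP => i; rewrite coef_drop_poly ['X * A]mulrC coefD coefMX coefC addn1 /=.
by rewrite addr0.
Qed.

(* Dividing by [X - x] turns a family into another one with sheared shifts,
   over the same integer index set. *)
Lemma shear_fam sh u x i :
  let B := fam sh (fam0 u) i in
  let B' := fam (shear sh x) (fam0 (u - x / T)) i in
  unshear x B' = B /\ 'X * B - ('X * B).[x]%:P = ('X - x%:P) * B'.
Proof.
elim/last_ind: i => [|i j [IH1 IH2]] /=.
  split; rewrite /fam /= /fam0.
    rewrite /unshear [_ - _ *: 'X]addrC -scaleNr -mul_polyC mulrC.
    rewrite drop_poly1_mulX -mul_polyC !polyCB !polyCM !polyCN; ring.
  by rewrite !hornerE -!mul_polyC !polyCM !polyCB !polyCM; ring.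
rewrite !fam_rcons; set B := fam sh _ i in IH1 IH2 *; set B' := fam (shear sh x) _ i in IH1 IH2 *.
have hs : step (shear sh x) B' j = 'X * B' + (j%:~R / T + sh B + x * B.[x])%:P.
  by rewrite /step /shear IH1 addrA.
split.
  rewrite /unshear hs drop_poly1_mulX /step.
  transitivity (('X - x%:P) * B' + (j%:~R / T + sh B + x * B.[x])%:P).
    by rewrite -mul_polyC; ring.
  rewrite -IH2 !hornerE [in RHS]polyCD [(_ + _ + _)%:P]polyCD; ring.
rewrite hs; set c := (_ + _)%:P.
transitivity ('X * (('X - x%:P) * B') + ('X - x%:P) * c); last by ring.
rewrite -IH2 /c /step !hornerE !(polyCD, polyCM); ring.
Qed.

Definition bounded (K : R) A : bool := all (fun c => `|c| <= K) A.

Lemma boundedP K A : 0 <= K -> reflect (forall k, `|A`_k| <= K) (bounded K A).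
Proof.
move=> K0; apply: (iffP (all_nthP 0)) => h k; last by move=> _; apply: h.
case: (ltnP k (size A)) => [/h //|hk]; by rewrite nth_default ?normr0.
Qed.

Lemma bounded_horner K A n x : 0 <= K -> bounded K A -> (size A <= n)%N -> `|x| <= 4 ->
  `|A.[x]| <= n%:R * K * 4 ^+ n.
Proof.
move=> K0 /(boundedP _ K0) hA szA x4; rewrite (horner_coef_wide _ szA).
apply: (le_trans (ler_norm_sum _ _ _)).
have -> : n%:R * K * 4 ^+ n = \sum_(i < n) (K * 4 ^+ n).
  by rewrite sumr_const card_ord -mulrA mulr_natl.
apply: ler_sum => i _; rewrite normrM normrX ler_pM ?exprn_ge0 //.
apply: (@le_trans _ _ (4 ^+ i)); first by apply: lerXn2r; rewrite ?nnegrE.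
by apply: ler_weXn2l; [lra | apply: ltnW].
Qed.

(* The window [-M, M] of integers contains all those that matter for polynomials bounded by [K]. *)
Definition covers K m (M : nat) sh := forall A, (size A <= m.+1)%N -> bounded K A ->
  `|sh A| + K <= M%:R / T.

(** For 0 <= x <= 4, [unshear] multiplies a coefficient bound by at most 5, and [bounded_horner]
    then bounds x B(x). The required lower bound on K collects these terms. *)
Lemma covers_shear K K' m M sh x : 0 <= K' -> 0 <= x <= 4 ->
  K' + 4 * (m.+1%:R * (5 * K') * 4 ^+ m.+1) + 5 * K' <= K ->
  covers K m.+1 M sh -> covers K' m M (shear sh x).
Proof.
move=> K0 /andP[x0 x4] hK hc A szA bA.
have x4' : `|x| <= 4 by rewrite ger0_norm.
pose B := unshear x A.
have bB : bounded (5 * K') B.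
  apply/boundedP; first by rewrite mulr_ge0.
  move=> k; rewrite coefB coefZ coef_drop_poly.
  have/(boundedP _ K0) hA := bA; apply: (le_trans (ler_normB _ _)).
  rewrite normrM (_ : 5 * K' = K' + 4 * K'); last by ring.
  by apply: lerD => //; apply: ler_pM.
have szB : (size B <= m.+1)%N.
  rewrite (leq_trans (size_polyD _ _)) // geq_max szA size_polyN.
  rewrite (leq_trans (size_scale_leq _ _)) // (leq_trans _ szA) //.
  by rewrite size_drop_poly leq_subr.
have K5 : 0 <= 5 * K' by rewrite mulr_ge0.
have hB := bounded_horner K5 bB szB x4'.
have bKB : bounded K B.
  apply/allP => c /(allP bB) /le_trans; apply; apply: le_trans hK.
  by rewrite lerDr addr_ge0 // !mulr_ge0 // exprn_ge0.
have := hc B (leqW szB) bKB.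
have : `|x * B.[x]| <= 4 * (m.+1%:R * (5 * K') * 4 ^+ m.+1).
  by rewrite normrM ler_pM.
have := ler_normD (sh B) (x * B.[x]).
rewrite -/(shear sh x A); move: hK K5.
by set a := 4 * (_ * _); move=> *; lra.
Qed.

Lemma size_int_itv (s : seq int) (a b : R) : uniq s -> a <= b ->
  all (fun j : int => a <= j%:~R <= b) s -> (size s)%:R <= b - a + 1.
Proof.
move=> us ab hs; case: s us hs => [|j1 s'] us hs.
  by rewrite addr_ge0 // subr_ge0.
set s := j1 :: s' in us hs *.
have [j0 j0s jmin] : exists2 j0, j0 \in s & all (fun j => j0 <= j) s.
  exists (head 0 (sort <=%O s)).
    by rewrite -(mem_sort <=%O) -nth0 mem_nth // size_sort.
  have hsub := sort_le_sorted s; rewrite -(all_sort _ <=%O).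
  case: (sort _ _) hsub => //= j t; rewrite lexx /=.
  by rewrite (path_sortedE le_trans) => /andP[].
pose N := Num.truncn (b - a).
have : (size s <= N.+1)%N.
  rewrite -(size_iota 0 N.+1) -(size_map (fun j => absz (j - j0))).
  apply: uniq_leq_size.
    rewrite map_inj_in_uniq // => j j' /(allP jmin) h /(allP jmin) h'; lia.
  move=> _ /mapP[j js ->]; rewrite mem_iota add0n /= ltnS.
  have h1 := allP jmin _ js.
  have /andP[h2 h3] := allP hs _ js; have /andP[h4 h5] := allP hs _ j0s.
  rewrite /N truncn_ge_nat ?subr_ge0 // natr_absz ger0_norm ?subr_ge0 // intrB.
  by move: h2 h3 h4 h5; lra.
rewrite -(ler_nat R) => h; apply: (le_trans h).
by rewrite -natr1 lerD2r truncn_le // subr_ge0.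
Qed.

Lemma count_itv (s : seq int) (c a b : R) : uniq s -> a <= b ->
  (count (fun j : int => a <= j%:~R / T + c <= b) s)%:R <= T * (b - a) + 1.
Proof.
move=> us ab; rewrite -size_filter.
apply: (le_trans (@size_int_itv _ (T * (a - c)) (T * (b - c)) _ _ _)).
- exact: filter_uniq.
- by rewrite ler_pM2l // lerD2r.
- apply/allP => j; rewrite mem_filter => /andP[/andP[h1 h2] _].
  have -> : j%:~R = T * (j%:~R / T) by rewrite mulrC divfK // gt_eqF.
  by rewrite !ler_pM2l // lerBlDr h1 lerBrDr h2.
by rewrite lerD2r -mulrBr ler_pM2l //; lra.
Qed.

(** Given the previous coefficients, the next one is confined to [-K, K], which leaves at most 2 K T
    + 1 integers whatever the shift. The point is that only O(T^m) fibers can contribute an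
    error. *)
Lemma count_bounded_fam K u sh M m : 0 <= K ->
  (count (fun i => bounded K (fam sh (fam0 u) i)) (box M m))%:R <= (2 * K * T + 1) ^+ m.
Proof.
move=> K0; have c0 : 0 <= 2 * K * T + 1 by rewrite addr_ge0 // !mulr_ge0 // ltW.
elim: m => [|m IH]; first by rewrite expr0 (ler_nat R _ 1) (leq_trans (count_size _ _)).
rewrite exprSr; apply: le_trans (ler_wpM2r c0 IH).
rewrite -!sum1_count !natr_sum big_mkcond big_box.
rewrite mulr_suml [X in _ <= X]big_mkcond; apply: ler_sum => i _.
have hb j : bounded K (fam sh (fam0 u) (rcons i j)) ->
    bounded K (fam sh (fam0 u) i) /\ `|j%:~R / T + sh (fam sh (fam0 u) i)| <= K.
  move=> /(boundedP _ K0); rewrite fam_rcons /step mulrC => h; split.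
    by apply/boundedP => // k; have := h k.+1; rewrite coefD coefMX coefC /= addr0.
  by have := h 0%N; rewrite coefD coefMX coefC /= add0r.
case: ifP => bi; last first.
  by rewrite big1 // => j _; case: ifP => // /hb[]; rewrite bi.
rewrite mul1r -big_mkcond -natr_sum sum1_count.
apply: (@le_trans _ _ (T * (K - - K) + 1)); last first.
  by rewrite opprK mulrC -mulr2n mulr_natl lexx.
have := @count_itv (zrange M) (sh (fam sh (fam0 u) i)) (- K) K (zrange_uniq M).
rewrite ge0_cp // => /(_ isT); apply: le_trans; rewrite ler_nat.
by apply: sub_count => j /hb[_]; rewrite ler_norml.
Qed.

End Families.
(** * From lattice sums to integrals *)

Section ElementaryIntegral.
Variable R : rcfType.
Implicit Types (p q a b e x : R) (G H : {poly R}) (s : seq (R * R * {poly R})).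

Lemma sub_count_lt (I : eqType) (P Q : pred I) (s : seq I) (e : I) :
  subpred P Q -> e \in s -> Q e -> ~~ P e -> (count P s < count Q s)%N.
Proof.
move=> PQ; elim: s => //= i s IH; rewrite inE => /predU1P[-> Qi nPi|es Qe nPe].
  by rewrite Qi (negPf nPi) add0n add1n ltnS; apply: sub_count.
have := IH es Qe nPe; case: (boolP (P i)) => [/PQ -> |_]; rewrite ?add1n ?ltnS //.
by move=> h; rewrite add0n (leq_trans h) // leq_addl.
Qed.

Definition endpoints s := [seq t.1.1 | t <- s] ++ [seq t.1.2 | t <- s].

Definition cut (f : R -> R) s := [seq ((f t.1.1, f t.1.2), t.2) | t <- s].

Lemma endpoints_cut f s : endpoints (cut f s) = map f (endpoints s).
Proof. by rewrite /endpoints map_cat -!map_comp. Qed.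

Definition inside x (t : R * R * {poly R}) := t.1.1 < x < t.1.2.

(* [\sum_t 1_(p_t, q_t) H_t^`()] is integrated piecewise, by cutting at the end points. *)
Lemma step_integral eps G s a b : a <= b ->
  all (fun t => [&& a <= t.1.1, t.1.1 <= t.1.2 & t.1.2 <= b]) s ->
  (forall x, a < x < b -> x \notin endpoints s ->
     `|\sum_(t <- s) (inside x t)%:R * t.2^`().[x] - G^`().[x]| <= eps) ->
  `|\sum_(t <- s) (t.2.[t.1.2] - t.2.[t.1.1]) - (G.[b] - G.[a])| <= eps * (b - a).
Proof.
(* Induction on the number of end points strictly inside (a, b). Cutting at one of them, e, by min
   and max with e moves it to the boundary of both halves. *)
have [n] := ubnP (count (fun v => a < v < b) (endpoints s)).
elim: n a b s => // n IH a b s; rewrite ltnS => cn ab hs hx.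
have [/hasP[e es /andP[ae eb]]|] := boolP (has (fun v => a < v < b) (endpoints s)).
  have IH1 := IH a e (cut (fun v => Num.min v e) s).
  have IH2 := IH e b (cut (fun v => Num.max v e) s).
  have -> : \sum_(t <- s) (t.2.[t.1.2] - t.2.[t.1.1]) - (G.[b] - G.[a]) =
      (\sum_(t <- cut (fun v => Num.min v e) s) (t.2.[t.1.2] - t.2.[t.1.1])
         - (G.[e] - G.[a])) +
      (\sum_(t <- cut (fun v => Num.max v e) s) (t.2.[t.1.2] - t.2.[t.1.1])
         - (G.[b] - G.[e])).
    rewrite !big_map addrACA -big_split /=; congr (_ + _); last by ring.
    apply: eq_bigr => -[[p q] H] _ /=.
    have mm v : H.[v] = H.[Num.min v e] + H.[Num.max v e] - H.[e].
      by case: (leP v e) => _; ring.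
    by rewrite [H.[q]]mm [H.[p]]mm; ring.
  have -> : eps * (b - a) = eps * (e - a) + eps * (b - e) by ring.
  apply: (le_trans (ler_normD _ _)); apply: lerD.
    apply: IH1; rewrite ?ltW //.
    - rewrite endpoints_cut count_map (leq_trans _ cn) //.
      apply: (@sub_count_lt _ _ _ _ e); rewrite ?ae ?eb //=; last first.
        by rewrite minxx ltxx andbF.
      move=> v /=; rewrite lt_min gt_min ltxx orbF => /andP[/andP[-> _] ve].
      exact: lt_trans eb.
    - rewrite all_map; apply: sub_all hs => -[[p q] H] /= /and3P[ap pq qb].
      apply/and3P; split; first by rewrite le_min ap ltW.
        by rewrite le_min !ge_min pq lexx orbT.
      by rewrite ge_min lexx orbT.
    move=> x /andP[ax xe]; rewrite endpoints_cut => xE.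
    have xE' : x \notin endpoints s.
      apply: contra xE => xs; apply/mapP; exists x => //.
      by rewrite min_l // ltW.
    have := hx x; rewrite ax (lt_trans xe eb) => /(_ isT xE').
    rewrite big_map; congr (`|_ - _| <= _); apply: eq_bigr => -[[p q] H] _.
    by rewrite /inside /= gt_min lt_min xe andbT (ltNge e) (ltW xe) orbF.
  apply: IH2; rewrite ?ltW //.
  - rewrite endpoints_cut count_map (leq_trans _ cn) //.
    apply: (@sub_count_lt _ _ _ _ e); rewrite ?ae ?eb //=; last first.
      by rewrite maxxx ltxx.
    move=> v /=; rewrite lt_max gt_max ltxx orbF => /andP[ev /andP[-> _]].
    by rewrite andbT; apply: lt_trans ev.
  - rewrite all_map; apply: sub_all hs => -[[p q] H] /= /and3P[ap pq qb].
    apply/and3P; split; first by rewrite le_max lexx orbT.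
      by rewrite ge_max !le_max pq lexx orbT.
    by rewrite ge_max qb ltW.
  move=> x /andP[ex xb]; rewrite endpoints_cut => xE.
  have xE' : x \notin endpoints s.
    apply: contra xE => xs; apply/mapP; exists x => //.
    by rewrite max_l // ltW.
  have := hx x; rewrite xb (lt_trans ae ex) => /(_ isT xE').
  rewrite big_map; congr (`|_ - _| <= _); apply: eq_bigr => -[[p q] H] _.
  by rewrite /inside /= gt_max lt_max ex andbT (ltNge x e) (ltW ex) orbF.
move=> /hasPn nE; move: ab; rewrite le_eqVlt => /predU1P[ab|ab].
  rewrite -ab !subrr mulr0 subr0 big_seq big1 ?normr0 // => -[[p q] H] ts /=.
  have /and3P[/= ap pq qb] := allP hs _ ts.
  by rewrite (_ : p = q) ?subrr //; apply/eqP; rewrite eq_le pq (le_trans qb) // -ab.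
(* Without interior end points each interval is either all of [a, b] or reduced to a point, so one
   application of the mean value theorem to [F] suffices. *)
pose full (t : R * R * {poly R}) := (t.1.1 == a) && (t.1.2 == b).
pose F : {poly R} := \sum_(t <- s | full t) t.2 - G.
have pqE t : t \in s -> ((t.1.1 == a) || (t.1.1 == b)) && ((t.1.2 == a) || (t.1.2 == b)).
  move=> ts; have /and3P[ap pq qb] := allP hs _ ts.
  have := nE t.1.1; rewrite mem_cat (map_f (fun t => t.1.1) ts) => /(_ isT).
  have := nE t.1.2; rewrite mem_cat (map_f (fun t => t.1.2) ts) orbT => /(_ isT).
  rewrite !negb_and -!leNgt => /orP h1 /orP h2; rewrite !eq_le.
  rewrite ap qb (le_trans ap pq) (le_trans pq qb) !andbT /=.
  by apply/andP; split; apply/orP.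
have [c cI ec] := poly_mvt F ab; move: cI; rewrite in_itv /= => cI.
have -> : \sum_(t <- s) (t.2.[t.1.2] - t.2.[t.1.1]) - (G.[b] - G.[a]) = F.[b] - F.[a].
  rewrite /F !hornerD !hornerN !horner_sum.
  transitivity (\sum_(t <- s | full t) (t.2.[b] - t.2.[a]) - (G.[b] - G.[a])); last first.
    by rewrite sumrB; ring.
  congr (_ - _); rewrite [RHS]big_mkcond /= !big_seq; apply: eq_bigr => -[[p q] H] ts /=.
  have /and3P[/= ap pq qb] := allP hs _ ts.
  have := pqE _ ts; rewrite /full /=.
  have [->|pa] := eqVneq p a; have [->|qb'] := eqVneq q b; rewrite //= ?orbF.
  - by move=> /eqP ->; rewrite subrr.
  - move=> /andP[/eqP -> _]; by rewrite subrr.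
  by move=> /andP[/eqP pE /eqP qE]; move: pq ab; rewrite pE qE leNgt => /negP.
rewrite ec normrM (gtr0_norm (_ : 0 < b - a)) ?subr_gt0 // ler_pM2r ?subr_gt0 //.
have := hx c cI; rewrite /F derivD derivN hornerD hornerN.
have -> : c \notin endpoints s by apply/negP => /nE; rewrite cI.
move=> /(_ isT); rewrite raddf_sum horner_sum; congr (`|_ - _| <= _).
rewrite [RHS]big_mkcond !big_seq; apply: eq_bigr => -[[p q] H] ts.
have /and3P[/= ap pq qb] := allP hs _ ts; have := pqE _ ts.
rewrite /full /inside /=; case/andP: cI => ac cb.
have [->|pa] := eqVneq p a; have [->|qb'] := eqVneq q b; rewrite //= ?orbF.
- by rewrite ac cb mul1r.
- by move=> /eqP ->; rewrite [c < a]ltNge (ltW ac) andbF mul0r.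
- by move=> /andP[/eqP -> _]; rewrite [b < c]ltNge (ltW cb) mul0r.
by move=> /andP[/eqP -> _]; rewrite [b < c]ltNge (ltW cb) mul0r.
Qed.

End ElementaryIntegral.

(** * Riemann sums over a shifted lattice *)

Section RiemannSum.
Variable R : realType.
Variables (T : R).
Hypothesis T1 : 1 <= T.
Let T0 : 0 < T. Proof. exact: lt_le_trans T1. Qed.

Lemma telescope_zrange M (f : R -> R) (c : R) :
  \sum_(j <- zrange M) (f ((j%:~R + 1) / T + c) - f (j%:~R / T + c)) =
  f ((M%:R + 1) / T + c) - f (- M%:R / T + c).
Proof.
rewrite big_map.
have := @telescope_sumr R 0 (2 * M).+1 (fun i => f ((i%:R - M%:R) / T + c)) isT.
rewrite /index_iota subn0 sub0r => h.
rewrite -[in RHS](_ : (2 * M).+1%:R - M%:R = M%:R + 1 :> R).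
  rewrite -h; apply: eq_bigr => i _.
  by rewrite !intrB -!pmulrn -natr1; congr (f (_ / _ + _) - _); ring.
by rewrite -natr1 natrM; ring.
Qed.

Lemma poly_mvt_le (p : {poly R}) (a b v w G : R) : a <= v -> v <= w -> w <= b ->
  (forall x, a <= x <= b -> `|p^`().[x]| <= G) -> `|p.[w] - p.[v]| <= G * (w - v).
Proof.
move=> av; rewrite le_eqVlt => /predU1P[-> _ _|vw wb hG].
  by rewrite !subrr normr0 mulr0.
have [x] := poly_mvt p vw; rewrite in_itv /= => /andP[vx xw] ->.
rewrite normrM (gtr0_norm (_ : 0 < w - v)) ?subr_gt0 // ler_pM2r ?subr_gt0 //.
by apply: hG; rewrite (le_trans av (ltW vx)) (le_trans (ltW xw) wb).
Qed.

(** Each term is compared with the increment over [v, v + 1 / T] of the primitive clamped to [A, B].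
    Inside, at most T (B - A) + 1 terms differ by G2 / T^2 each. Near the two ends at most four
    terms differ by 2 G1 / T each. Nothing is assumed about [E] at A and B themselves. *)
Lemma riemann_zrange M (w : {poly R}) (E : R -> bool) (A B G1 G2 c : R) :
  A <= B -> - M%:R / T + c <= A -> B <= (M%:R + 1) / T + c ->
  (forall v, A <= v <= B -> `|w.[v]| <= G1) ->
  (forall v, A <= v <= B -> `|w^`().[v]| <= G2) ->
  (forall v, A < v < B -> E v) -> (forall v, E v -> A <= v <= B) ->
  `|T^-1 * \sum_(j <- zrange M) (E (j%:~R / T + c))%:R * w.[j%:~R / T + c]
     - ((prim w).[B] - (prim w).[A])| <= (G2 * (B - A + 1) + 8 * G1) / T.
Proof.
move=> AB hA hB h1 h2 E1 E2.
have G10 : 0 <= G1 by apply: le_trans (h1 A _) => //; rewrite lexx.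
have G20 : 0 <= G2 by apply: le_trans (h2 A _) => //; rewrite lexx.
pose clamp v := Num.max A (Num.min v B).
pose W v := (prim w).[clamp v].
have cl1 v : v <= A -> clamp v = A.
  by move=> vA; rewrite /clamp min_l ?max_l // (le_trans vA).
have cl2 v : B <= v -> clamp v = B.
  by move=> vB; rewrite /clamp min_r ?max_r.
have cl3 v : A <= v <= B -> clamp v = v.
  by move=> /andP[vA vB]; rewrite /clamp min_l ?max_r.
have clI v : A <= clamp v <= B.
  by rewrite /clamp le_max lexx ge_max AB ge_min lexx orbT.
have cl_mono v v' : v <= v' -> clamp v <= clamp v' /\ clamp v' - clamp v <= v' - v.
  move=> vv'; rewrite /clamp; case: (leP v B) => h3; case: (leP v' B) => h4;
    case: (leP A v) => h5; case: (leP A v') => h6; rewrite ?(max_r AB); split; lra.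
have Winc v v' : v <= v' -> `|W v' - W v| <= G1 * (v' - v).
  move=> /cl_mono[h3 h4]; apply: (@le_trans _ _ (G1 * (clamp v' - clamp v))).
    apply: (@poly_mvt_le _ A B) => //; first by case/andP: (clI v).
      by case/andP: (clI v').
    by move=> x /h1; rewrite deriv_prim.
  by apply: ler_wpM2l.
have -> : (prim w).[B] - (prim w).[A] =
   \sum_(j <- zrange M) (W ((j%:~R + 1) / T + c) - W (j%:~R / T + c)).
  by rewrite telescope_zrange /W (cl2 _ hB) (cl1 _ hA).
rewrite mulr_sumr -sumrB.
pose n1 (v : R) := (A <= v <= B)%R.
pose n2 (v : R) := (A - T^-1 <= v <= A)%R.
pose n3 (v : R) := (B - T^-1 <= v <= B)%R.
have Ti0 : 0 < T^-1 by rewrite invr_gt0.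
have key (v : R) : `|T^-1 * ((E v)%:R * w.[v]) - (W (v + T^-1) - W v)| <=
   G2 / T ^+ 2 * (n1 v)%:R + 2 * G1 / T * ((n2 v)%:R + (n3 v)%:R).
  have p1 : 0 <= G2 / T ^+ 2 * (n1 v)%:R by rewrite !mulr_ge0 ?invr_ge0 ?exprn_ge0 // ltW.
  have p2 : 0 <= 2 * G1 / T by rewrite !mulr_ge0 // ltW.
  have inc : `|W (v + T^-1) - W v| <= G1 * T^-1.
    by have := Winc v (v + T^-1); rewrite [_ + _ - v]addrAC subrr add0r; apply; lra.
  have tot : `|T^-1 * ((E v)%:R * w.[v]) - (W (v + T^-1) - W v)| <= 2 * G1 / T.
    apply: (le_trans (ler_normB _ _)).
    have -> : 2 * G1 / T = G1 / T + G1 / T by ring.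
    apply: lerD => //; rewrite mulrC normrM (gtr0_norm Ti0) ler_pM2r //.
    by case: (boolP (E v)) => [/E2/h1|_]; rewrite ?mul1r // mul0r normr0.
  have [vA|vA] := ltP v (A - T^-1).
    have nE : E v = false by apply/negP => /E2; lra.
    rewrite nE mul0r mulr0 /W !cl1 ?subrr ?normr0; try lra.
    by rewrite addr_ge0 // mulr_ge0 // addr_ge0.
  have [vA'|vA'] := leP v A.
    rewrite /n2 vA vA' /=; apply: (le_trans tot).
    have := mulr_ge0 p2 (ler0n R (n3 v)); rewrite mulrDr mulr1; lra.
  have [vB|vB] := ltP v (B - T^-1); last first.
    have [vB'|vB'] := leP v B.
      rewrite /n3 vB vB' /=; apply: (le_trans tot).
      have := mulr_ge0 p2 (ler0n R (n2 v)); rewrite mulrDr mulr1; lra.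
    have nE : E v = false by apply/negP => /E2; lra.
    rewrite nE mul0r mulr0 /W !cl2 ?subrr ?normr0; try lra.
    by rewrite addr_ge0 // mulr_ge0 // addr_ge0.
  have vI : A <= v <= B by apply/andP; split; lra.
  have vI' : A <= v + T^-1 <= B by apply/andP; split; lra.
  rewrite E1 ?vA' /=; last by lra.
  rewrite /n1 vI mul1r /W !cl3 // mulr1.
  apply: (@le_trans _ _ (G2 / T ^+ 2)); last first.
    by rewrite lerDl mulr_ge0 // addr_ge0.
  have vv : v < v + T^-1 by rewrite ltrDl.
  have [x] := poly_mvt (prim w) vv; rewrite in_itv /= deriv_prim => /andP[vx xv] ->.
  rewrite [v + _ - v]addrAC subrr add0r mulrC -mulrBl normrM (gtr0_norm Ti0).
  rewrite expr2 invfM mulrA ler_pM2r // distrC.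
  apply: (@le_trans _ _ (G2 * (x - v))).
    by apply: (@poly_mvt_le w A B) => //; [case/andP: vI | exact: ltW | case/andP: vI'; lra].
  by apply: ler_wpM2l => //; lra.
apply: (le_trans (ler_norm_sum _ _ _)).
apply: (@le_trans _ _ (\sum_(j <- zrange M) (G2 / T ^+ 2 * (n1 (j%:~R / T + c))%:R +
   2 * G1 / T * ((n2 (j%:~R / T + c))%:R + (n3 (j%:~R / T + c))%:R)))).
  apply: ler_sum => j _; have := key (j%:~R / T + c); congr (`|_ - (W _ - _)| <= _).
  by rewrite mulrDl mul1r addrAC.
rewrite big_split /= -!mulr_sumr big_split /= -!natr_sum.
have cnt (a b : R) : a <= b -> (\sum_(j <- zrange M) (a <= j%:~R / T + c <= b)%R)%N%:R <= T * (b - a) + 1 :> R.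
  move=> ab; apply: le_trans (count_itv T0 c (zrange_uniq M) ab).
  rewrite -sum1_count ler_nat; apply: eq_leq; rewrite [RHS]big_mkcond; apply: eq_bigr => j _.
  by case: (_ <= _ <= _).
have c1 := cnt _ _ AB.
(* A closed interval of length 1 / T meets the lattice of step 1 / T in at most two points. *)
have c2 : (\sum_(j <- zrange M) n2 (j%:~R / T + c)%R)%N%:R <= 2 :> R.
  apply: (le_trans (cnt (A - T^-1) A _)); first by rewrite gerBl ltW.
  by rewrite opprB [A + _]addrC subrK divff ?gt_eqF.
have c3 : (\sum_(j <- zrange M) n3 (j%:~R / T + c)%R)%N%:R <= 2 :> R.
  apply: (le_trans (cnt (B - T^-1) B _)); first by rewrite gerBl ltW.
  by rewrite opprB [B + _]addrC subrK divff ?gt_eqF.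
apply: (@le_trans _ _ (G2 / T ^+ 2 * (T * (B - A) + 1) + 2 * G1 / T * (2 + 2))).
  apply: lerD; first by apply: ler_wpM2l; rewrite // !mulr_ge0 ?invr_ge0 ?exprn_ge0 // ltW.
  by apply: ler_wpM2l; rewrite ?lerD // !mulr_ge0 // ltW.
have t1 : T^-1 <= 1 by rewrite invf_le1.
have tt : T * T^-1 = 1 by rewrite divff // gt_eqF.
have -> : G2 / T ^+ 2 * (T * (B - A) + 1) + 2 * G1 / T * (2 + 2) =
   (G2 * (B - A) * (T * T^-1) + G2 * T^-1 + 8 * G1) / T.
  by rewrite expr2 invfM; ring.
rewrite tt mulr1 ler_pM2r // lerD2r [X in _ <= X]mulrDr lerD2l mulr1.
by rewrite ler_piMr.
Qed.

End RiemannSum.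

(** * One fiber: the sum over the constant coefficient *)

Section Fiber.
Variable R : realType.
Implicit Types (A B P Q : {poly R}).

(** The end points are the infimum and the supremum of J. Whether they belong to J is left open. *)
Lemma convex_endpoints (J : R -> Prop) (X : R) : (exists x, J x) ->
  (forall x, J x -> 0 < x < X) ->
  (forall x1 x2 x, J x1 -> J x2 -> x1 < x < x2 -> J x) ->
  exists p q, [/\ 0 <= p, p <= q, q <= X, forall x, J x -> p <= x <= q
     & forall x, p < x < q -> J x].
Proof.
move=> [x0 Jx0] JX Jc.
have ubJ : has_ubound J by exists X => x /JX/andP[_ /ltW].
have lbJ : has_lbound J by exists 0 => x /JX/andP[/ltW].
have le x : J x -> inf J <= x <= sup J.
  by move=> Jx; apply/andP; split; [apply: ge_inf | apply: ub_le_sup].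
exists (inf J), (sup J); split.
- by apply: lb_le_inf; [exists x0 | move=> x /JX/andP[/ltW]].
- by have /andP[] := le _ Jx0; apply: le_trans.
- by apply: ge_sup; [exists x0 | move=> x /JX/andP[_ /ltW]].
- exact: le.
move=> x /andP[ix xs].
have [||x1 Jx1 h1] := @inf_adherent _ J (x - inf J); first by rewrite subr_gt0.
  by split=> //; exists x0.
have [||x2 Jx2 h2] := @sup_adherent _ J (sup J - x); first by rewrite subr_gt0.
  by split=> //; exists x0.
by apply: (Jc x1 x2) => //; apply/andP; split; lra.
Qed.

Lemma good_mulXsub m x P : P != 0 -> good m x (('X - x%:P) * P) = good m x P.
Proof.
move=> P0; rewrite /good; congr (_ <= size _)%N.
apply: lt_sorted_eq; rewrite ?sorted_roots // => y.
rewrite !in_roots P0 mulf_neq0 ?polyXsubC_eq0 // !andbT rootM root_XsubC in_itv /=.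
by case: eqVneq => // ->; rewrite ltxx !andbF.
Qed.

Lemma bounded_mulXsub K P (a : R) : 0 <= K -> bounded K P -> `|a| <= 4 ->
  bounded (5 * K) (('X - a%:P) * P).
Proof.
move=> K0 /(boundedP _ K0) hP ha; apply/boundedP => [|k]; first by rewrite mulr_ge0.
rewrite mulrBl coefB coefXM coefCM (_ : 5 * K = K + 4 * K); last by ring.
apply: (le_trans (ler_normB _ _)); apply: lerD; last by rewrite normrM ler_pM.
by case: ifP => _; rewrite ?normr0.
Qed.

Lemma bounded_prod_XsubC K (a : seq R) P : 0 <= K -> all (fun y => `|y| <= 4) a ->
  bounded K P -> bounded (5 ^+ size a * K) (\prod_(y <- a) ('X - y%:P) * P).
Proof.
move=> K0 + hP; elim: a => [|y a IH] /=; first by rewrite big_nil !mul1r.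
case/andP => y4 /IH {}IH; rewrite big_cons -mulrA exprS -mulrA.
by apply: bounded_mulXsub => //; apply: mulr_ge0 => //; apply: exprn_ge0.
Qed.

Variables (T : R).
Hypothesis T1 : 1 <= T.
Let T0 : 0 < T. Proof. exact: lt_le_trans T1. Qed.

(** The linear cofactor of the m roots has coefficients at most 1, as u <= 1 and T >= 1, and each
    factor X - a with 0 < a < 4 enlarges a coefficient bound at most 1 + 4 times. *)
Lemma good_bounded u m x P : u <= 1 -> shape T u m P -> 4 * m.+1%:R / T < u -> x <= 4 ->
  good m x P -> bounded (5 ^+ m) P.
Proof.
move=> u1 sh hu x4 /(goodP _ _ (shape_neq0 sh))[a ha].
have [c hc] := shape_pos T0 sh hu x4 ha.
have [sza sa aI ar] := ha.
have := shape_factor sh sza (lt_sorted_uniq sa) ar; set c' := u - _ => -> Pc.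
have c'1 : c' <= 1.
  rewrite /c' lerBlDr (le_trans u1) // lerDl; apply: mulr_ge0.
    by rewrite invr_ge0 ltW.
  by rewrite big_seq; apply: sumr_ge0 => y /(allP aI)/andP[/ltW].
have c'c : c' = c.
  have A0 : \prod_(y <- a) ('X - y%:P) != 0 :> {poly R}.
    exact: monic_neq0 (monic_prod_XsubC _ _ _).
  have := mulfI A0 Pc => /addIr /polyC_inj; exact.
have c'0 : 0 < c' by rewrite c'c (lt_trans _ hc) // divr_gt0.
have hb : bounded 1 (c'%:P - T^-1 *: 'X).
  apply/boundedP => // k; rewrite coefB coefC coefZ coefX.
  case: k => [|[|k]] /=; rewrite ?mulr0 ?mulr1 ?subr0 ?sub0r ?normrN ?normr0 //.
    by rewrite ger0_norm // ltW.
  by rewrite ger0_norm ?invf_le1 // invr_ge0 (ltW T0).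
rewrite -sza -[5 ^+ _]mulr1; apply: bounded_prod_XsubC => //.
by apply: sub_all aI => y /andP[y0 yx]; rewrite ger0_norm ?(ltW y0) // (ltW (lt_le_trans yx x4)).
Qed.


Section OneFiber.
Variables (u : R) (m : nat) (B : {poly R}) (X : R).
Let Q := 'X * B.
Hypotheses (u1 : u <= 1) (sB : shape T u m B) (hu : 4 * m.+2%:R / T < u).
Hypotheses (X4 : X <= 4).

(* The values [x] of the largest root of [Q + c], over all admissible [c]. *)
Definition slice x := (0 < x < X) && good m x (Q - Q.[x]%:P).

Let sQ : shape T u m.+1 Q.
Proof. by have := shape_mulX 0 sB; rewrite addr0. Qed.

Let Q0 c : Q - c%:P != 0.
Proof. exact: shape_neq0 (shape_subC c sQ). Qed.

Lemma slice_deriv x : slice x -> 0 < Q^`().[x].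
Proof.
case/andP => /andP[x0 xX] /goodP-/(_ (Q0 _))[a ha].
by apply: (deriv_top_root T0 sQ hu _ ha); rewrite x0 (lt_le_trans xX).
Qed.

Lemma slice_convex x1 x2 x : slice x1 -> slice x2 -> x1 < x < x2 -> slice x.
Proof.
case/andP => /andP[x10 x1X] /goodP-/(_ (Q0 _))[a ha].
case/andP => /andP[x20 x2X] /goodP-/(_ (Q0 _))[b hb] xI.
have /andP[xx1 xx2] := xI.
rewrite /slice (lt_trans x10) // (lt_trans xx2) //=; apply/goodP => //.
exact: (good_convex T0 sQ hu x10 (le_trans (ltW x2X) X4) ha hb xI).
Qed.

Lemma good_slice c : reflect (exists2 x, slice x & c = - Q.[x]) (good m.+1 X (Q + c%:P)).
Proof.
have Qc0 : Q + c%:P != 0 by have := Q0 (- c); rewrite polyCN opprK.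
apply: (iffP (goodP _ _ Qc0)) => [[a [sza sa aI ar]]|[x]].
  case/lastP: a sza sa aI ar => [//|a x]; rewrite size_rcons => -[sza] sa.
  rewrite !all_rcons => /andP[/andP[x0 xX] aI] /andP[xr ar].
  have cE : c = - Q.[x] by move: xr; rewrite rootE !hornerE addrC addr_eq0 => /eqP.
  exists x => //; rewrite /slice x0 xX /=; apply/goodP => //.
  exists a; split=> //.
  - by move: sa; rewrite lt_sorted_pairwise pairwise_rcons -lt_sorted_pairwise => /andP[].
  - apply/allP => y ya; have /andP[-> _] := allP aI _ ya.
    by move: sa; rewrite lt_sorted_pairwise pairwise_rcons => /andP[/allP/(_ _ ya)].
  - by rewrite -polyCN -cE.
case/andP => /andP[x0 xX] /goodP-/(_ (Q0 _))[a ha] ->.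
have [sza sa aI ar] := roots_in_lt_rcons x0 ha.
exists (rcons a x); split=> //; last by rewrite polyCN.
by apply: sub_all aI => y /andP[-> /le_lt_trans]; apply.
Qed.


Variables (ys : seq R) (M : nat) (c0 : R).
Hypothesis ysX : all (fun y => X <= y <= 4) ys.

(** [K] is the bound of [good_bounded] for the polynomials Q + c, and [N] that of [bounded_horner]
    for |Q(x)| with |x| <= 4. With [cov], the window [-M, M] contains all integers that make c
    admissible. *)
Let K := 5 ^+ m.+1 : R.
Let N := m.+3%:R * K * 4 ^+ m.+3.
Hypothesis cov : bounded K B -> `|c0| + N <= M%:R / T.

Let w : {poly R} := \prod_(y <- ys) ('X + (Q.[y])%:P).

Let wE c : w.[c] = \prod_(y <- ys) (Q.[y] + c).
Proof. by rewrite horner_prod; apply: eq_bigr => y _; rewrite !hornerE addrC. Qed.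

Let w_bound (D : R) (s : seq R) v : 1 <= D -> all (fun y => `|Q.[y] + v| <= D) s ->
  `|(\prod_(y <- s) ('X + (Q.[y])%:P)).[v]| <= D ^+ size s /\
  `|(\prod_(y <- s) ('X + (Q.[y])%:P))^`().[v]| <= (size s)%:R * D ^+ size s.
Proof.
move=> D1; have D0 : 0 <= D by apply: le_trans D1.
elim: s => [_|y s IH] /=.
  by rewrite !big_nil -polyC1 derivC horner0 hornerC normr0 normr1 mul0r.
case/andP => hy /IH[IH1 IH2].
have e : ('X + (Q.[y])%:P).[v] = Q.[y] + v by rewrite hornerD hornerX hornerC addrC.
rewrite !big_cons; split; first by rewrite hornerM e normrM exprS ler_pM.
rewrite derivM derivD derivX derivC addr0 mul1r hornerD hornerM e.
apply: (le_trans (ler_normD _ _)).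
rewrite (_ : _.+1%:R * _ = D ^+ (size s).+1 + (size s)%:R * D ^+ (size s).+1); last first.
  by rewrite -nat1r; ring.
apply: lerD.
  by rewrite (le_trans IH1) // exprS ler_peMl // exprn_ge0.
by rewrite normrM exprS mulrCA ler_pM.
Qed.

(** The numerator of the error in [riemann_zrange] when c runs over an interval of length at most 2
    N and each of the k factors Q(y) + c of the weight is at most 2 N. *)
Definition fiber_const k : R :=
  (k%:R * (2 * N) ^+ k) * (2 * N + 1) + 8 * (2 * N) ^+ k.

(** H is the primitive of the weight after the substitution c = - Q(x), whence the factor Q' in its
    derivative. The indicator in the error records that a fiber with an admissible c has a bounded
    B. Other fibers contribute exactly 0, so [count_bounded_fam] controls the total error. *)
Lemma fiber_estimate : exists (p q : R) (H : {poly R}),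
  [/\ [&& 0 <= p, p <= q & q <= Num.max 0 X],
     forall x : R, 0 < x < X -> x != p -> x != q -> (p < x < q) = good m x (Q - Q.[x]%:P),
     forall x, H^`().[x] = (\prod_(y <- ys) (Q.[y] - Q.[x])) * Q^`().[x]
   & `|T^-1 * \sum_(j <- zrange M) (good m.+1 X (Q + (j%:~R / T + c0)%:P))%:R *
          \prod_(y <- ys) (Q + (j%:~R / T + c0)%:P).[y] - (H.[q] - H.[p])|
     <= fiber_const (size ys) / T * (bounded K B)%:R].
Proof.
pose H := - (prim w \Po (- Q)).
have HE x : H.[x] = - (prim w).[- Q.[x]] by rewrite hornerN horner_comp hornerN.
have dH x : H^`().[x] = (\prod_(y <- ys) (Q.[y] - Q.[x])) * Q^`().[x].
  rewrite derivN deriv_comp deriv_prim derivN mulrN opprK hornerM horner_comp wE.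
  by rewrite hornerN.
have K0 : 0 <= K by apply: exprn_ge0.
have N0 : 0 <= N.
  by apply: mulr_ge0; [apply: mulr_ge0 | apply: exprn_ge0].
have N1 : 1 <= N.
  by apply: mulr_ege1; [apply: mulr_ege1; [rewrite ler1n | apply: exprn_ege1; rewrite ler1n]
    | apply: exprn_ege1; rewrite ler1n].
have F0 k : 0 <= fiber_const k.
  have D0 : 0 <= (2 * N) ^+ k by apply: exprn_ge0; apply: mulr_ge0.
  apply: addr_ge0; last by apply: mulr_ge0.
  by apply: mulr_ge0; [apply: mulr_ge0 | apply: addr_ge0 => //; apply: mulr_ge0].
have Tge0 : 0 <= T^-1 by rewrite invr_ge0 ltW.
have gQ c y : (Q + c%:P).[y] = Q.[y] + c by rewrite !hornerE.
(* If no c is admissible, the degenerate interval p = q = 0 serves, and both the sum and the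
   difference H(q) - H(p) vanish. *)
have [[x0 Jx0]|nJ] := pselect (exists x, slice x); last first.
  exists 0, 0, H; split=> //.
  - by rewrite lexx /= le_max lexx.
  - move=> x xX _ _; rewrite lt_asym; apply/esym/negP => gx.
    by apply: nJ; exists x; rewrite /slice xX.
  rewrite subrr subr0 big1 ?mulr0 ?normr0 // => [|j _].
    by apply: mulr_ge0 => //; apply: mulr_ge0.
  by case: good_slice => [[x Jx _]|_]; [case: nJ; exists x | rewrite mul0r].
have JX x : slice x -> 0 < x < X by case/andP.
have [p [q [p0 pq qX Jin Jout]]] :=
  @convex_endpoints slice X (ex_intro _ x0 Jx0) JX slice_convex.
have /andP[x00 x0X] := JX _ Jx0.
have X0 : 0 < X := lt_trans x00 x0X.
exists p, q, H; split=> //.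
- by rewrite p0 pq le_max qX orbT.
- move=> x xX xp xq; apply/idP/idP => [/Jout/andP[]//|gx].
  have /Jin/andP[px xq'] : slice x by rewrite /slice xX.
  by rewrite !lt_neqAle px xq' eq_sym xp xq.
have bQ : bounded K (Q + (- Q.[x0])%:P).
  apply: (good_bounded u1 (shape_mulX (- Q.[x0]) sB) hu X4).
  by apply/good_slice; exists x0.
have bB : bounded K B.
  apply/boundedP => // k; have /(boundedP _ K0)/(_ k.+1) := bQ.
  by rewrite coefD coefXM coefC /= addr0.
rewrite bB mulr1.
have Qb y : `|y| <= 4 -> `|Q.[y]| <= N.
  move=> y4; apply: bounded_horner => //; last by case: sQ => ->.
  apply/boundedP => // k; rewrite coefXM; case: ifP => _; first by rewrite normr0.
  by have /(boundedP _ K0) := bB; apply.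
(* Q increases on [p, q], so c = - Q(x) runs from - Q(q) to - Q(p) without repetition. *)
have incQ x1 x2 : p <= x1 -> x1 <= x2 -> x2 <= q -> Q.[x1] <= Q.[x2].
  move=> px1; rewrite le_eqVlt => /predU1P[->//|x12] x2q.
  have [x] := poly_mvt Q x12; rewrite in_itv /= => /andP[h1 h2] e.
  rewrite -subr_ge0 e mulr_ge0 ?subr_ge0 ?(ltW x12) // ltW // slice_deriv // Jout //.
  by rewrite (le_lt_trans px1 h1) (lt_le_trans h2 x2q).
have p4 : `|p| <= 4 by rewrite ger0_norm // (le_trans pq) // (le_trans qX).
have q4 : `|q| <= 4 by rewrite ger0_norm ?(le_trans qX) // (le_trans p0).
have /ler_normlP[q1 q2] := Qb q q4; have /ler_normlP[p1 p2] := Qb p p4.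
have := cov bB; have := ler_norm c0; have := ler_norm (- c0); rewrite normrN => nc1 nc2 hcov.
have AB : - Q.[q] <= - Q.[p] by rewrite lerN2 incQ.
have Mneg : - M%:R / T = - (M%:R / T) :> R by rewrite mulNr.
have Mp : (M%:R + 1) / T = M%:R / T + T^-1 :> R by rewrite mulrDl mul1r.
have wb v : - Q.[q] <= v <= - Q.[p] -> `|w.[v]| <= (2 * N) ^+ size ys /\
    `|w^`().[v]| <= (size ys)%:R * (2 * N) ^+ size ys.
  move=> /andP[v1 v2]; apply: w_bound.
    lra.
  apply: sub_all ysX => y /andP[Xy y4].
  have := Qb y; rewrite ger0_norm ?(le_trans (ltW X0)) // => /(_ y4).
  by rewrite !ler_norml => /andP[h1 h2]; apply/andP; split; lra.
have := @riemann_zrange _ T T1 M w (fun v => good m.+1 X (Q + v%:P)) (- Q.[q]) (- Q.[p])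
  ((2 * N) ^+ size ys) ((size ys)%:R * (2 * N) ^+ size ys) c0 AB.
case/(_ _ _ _ _ _ _)/wrap.
- by rewrite Mneg; lra.
- by rewrite Mp; lra.
- by move=> v /wb[].
- by move=> v /wb[].
- move=> v /andP[v1 v2]; apply/good_slice.
  have [||x] := @poly_ivtoo _ (Q + v%:P) p q; first exact: pq.
    by rewrite !gQ nmulr_rlt0; lra.
  rewrite in_itv /= rootE gQ addr_eq0 => /Jout Jx /eqP e.
  by exists x => //; rewrite e opprK.
- move=> v /good_slice[x /Jin/andP[px xq] ->].
  by rewrite !lerN2 !incQ.
move/le_trans => /(_ (fiber_const (size ys) / T)) h; have {h} := h _; rewrite !HE.
have h2 : (size ys)%:R * (2 * N) ^+ size ys * (- Q.[p] - - Q.[q] + 1) +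
    8 * (2 * N) ^+ size ys <= fiber_const (size ys).
  rewrite lerD2r; apply: ler_wpM2l; last by lra.
  by apply: mulr_ge0 => //; apply: exprn_ge0; apply: mulr_ge0.
move=> /(_ _)/wrap[]; first by rewrite ler_pM2r ?invr_gt0.
congr (`|_ * _ - _| <= _); last by rewrite opprK addrC.
by apply: eq_bigr => j _; congr (_ * _); rewrite wE; apply: eq_bigr => y _; rewrite gQ.
Qed.

End OneFiber.
End Fiber.

(** * Induction on the dimension of the lattice *)

Section LatticeCount.
Variable R : realType.

Definition lattice_avg (T : R) (M m : nat) sh u X (ys : seq R) : R :=
  T ^- m * \sum_(i <- box M m) (good m X (fam T sh (fam0 T u) i))%:R *
    \prod_(y <- ys) (fam T sh (fam0 T u) i).[y].

Lemma prod_near1 (s : seq R) (D : R) : 0 <= D ->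
  all (fun v => (0 <= v <= 1) && (1 - D <= v)) s ->
  `|\prod_(v <- s) v - 1| <= (size s)%:R * D.
Proof.
move=> D0; elim: s => [|v s IH] /=; first by rewrite big_nil subrr normr0 mul0r.
case/andP => /andP[/andP[v0 v1] vD] /IH {}IH; rewrite big_cons.
set P := \prod_(v <- s) v in IH *.
have -> : v * P - 1 = v * (P - 1) - (1 - v) by ring.
apply: (le_trans (ler_normB _ _)).
rewrite (_ : _.+1%:R * _ = (size s)%:R * D + D); last by rewrite -natr1; ring.
apply: lerD; last by rewrite ger0_norm ?subr_ge0 // lerBlDl -lerBlDr.
rewrite normrM ger0_norm //; apply: le_trans IH.
by rewrite ler_piMl.
Qed.

Lemma lattice_avg_base d (T u X : R) ys sh M : 0 < T -> (d + 4)%:R < T ->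
  1 - d%:R / T <= u -> u <= 1 -> 0 <= X -> all (fun y => X <= y <= 4) ys ->
  `|lattice_avg T M 0 sh u X ys - simplexint 0 X ys| <= (size ys)%:R * (d + 4)%:R / T.
Proof.
move=> T0 hT u0 u1 X0 hys.
rewrite /lattice_avg expr0 invr1 mul1r big_seq1 /good leq0n mul1r /simplexint /= hornerC.
have -> : \prod_(y <- ys) (fam T sh (fam0 T u) [::]).[y] =
          \prod_(v <- [seq u - y / T | y <- ys]) v.
  by rewrite big_map; apply: eq_bigr => y _; rewrite /fam /= !hornerE [_ * y]mulrC.
rewrite -mulrA -(size_map (fun y => u - y / T)); apply: prod_near1.
  by rewrite mulr_ge0 // invr_ge0 ltW.
rewrite all_map; apply: sub_all hys => y /andP[Xy y4] /=.
have y0 : 0 <= y / T by rewrite mulr_ge0 ?invr_ge0 ?(ltW T0) // (le_trans X0).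
have y4T : y / T <= 4 / T by rewrite ler_pM2r ?invr_gt0.
have : (d + 4)%:R / T < 1 by rewrite ltr_pdivrMr // mul1r.
rewrite natrD mulrDl => h; apply/andP; split; [apply/andP; split|]; lra.
Qed.

(** At a given x, the densities of all fibers add up to a lattice average of one dimension less, for
    the quotients by X - x with weight points x :: ys, times the product of the y - x. By the
    induction hypothesis this is close to the density of [simplexint], which obeys the same
    recursion by [simplexint_densE]. As x <= 4, the defect d of u = 1 - O(d / T) grows by at most
    4. *)
Lemma lattice_avg_step (m d k : nat) (K' C' : R) : 0 <= K' -> 0 <= C' ->
  (forall (T u X : R) (ys : seq R) sh M, (d + 4 + 4 * m.+1)%:R < T ->
     1 - (d + 4)%:R / T <= u -> u <= 1 -> 0 <= X <= 4 -> all (fun y => X <= y <= 4) ys ->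
     size ys = k.+1 -> covers T K' m M sh ->
     `|lattice_avg T M m sh u X ys - simplexint m X ys| <= C' / T) ->
  exists K C, [/\ 0 <= K, 0 <= C & forall (T u X : R) (ys : seq R) sh M, (d + 4 * m.+2)%:R < T ->
     1 - d%:R / T <= u -> u <= 1 -> 0 <= X <= 4 -> all (fun y => X <= y <= 4) ys ->
     size ys = k -> covers T K m.+1 M sh ->
     `|lattice_avg T M m.+1 sh u X ys - simplexint m.+1 X ys| <= C / T].
Proof.
move=> K'0 C'0 IH.
pose K0 : R := 5 ^+ m.+1.
pose N : R := m.+3%:R * K0 * 4 ^+ m.+3.
pose K1 : R := K' + 4 * (m.+1%:R * (5 * K') * 4 ^+ m.+1) + 5 * K'.
pose F := fiber_const R m k.
have K00 : 0 <= K0 by apply: exprn_ge0.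
have N0 : 0 <= N by apply: mulr_ge0; [apply: mulr_ge0 | apply: exprn_ge0].
have K10 : 0 <= K1.
  apply: addr_ge0; last by apply: mulr_ge0.
  apply: addr_ge0 => //; apply: mulr_ge0 => //; apply: mulr_ge0; last exact: exprn_ge0.
  by apply: mulr_ge0 => //; apply: mulr_ge0.
have F0 : 0 <= F.
  have D0 : 0 <= (2 * N) ^+ k by apply: exprn_ge0; apply: mulr_ge0.
  apply: addr_ge0; last by apply: mulr_ge0.
  by apply: mulr_ge0; [apply: mulr_ge0 | apply: addr_ge0 => //; apply: mulr_ge0].
(* In K, [K1] is what [covers_shear] asks for, [N] and [K0] serve the window of a fiber. In C, the
   first term sums the errors F / T of at most (2 K0 T + 1)^m fibers. The second integrates the
   error C' / T of the induction hypothesis, times at most 4^k for the factors y - x, over an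
   interval of length at most 4. *)
exists (K1 + N + K0), (F * (2 * K0 + 1) ^+ m + 4 ^+ k * C' * 4); split.
- by apply: addr_ge0 => //; apply: addr_ge0.
- apply: addr_ge0; first by apply: mulr_ge0 => //; apply: exprn_ge0; apply: addr_ge0 => //; apply: mulr_ge0.
  by apply: mulr_ge0 => //; apply: mulr_ge0 => //; apply: exprn_ge0.
move=> T u X ys sh M hT u0 u1 /andP[X0 X4] hys szys cov.
have T1 : 1 <= T by apply: le_trans (ltW hT); rewrite ler1n addn_gt0 orbT.
have T0 : 0 < T by apply: lt_le_trans T1.
have hu : 4 * m.+2%:R / T < u.
  apply: lt_le_trans u0; rewrite ltrBrDr -mulrDl ltr_pdivrMr // mul1r.
  by move: hT; rewrite natrD natrM addrC.
pose B i := fam T sh (fam0 T u) i.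
have sB i : i \in box M m -> shape T u m (B i).
  by move=> /size_of_box <-; apply: shape_fam.
have fib i : exists t : R * R * {poly R}, i \in box M m ->
  [/\ [&& 0 <= t.1.1, t.1.1 <= t.1.2 & t.1.2 <= X],
     forall x : R, 0 < x < X -> x != t.1.1 -> x != t.1.2 -> (t.1.1 < x < t.1.2) =
        good m x ('X * B i - ('X * B i).[x]%:P),
     forall x, t.2^`().[x] = (\prod_(y <- ys) (('X * B i).[y] - ('X * B i).[x]))
        * ('X * B i)^`().[x]
   & `|T^-1 * \sum_(j <- zrange M) (good m.+1 X (step T sh (B i) j))%:R *
          \prod_(y <- ys) (step T sh (B i) j).[y] - (t.2.[t.1.2] - t.2.[t.1.1])|
     <= F / T * (bounded K0 (B i))%:R].
  case: (boolP (i \in box M m)) => [hi|_]; last by exists (0, 0, 0).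
  have cov' : bounded K0 (B i) -> `|sh (B i)| + N <= M%:R / T.
    move=> bB; have := cov (B i); have [-> _ _] := sB i hi => /(_ (leqnn _) _)/wrap[].
      apply/allP => c /(allP bB) h; apply: le_trans h _.
      by rewrite lerDr addr_ge0.
    by move: K10 K00; lra.
  have [p [q [H [h1 h2 h3 h4]]]] := fiber_estimate T1 u1 (sB i hi) hu X4 hys cov'.
  exists (p, q, H) => _; split=> //; last by rewrite szys in h4.
  by move: h1; rewrite max_r.
have [t ht] := choice fib.
pose tr i := ((t i).1, T ^- m *: (t i).2).
have Tm : 0 < T ^- m by rewrite invr_gt0 exprn_gt0.
have main := @step_integral _ (4 ^+ k * C' / T) (prim (simplexint_dens m ys))
   [seq tr i | i <- box M m] 0 X X0.
case/(_ _ _)/wrap: main.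
- by rewrite all_map; apply/allP => i hi /=; have [] := ht i hi.
- move=> x /andP[x0 xX] xE; rewrite deriv_prim simplexint_densE.
  have x4 : x <= 4 by rewrite (le_trans (ltW xX)).
  have xT0 : 0 <= x / T by rewrite mulr_ge0 ?invr_ge0 ?ltW.
  have -> : \sum_(t0 <- [seq tr i | i <- box M m]) (inside x t0)%:R * t0.2^`().[x] =
    (\prod_(y <- ys) (y - x)) * lattice_avg T M m (shear sh x) (u - x / T) x (x :: ys).
    rewrite /lattice_avg mulrCA mulr_sumr big_map mulr_sumr.
    rewrite big_seq [RHS]big_seq; apply: eq_bigr => i hi.
    have [_ h2 h3 _] := ht i hi.
    have [_] := shear_fam T sh u x i; rewrite -/(B i); set B' := fam _ _ _ i => eB.
    have xp : x != (t i).1.1.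
      apply: contraNneq xE => ->; rewrite mem_cat; apply/orP; left.
      by rewrite -map_comp; apply/mapP; exists i.
    have xq : x != (t i).1.2.
      apply: contraNneq xE => ->; rewrite mem_cat; apply/orP; right.
      by rewrite -map_comp; apply/mapP; exists i.
    rewrite /inside /= h2 ?x0 // derivZ hornerZ h3.
    have B'0 : B' != 0 by apply: (shape_neq0 (shape_fam T0 _ _ _)).
    rewrite eB good_mulXsub // big_cons.
    (* The Jacobian of the substitution becomes the value at x of the quotient, i.e. the new
       weight. *)
    have -> : ('X * B i)^`().[x] = B'.[x].
      have -> : ('X * B i)^`() = (('X - x%:P) * B')^`() by rewrite -eB derivB derivC subr0.
      by rewrite derivM derivXsubC mul1r hornerD hornerM hornerXsubC subrr mul0r addr0.
    have -> : \prod_(y <- ys) (('X * B i).[y] - ('X * B i).[x]) =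
       (\prod_(y <- ys) (y - x)) * \prod_(y <- ys) B'.[y].
      rewrite -big_split; apply: eq_bigr => y _ /=.
      have := congr1 (horner^~ y) eB.
      by rewrite hornerD hornerN hornerC => ->; rewrite hornerM hornerXsubC.
    by ring.
  rewrite -mulrBr normrM.
  have -> : 4 ^+ k * C' / T = 4 ^+ k * (C' / T) by rewrite mulrA.
  apply: ler_pM => //.
    rewrite normr_prod -szys; elim: (ys) hys => [|y s IHs] /=; first by rewrite big_nil.
    case/andP => /andP[Xy y4] /IHs h; rewrite big_cons exprS ler_pM ?prodr_ge0 //.
    rewrite ger0_norm; first by rewrite (le_trans _ y4) // gerBl ltW.
    by rewrite subr_ge0 (le_trans (ltW xX)).
  apply: IH.
  (* The threshold on T is invariant: (d + 4) + 4 (m + 1) = d + 4 (m + 2). *)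
  - by rewrite -addnA -mulnS.
  - rewrite natrD mulrDl.
    have : x / T <= 4 / T by rewrite ler_pM2r ?invr_gt0.
    by lra.
  - by lra.
  - by rewrite ltW.
  - rewrite /= lexx x4 /=; apply: sub_all hys => y /andP[Xy ->].
    by rewrite (le_trans (ltW xX)).
  - by rewrite /= szys.
  apply: covers_shear cov => //; first by rewrite ltW.
  by rewrite -/K1 -addrA lerDl addr_ge0.
rewrite prim_root0 !subr0 -simplexintS => h1.
have e : lattice_avg T M m.+1 sh u X ys = T ^- m * \sum_(i <- box M m) (T^-1 *
    \sum_(j <- zrange M) (good m.+1 X (step T sh (B i) j))%:R *
          \prod_(y <- ys) (step T sh (B i) j).[y]).
  rewrite /lattice_avg big_box -mulr_sumr mulrA exprS invfM [T ^- m * _]mulrC.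
  congr (_ * _); apply: eq_bigr => i _; apply: eq_bigr => j _.
  by rewrite !fam_rcons.
have h2 : `|lattice_avg T M m.+1 sh u X ys -
    \sum_(t0 <- [seq tr i | i <- box M m]) (t0.2.[t0.1.2] - t0.2.[t0.1.1])| <=
    F * (2 * K0 + 1) ^+ m / T.
  have -> : \sum_(t0 <- [seq tr i | i <- box M m]) (t0.2.[t0.1.2] - t0.2.[t0.1.1]) =
     T ^- m * \sum_(i <- box M m) ((t i).2.[(t i).1.2] - (t i).2.[(t i).1.1]).
    by rewrite big_map mulr_sumr; apply: eq_bigr => i _; rewrite /= !hornerZ mulrBr.
  rewrite e -mulrBr -sumrB normrM gtr0_norm //.
  have h3 : \sum_(i <- box M m) (bounded K0 (B i))%:R <= (2 * K0 * T + 1) ^+ m :> R.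
    have := count_bounded_fam T0 u sh M m K00; apply: le_trans.
    rewrite -sum1_count natr_sum [X in _ <= X]big_mkcond /=; apply: ler_sum => i _.
    by case: ifP.
  apply: (@le_trans _ _ (T ^- m * (F / T * (2 * K0 * T + 1) ^+ m))).
    rewrite ler_pM2l //; apply: (le_trans (ler_norm_sum _ _ _)).
    apply: le_trans (ler_wpM2l _ h3); last by rewrite mulr_ge0 // invr_ge0 ltW.
    rewrite mulr_sumr big_seq [X in _ <= X]big_seq; apply: ler_sum => i hi.
    by have [] := ht i hi.
  rewrite mulrCA [X in _ <= X]mulrAC.
  apply: ler_wpM2l; first by rewrite mulr_ge0 // invr_ge0 ltW.
  rewrite -exprVn -exprMn; apply: lerXn2r; rewrite ?nnegrE.
  - by apply: mulr_ge0; [rewrite invr_ge0 ltW | apply: addr_ge0 => //; apply: mulr_ge0; [apply: mulr_ge0 | apply: ltW]].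
  - by apply: addr_ge0 => //; apply: mulr_ge0.
  rewrite ler_pdivrMl // mulrDr mulr1 mulrC [T * _]mulrC.
  by rewrite [2 * K0 * T]mulrC lerD2l.
have h3 : 4 ^+ k * C' / T * X <= 4 ^+ k * C' * 4 / T.
  rewrite [X in _ <= X](_ : _ = 4 ^+ k * C' / T * 4); last by ring.
  apply: ler_wpM2l => //; apply: mulr_ge0; last by rewrite invr_ge0 ltW.
  by apply: mulr_ge0 => //; apply: exprn_ge0.
rewrite mulrDl; apply: (le_trans (ler_distD _ _ _)); apply: lerD; first exact: h2.
exact: le_trans h1 h3.
Qed.

Lemma lattice_avg_estimate m d k : exists K C : R, [/\ 0 <= K, 0 <= C &
  forall (T u X : R) (ys : seq R) sh M, (d + 4 * m.+1)%:R < T ->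
     1 - d%:R / T <= u -> u <= 1 -> 0 <= X <= 4 -> all (fun y => X <= y <= 4) ys ->
     size ys = k -> covers T K m M sh ->
     `|lattice_avg T M m sh u X ys - simplexint m X ys| <= C / T].
Proof.
elim: m d k => [|m IH] d k.
  exists 0, (k%:R * (d + 4)%:R); split=> //; first by rewrite mulr_ge0.
  move=> T u X ys sh M hT u0 u1 /andP[X0 _] hys <- _.
  rewrite muln1 in hT; apply: lattice_avg_base => //.
  exact: le_lt_trans hT.
have [K' [C' [K0 C0 h]]] := IH (d + 4)%N k.+1.
exact: (lattice_avg_step K0 C0 h).
Qed.

End LatticeCount.

(** * Salem numbers and trace polynomials *)

Section Lift.
Variable F : comNzRingType.
Implicit Types (q : {poly F}).

(* [trlift n q] is [x ^ n * q((x + 1) ^ 2 / x)], i.e. the trace polynomial [q] is taken in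
   the variable [x + 1 / x + 2], which puts the unit circle over [0, 4]. *)
Definition trlift n q : {poly F} :=
  \sum_(k < n.+1) q`_k *: (('X + 1) ^+ (2 * k) * 'X^(n - k)).

Lemma trliftD n q r : trlift n (q + r) = trlift n q + trlift n r.
Proof. by rewrite -big_split; apply: eq_bigr => k _; rewrite coefD scalerDl. Qed.

Lemma trliftZ n c q : trlift n (c *: q) = c *: trlift n q.
Proof. by rewrite scaler_sumr; apply: eq_bigr => k _; rewrite coefZ scalerA. Qed.

Lemma trliftS n q : (size q <= n.+1)%N -> trlift n.+1 q = 'X * trlift n q.
Proof.
move=> szq; rewrite /trlift big_ord_recr /= nth_default // scale0r addr0 mulr_sumr.
apply: eq_bigr => k _; rewrite -scalerAr; congr (_ *: _).
by rewrite mulrCA subSn ?exprS // -ltnS.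
Qed.

Lemma trlift_mulX n q : trlift n.+1 ('X * q) = ('X + 1) ^+ 2 * trlift n q.
Proof.
rewrite /trlift big_ord_recl coefXM /= scale0r add0r mulr_sumr.
apply: eq_bigr => k _; rewrite coefXM /= -scalerAr; congr (_ *: _).
by rewrite /bump /= add1n subSS mulnS exprD mulrA.
Qed.

Lemma trlift_mulXsub n q c : (size q <= n.+1)%N ->
  trlift n.+1 (('X - c%:P) * q) = (('X + 1) ^+ 2 - c *: 'X) * trlift n q.
Proof.
move=> szq; rewrite mulrBl mul_polyC -scaleNr trliftD trliftZ trlift_mulX trliftS //.
by rewrite mulrBl scaleNr -scalerAl.
Qed.

Lemma trlift_prod (s : seq F) : trlift (size s) (\prod_(c <- s) ('X - c%:P)) =
  \prod_(c <- s) (('X + 1) ^+ 2 - c *: 'X).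
Proof.
elim: s => [|c s IH].
  by rewrite !big_nil /trlift big_ord_recl big_ord0 /= coef1 scale1r !mulr1 addr0.
by rewrite !big_cons /= trlift_mulXsub ?IH // size_prod_XsubC.
Qed.

Lemma size_Xadd1_exp n : size (('X + 1) ^+ n : {poly F}) = n.+1.
Proof. by rewrite -[in LHS](opprK 1) -polyC1 -polyCN size_exp_XsubC. Qed.

Lemma trlift_top n q : (size q <= n.+1)%N ->
  (size (trlift n q - q`_n *: ('X + 1) ^+ (2 * n))%R <= 2 * n)%N.
Proof.
move=> szq; rewrite /trlift big_ord_recr /= subnn mulr1 addrK.
apply: (leq_trans (size_sum _ _ _)); apply/bigmax_leqP => k _.
apply: (leq_trans (size_scale_leq _ _)).
have nz : ('X + 1) ^+ (2 * k) != 0 :> {poly F} by rewrite -size_poly_eq0 size_Xadd1_exp.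
rewrite size_Mmonic ?monicXn // size_Xadd1_exp size_polyXn.
by have := ltn_ord k; lia.
Qed.

Lemma trlift_monic n q : q \is monic -> size q = n.+1 ->
  trlift n q \is monic /\ size (trlift n q) = (2 * n).+1.
Proof.
move=> qm szq; have q1 : q`_n = 1 by move: qm; rewrite monicE lead_coefE szq => /eqP.
have := @trlift_top n q; rewrite szq leqnn q1 scale1r => /(_ isT) h.
have e : trlift n q = ('X + 1) ^+ (2 * n) + (trlift n q - ('X + 1) ^+ (2 * n)) by ring.
have szlt : (size (trlift n q - ('X + 1) ^+ (2 * n))%R < size (('X + 1) ^+ (2 * n) : {poly F})%R)%N.
  by rewrite size_Xadd1_exp ltnS.
split; last by rewrite e size_polyDl // size_Xadd1_exp.
rewrite e monicE lead_coefDl // -monicE; apply: monic_exp; apply: monicXaddC.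
Qed.

Lemma trlift_eq0 n q : (size q <= n.+1)%N -> trlift n q = 0 -> q = 0.
Proof.
elim: n => [|n IH] szq q0.
  have := trlift_top szq; rewrite q0 sub0r size_polyN muln0 expr0 alg_polyC => h.
  by rewrite (size1_polyC szq); apply/eqP; rewrite -size_poly_eq0 -leqn0.
have q1 : q`_n.+1 = 0.
  have := trlift_top szq; rewrite q0 sub0r size_polyN => /leq_sizeP/(_ _ (leqnn _)).
  rewrite coefZ; have : ('X + 1 : {poly F}) ^+ (2 * n.+1) \is monic.
    by apply: monic_exp; apply: monicXaddC.
  by rewrite monicE lead_coefE size_Xadd1_exp => /eqP ->; rewrite mulr1.
have szq' : (size q <= n.+1)%N.
  by apply/leq_sizeP => j; rewrite leq_eqVlt => /predU1P[<- //|h]; apply: nth_default (leq_trans szq h).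
apply: IH => //; apply/polyP => k; have := congr1 (fun p : {poly F} => p`_k.+1) q0.
by rewrite trliftS // coefXM !coef0.
Qed.

Lemma trlift_inj n q (r : {poly F}) : (size q <= n.+1)%N -> (size r <= n.+1)%N ->
  trlift n q = trlift n r -> q = r.
Proof.
move=> szq szr e; apply/eqP; rewrite -subr_eq0; apply/eqP; apply: (@trlift_eq0 n).
  by rewrite (leq_trans (size_polyD _ _)) // geq_max szq size_polyN.
by rewrite trliftD -scaleN1r trliftZ scaleN1r e subrr.
Qed.

End Lift.

Lemma map_trlift (F K : comNzRingType) (f : {rmorphism F -> K}) n q :
  map_poly f (trlift n q) = trlift n (map_poly f q).
Proof.
rewrite rmorph_sum; apply: eq_bigr => k _ /=.
by rewrite map_polyZ rmorphM !rmorphXn rmorphD rmorph1 /= map_polyX coef_map.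
Qed.

Section LiftField.
Variable F : fieldType.

Lemma horner_trlift n (q : {poly F}) z : (size q <= n.+1)%N -> z != 0 ->
  (trlift n q).[z] = z ^+ n * q.[(z + 1) ^+ 2 / z].
Proof.
move=> szq z0; rewrite (horner_coef_wide _ szq) mulr_sumr horner_sum.
apply: eq_bigr => k _.
rewrite hornerZ hornerM hornerXn horner_exp hornerD hornerX -polyC1 hornerC.
rewrite [RHS]mulrCA; congr (_ * _); rewrite exprM expr_div_n [RHS]mulrCA; congr (_ * _).
by rewrite expfB_cond // (negPf z0) add0n -ltnS.
Qed.

End LiftField.

(** * Palindromic polynomials and roots on the unit circle *)

Section Palindromic.

Lemma coef_Xadd1_exp_sym (F : comNzRingType) n k : (k <= n)%N ->
  (('X + 1) ^+ n : {poly F})`_k = (('X + 1) ^+ n : {poly F})`_(n - k).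
Proof.
have e j : (('X + 1) ^+ n : {poly F})`_j = 'C(n, j)%:R.
  rewrite addrC exprDn coef_sum.
  have [jn|nj] := ltnP j n.+1; last first.
    rewrite bin_small // big1 // => i _; rewrite expr1n mul1r coefMn coefXn.
    by case: eqP => [ji|_]; [have := ltn_ord i; lia | rewrite mul0rn].
  rewrite (bigD1 (Ordinal jn)) //= big1 => [|i ij].
    by rewrite expr1n mul1r coefMn coefXn eqxx addr0.
  rewrite expr1n mul1r coefMn coefXn; case: eqP => [ji|_]; last by rewrite mul0rn.
  by case/eqP: ij; apply: val_inj.
by move=> kn; rewrite !e bin_sub.
Qed.

(** Subtracting a multiple of the palindromic (X + 1)^(2 n) kills the leading coefficient and, by
    symmetry, the constant one. The rest is X times a palindromic polynomial for n - 1. *)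
Lemma palindromic_trlift (F : comNzRingType) n (p : {poly F}) : (size p <= (2 * n).+1)%N ->
  (forall k, (k <= 2 * n)%N -> p`_k = p`_(2 * n - k)) ->
  exists2 q : {poly F}, (size q <= n.+1)%N & p = trlift n q /\ q`_n = p`_(2 * n).
Proof.
elim: n p => [|n IH] p szp hp.
  exists p => //; split=> //; rewrite /trlift big_ord_recl big_ord0 !mulr1 addr0.
  by rewrite alg_polyC; apply: size1_polyC.
pose c := p`_(2 * n.+1).
pose r := p - c *: ('X + 1) ^+ (2 * n.+1).
have rp k : (k <= 2 * n.+1)%N -> r`_k = r`_(2 * n.+1 - k).
  by move=> hk; rewrite !coefB !coefZ hp // coef_Xadd1_exp_sym.
have r0 : r`_(2 * n.+1) = 0.
  rewrite coefB coefZ coef_Xadd1_exp_sym // subnn -horner_coef0 horner_exp.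
  by rewrite hornerD hornerX add0r -polyC1 hornerC expr1n mulr1 subrr.
have szr : (size r <= 2 * n.+1)%N.
  apply/leq_sizeP => j; rewrite leq_eqVlt => /predU1P[<- //|hj].
  by rewrite coefB coefZ !nth_default ?mulr0 ?subrr // ?size_Xadd1_exp // (leq_trans szp).
have r00 : r`_0 = 0 by rewrite rp // subn0.
have rX : r = 'X * drop_poly 1 r.
  apply/polyP => k; rewrite coefXM coef_drop_poly addn1.
  by case: k => [|k]; rewrite ?r00.
have [||q szq [hq q1]] := IH (drop_poly 1 r).
- by rewrite size_drop_poly; lia.
- move=> k hk; rewrite !coef_drop_poly !addn1 rp; last by lia.
  by congr (r`_ _); lia.
exists (q + c *: 'X^(n.+1)).
  rewrite (leq_trans (size_polyD _ _)) // geq_max (leq_trans szq) //=.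
  by rewrite (leq_trans (size_scale_leq _ _)) // size_polyXn.
split; last by rewrite coefD coefZ coefXn eqxx mulr1 nth_default // add0r.
rewrite trliftD trliftS // -hq -rX trliftZ.
have -> : trlift n.+1 'X^(n.+1) = ('X + 1) ^+ (2 * n.+1) :> {poly F}.
  rewrite /trlift big_ord_recr /= big1 => [|k _].
    by rewrite add0r coefXn eqxx subnn mulr1 scale1r.
  by rewrite coefXn ltn_eqF ?scale0r.
by rewrite /r subrK.
Qed.

End Palindromic.
Section SalemTrace.
Variable R : realType.
Local Notation C := R[i].
Local Notation toQ := (map_poly (intr : int -> rat)).
Local Notation toR := (map_poly (intr : int -> R)).
Local Notation toC := (map_poly (intr : int -> C)).
Implicit Types (p q g : {poly int}).

Lemma horner_revpoly (F : fieldType) N (p : {poly F}) z : (size p <= N.+1)%N -> z != 0 ->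
  (\poly_(k < N.+1) p`_(N - k)).[z] = z ^+ N * p.[z^-1].
Proof.
move=> szp z0; rewrite horner_poly (horner_coef_wide _ szp) mulr_sumr.
rewrite (reindex_inj rev_ord_inj) /=; apply: eq_bigr => k _; rewrite subSS.
have kN : (k <= N)%N by rewrite -ltnS.
by rewrite subKn // mulrCA expfB_cond ?(negPf z0) ?add0n // exprVn.
Qed.

Lemma toQ_toC p : map_poly (ratr : rat -> C) (toQ p) = toC p.
Proof. by rewrite -map_poly_comp; apply: eq_map_poly => k /=; rewrite ratr_int. Qed.

Lemma toR_toC p : map_poly (real_complex R) (toR p) = toC p.
Proof. by rewrite -map_poly_comp; apply: eq_map_poly => k /=; rewrite rmorph_int. Qed.

Lemma size_map_int (F : numDomainType) p : size (map_poly (intr : int -> F) p) = size p.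
Proof. by rewrite size_map_inj_poly //; apply: intr_inj. Qed.

Lemma root_conj p z : root (toC p) z -> root (toC p) z^*%R.
Proof.
rewrite !rootE => /eqP h.
have -> : toC p = map_poly Num.conj (toC p).
  by rewrite -map_poly_comp; apply: eq_map_poly => k /=; rewrite rmorph_int.
by rewrite horner_map h; apply/eqP/rmorph0.
Qed.

Lemma norm1_inv (z : C) : `|z| = 1 -> z^-1 = z^*%R.
Proof. by move=> z1; rewrite invC_norm z1 expr1n invr1 mul1r. Qed.

Lemma irreducible_toQ_root p (x : rat) : irreducible_poly (toQ p) -> root (toQ p) x ->
  size p = 2.
Proof.
move=> ip; rewrite -dvdp_XsubCl => dv.
have := ip.2 _ _ dv; rewrite size_XsubC => /(_ isT)/eqp_size.
by rewrite size_XsubC size_map_int.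
Qed.

(** The inverse of z is its conjugate, hence a root of p, so z is a root of the reversed polynomial,
    which the irreducible p must divide. They agree up to a constant c with c^2 = 1. *)
Lemma irreducible_palindromic p n z : p \is monic -> size p = (2 * n).+1 ->
  irreducible_poly (toQ p) -> root (toC p) z -> `|z| = 1 ->
  forall k, (k <= 2 * n)%N -> p`_k = p`_(2 * n - k).
Proof.
move=> pm szp ip rz z1 k hk.
have z0 : z != 0 by apply/eqP => h; move: z1; rewrite h normr0 => /eqP; rewrite eq_sym oner_eq0.
have szQ : size (toQ p) = (2 * n).+1 by rewrite size_map_int.
pose r := \poly_(k < (2 * n).+1) (toQ p)`_(2 * n - k).
have rE j : (j <= 2 * n)%N -> r`_j = (p`_(2 * n - j))%:~R.
  by move=> hj; rewrite coef_poly ltnS hj coef_map.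
have ptop : p`_(2 * n) = 1 by move: pm; rewrite monicE lead_coefE szp => /eqP.
have r0 : r`_0 = 1 by rewrite rE // subn0 ptop.
have rr : root (map_poly (ratr : rat -> C) r) z.
  have -> : map_poly (ratr : rat -> C) r = \poly_(k < (2 * n).+1) (toC p)`_(2 * n - k).
    apply/polyP => j; rewrite coef_map !coef_poly; case: ifP => _; last exact: rmorph0.
    by case: ifP => _; [apply: ratr_int | apply: rmorph0].
  rewrite rootE horner_revpoly ?size_map_int ?szp // norm1_inv //.
  by have /rootP -> := root_conj rz; rewrite mulr0.
have dv : toQ p %| r.
  apply: contraT => ndv; have := irreducible_poly_coprime r ip; rewrite ndv.
  rewrite -(coprimep_map (ratr : {rmorphism rat -> C})) /= toQ_toC => /coprimep_root.
  by move=> /(_ z rz); rewrite (rootP rr) eqxx.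
have rn0 : r != 0 by apply/eqP => h; move: r0; rewrite h coef0.
have szr : size r = (2 * n).+1.
  apply/eqP; rewrite eqn_leq size_poly /= -szQ; exact: dvdp_leq.
have := dvdp_size_eqp dv; rewrite szr szQ eqxx => /esym/eqpP[[c1 c2]] /= /andP[c10 c20] e.
pose c := c1 / c2.
have {}e : r = c *: toQ p.
  by rewrite /c mulrC -scalerA e scalerA mulVf ?scale1r.
have e0 : 1 = c * (p`_0)%:~R by have := congr1 (fun s : {poly rat} => s`_0) e; rewrite r0 coefZ coef_map_id0.
have e1 : (p`_0)%:~R = c.
  have := rE _ (leqnn (2 * n)); rewrite subnn => <-.
  by rewrite e coefZ coef_map /= ptop mulr1.
have /eqP : c ^+ 2 = 1 by rewrite expr2 -{2}e1 -e0.
rewrite sqrf_eq1 => /orP[/eqP c1'|/eqP cN].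
  apply: (@intr_inj rat); rewrite -(rE _ hk) e c1' scale1r coef_map //.
(* A polynomial and its reversal agree at 1, so c = -1 would give p the rational root 1, which its
   even degree excludes. *)
have h1 : r.[1] = (toQ p).[1].
  by rewrite horner_revpoly ?szQ ?oner_neq0 // expr1n mul1r invr1.
have /(irreducible_toQ_root ip) : root (toQ p) 1.
  move: h1; rewrite e cN scaleN1r hornerN rootE => /eqP.
  by rewrite eq_sym -addr_eq0 -mulr2n mulrn_eq0.
by rewrite szp; lia.
Qed.

Lemma circle_trace (z : C) : `|z| = 1 -> (z + 1) ^+ 2 / z = `|z + 1| ^+ 2.
Proof.
move=> z1; have z0 : z != 0 by apply/eqP => h; move: z1; rewrite h normr0 => /eqP; rewrite eq_sym oner_eq0.
rewrite normCK (_ : (z + 1)^*%R = z^-1 + 1); first by field.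
by rewrite (norm1_inv z1) rmorphD; congr (_ + _); apply: rmorph1.
Qed.

Lemma real_of_ge0 (c : C) : 0 <= c -> c = ((complex.Re c)%:C)%C.
Proof. by move=> c0; rewrite RRe_real // ger0_real. Qed.

Lemma circle_trace_real (z : C) : `|z| = 1 -> z != 1 -> z != -1 ->
  exists2 x : R, 0 < x < 4 & (z + 1) ^+ 2 / z = (x%:C)%C.
Proof.
move=> z1 zn1 znN1.
have z0 : z != 0 by apply/eqP => h; move: z1; rewrite h normr0 => /eqP; rewrite eq_sym oner_eq0.
have cE := circle_trace z1; set c := (z + 1) ^+ 2 / z in cE *.
have c0 : 0 <= c by rewrite cE exprn_ge0.
have c4 : c <= 4.
  rewrite cE (_ : 4 = 2 ^+ 2 :> C); last by ring.
  rewrite lerXn2r ?nnegrE //; apply: (le_trans (ler_normD _ _)).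
  by rewrite z1 normr1.
have cn0 : c != 0.
  by rewrite mulf_neq0 ?invr_eq0 // expf_neq0 // addr_eq0.
have cn4 : c != 4.
  apply/eqP => h; have : (z - 1) ^+ 2 = 0.
    have h2 : (z + 1) ^+ 2 = 4 * z by rewrite -h /c divfK.
    have -> : (z - 1) ^+ 2 = (z + 1) ^+ 2 - 4 * z by ring.
    by rewrite h2 subrr.
  by move/eqP; rewrite sqrf_eq0 subr_eq0 (negPf zn1).
have cR := real_of_ge0 c0.
exists (complex.Re c) => //; rewrite -!ltcR -cR.
have -> : ((4 : R)%:C)%C = 4 :> C by rewrite -[4 : R]/(4%:R) rmorph_nat.
by rewrite !lt_neqAle eq_sym cn0 c0 cn4 c4.
Qed.

End SalemTrace.

(** * From Salem numbers to trace polynomials *)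

Section SalemToTrace.
Variable R : realType.
Local Notation C := R[i].
Local Notation toQ := (map_poly (intr : int -> rat)).
Local Notation toR := (map_poly (intr : int -> R)).
Local Notation toC := (map_poly (intr : int -> C)).
Implicit Types (p q g : {poly int}).

Lemma not_uniq_rem (K : eqType) (s : seq K) : ~~ uniq s -> exists2 c, c \in s & c \in rem c s.
Proof.
elim: s => //= x s IH; rewrite negb_and negbK.
have [xs _|xs /= /IH[c cs crem]] := boolP (x \in s).
  by exists x; rewrite ?mem_head // eqxx.
exists c; first by rewrite inE cs orbT.
by case: eqVneq => [xc|_]; [rewrite xc cs in xs | rewrite inE crem orbT].
Qed.

Lemma deriv_double_root (F : comNzRingType) (A S : {poly F}) z : A.[z] = 0 ->
  (A * (A * S))^`().[z] = 0.
Proof.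
by move=> h; rewrite derivM [(A * S)^`()]derivM hornerD !hornerM hornerD !hornerM h !mul0r mulr0 addr0.
Qed.

Lemma irreducible_simple_root p (z : C) : irreducible_poly (toQ p) ->
  root (toC p) z -> (toC p)^`().[z] != 0.
Proof.
move=> ip rz; have szQ : (1 < size (toQ p))%N by case: ip.
have d0 : (toQ p)^`() != 0.
  apply/eqP => /(congr1 (fun r : {poly rat} => r`_(size (toQ p)).-2)).
  rewrite coef_deriv coef0 prednK; last by rewrite -subn1 subn_gt0.
  move/eqP; rewrite mulrn_eq0 -lead_coefE lead_coef_eq0 -size_poly_eq0.
  by case: (size _) szQ => [|[]].
have : coprimep (toQ p) (toQ p)^`().
  rewrite irreducible_poly_coprime //; apply/negP => /(dvdp_leq d0).
  by rewrite leqNgt lt_size_deriv // -size_poly_gt0 ltnW.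
rewrite -(coprimep_map (ratr : {rmorphism rat -> C})) /= -deriv_map toQ_toC.
by move/coprimep_root; apply.
Qed.

Lemma root_toC_toR p (x : R) : root (toC p) (x%:C)%C = root (toR p) x.
Proof. by rewrite -toR_toC fmorph_root. Qed.

Lemma trlift_toC_prod q m (cs : seq C) : size cs = m ->
  toC q = \prod_(c <- cs) ('X - c%:P) ->
  toC (trlift m q) = \prod_(c <- cs) (('X + 1) ^+ 2 - c *: 'X).
Proof. by move=> <- e; rewrite (map_trlift (intr : {rmorphism int -> C})) /= e trlift_prod. Qed.

Lemma horner_quad (c z : C) : (('X + 1) ^+ 2 - c *: 'X).[z] = (z + 1) ^+ 2 - c * z.
Proof. by rewrite hornerD hornerN hornerZ hornerX horner_exp hornerD hornerX -polyC1 hornerC. Qed.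

Lemma quad_root (c z : C) : (z + 1) ^+ 2 - c * z = 0 -> z != 0 /\ c = (z + 1) ^+ 2 / z.
Proof.
move=> h; have z0 : z != 0.
  apply/eqP => z0; move: h; rewrite z0 add0r expr1n mulr0 subr0 => /eqP.
  by rewrite oner_eq0.
by split=> //; move/eqP: h; rewrite subr_eq0 => /eqP ->; rewrite mulfK.
Qed.

Lemma exists_quad_root (c : C) : exists z : C, (z + 1) ^+ 2 - c * z = 0.
Proof.
have [z /rootP] : exists z, root (('X + 1) ^+ 2 - c *: 'X : {poly C}) z.
  apply/closed_rootP; rewrite size_polyDl ?size_Xadd1_exp // size_polyN.
  by rewrite (leq_ltn_trans (size_scale_leq _ _)) // size_polyX.
by rewrite horner_quad; exists z.
Qed.

(** The conjugate on the unit circle makes the minimal polynomial palindromic, hence a lift of some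
    q. For a root z other than alpha and its inverse, both z and 1 / z have modulus at most 1, so z
    is on the circle and its trace is in (0, 4). A repeated root of q would give a double root of
    the irreducible p. *)
Lemma salem_trace m (alpha : R) : salem_of_degree (2 * (m + 1)) alpha ->
  exists q, [/\ q \is monic, size q = m.+2, is_int_minpoly (trlift m.+1 q) alpha,
    root (toR q) ((alpha + 1) ^+ 2 / alpha) & exists a, roots_in_lt m 4 (toR q) a].
Proof.
case=> p [[pm ip ra] szp' a1 hle [w [rw wa w1]]].
have szp : size p = (2 * m.+1).+1.
  have : p != 0 by apply: monic_neq0.
  by rewrite -size_poly_gt0; move: szp'; case: (size p) => //= k -> _; rewrite addn1.
have pal := irreducible_palindromic pm szp ip rw w1.
have [||q szq [pq qn]] := @palindromic_trlift _ m.+1 p; rewrite ?szp //.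
have q1 : q`_m.+1 = 1 by move: pm; rewrite qn monicE lead_coefE szp => /eqP.
have szq' : size q = m.+2.
  apply/eqP; rewrite eqn_leq szq ltnNge; apply/negP => /leq_sizeP/(_ _ (leqnn _)).
  by rewrite q1 => /eqP; rewrite oner_eq0.
have qm : q \is monic by rewrite monicE lead_coefE szq' q1.
have a0 : 0 < alpha by apply: lt_trans a1.
have [cs csE] := closed_field_poly_normal (toC q).
have {}csE : toC q = \prod_(c <- cs) ('X - c%:P).
  have qmC : toC q \is monic by apply: monic_map.
  by rewrite csE; move: qmC; rewrite monicE => /eqP ->; rewrite scale1r.
have szcs : size cs = m.+1.
  by have := size_map_int C q; rewrite csE size_prod_XsubC szq' => -[].
have pC : toC p = \prod_(c <- cs) (('X + 1) ^+ 2 - c *: 'X).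
  by rewrite pq; apply: trlift_toC_prod.
have rtE z : z != 0 -> root (toC p) z = ((z + 1) ^+ 2 / z \in cs).
  move=> z0; rewrite pq (map_trlift (intr : {rmorphism int -> C})) rootE /=.
  rewrite horner_trlift ?size_map_int // mulf_eq0 expf_eq0 (negPf z0) /= -rootE.
  by rewrite csE root_prod_XsubC.
have root_n0 z : root (toC p) z -> z != 0.
  apply: contraTneq => ->; rewrite pC rootE horner_prod prodf_seq_neq0; apply/allP => c _ /=.
  by rewrite horner_quad add0r expr1n mulr0 subr0 oner_neq0.
have root_inv z : root (toC p) z -> root (toC p) z^-1.
  move=> rz; have z0 := root_n0 _ rz; move: rz; rewrite !rtE ?invr_eq0 //.
  by congr (_ \in cs); field.
have rootN1 z : root (toC p) z -> z != 1 /\ z != -1.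
  have norat (x : rat) : ~~ root (toC p) (ratr x).
    apply/negP; rewrite -toQ_toC fmorph_root => /(irreducible_toQ_root ip).
    by rewrite szp; lia.
  move=> rz; split; apply/eqP => h; rewrite h in rz.
    by have := norat 1; rewrite rmorph1 rz.
  by have := norat (-1); rewrite rmorphN1 rz.
pose aC : C := (alpha%:C)%C.
have aC0 : aC != 0 by rewrite (inj_eq (@complexI R) alpha 0) gt_eqF.
have raC : root (toC p) aC by rewrite root_toC_toR.
pose gC := (aC + 1) ^+ 2 / aC.
have gCcs : gC \in cs by rewrite -rtE.
have cases c : c \in cs -> c = gC \/ exists2 x : R, 0 < x < 4 & c = (x%:C)%C.
  move=> ccs; have [z hz] := exists_quad_root c; have [z0 cE] := quad_root hz.
  have rz : root (toC p) z by rewrite rtE // -cE.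
  have [za|za] := eqVneq z aC; first by left; rewrite cE za.
  have [zi|zi] := eqVneq z^-1 aC.
    by left; rewrite cE /gC -zi; field.
  right; have z1 : `|z| = 1.
    apply/le_anti; rewrite hle //=.
    have := hle _ (root_inv _ rz) zi.
    by rewrite normfV invf_le1 // normr_gt0.
  have [zn1 znN1] := rootN1 _ rz; rewrite cE; exact: circle_trace_real.
have ucs : uniq cs.
  apply: contraT => /not_uniq_rem[c ccs crem].
  have [z hz] := exists_quad_root c; have [z0 cE] := quad_root hz.
  have rz : root (toC p) z by rewrite rtE // -cE.
  have := irreducible_simple_root ip rz.
  rewrite pC (big_rem _ ccs) /= (big_rem _ crem) /= deriv_double_root ?eqxx //.
  by rewrite horner_quad.
have gE : gC = (((alpha + 1) ^+ 2 / alpha)%:C)%C.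
  by rewrite fmorph_div rmorphXn rmorphD rmorph1.
exists q; split=> //.
- by split; rewrite -?pq.
- by rewrite -root_toC_toR -gE csE root_prod_XsubC.
pose bs := rem gC cs.
have bsE c : c \in bs -> 0 < complex.Re c < 4 /\ c = ((complex.Re c)%:C)%C.
  rewrite mem_rem_uniq // inE => /andP[cg /cases[ch|[x hx ->]]] //.
  by rewrite ch eqxx in cg.
exists (sort <=%O (map (@complex.Re R) bs)); split.
- by rewrite size_sort size_map size_rem // szcs.
- rewrite sort_lt_sorted map_inj_in_uniq ?rem_uniq // => c d /bsE[_ ce] /bsE[_ de] h.
  by rewrite ce de h.
- rewrite all_sort all_map; apply/allP => c /bsE[]//.
rewrite all_sort all_map; apply/allP => c cb /=; have [_ ce] := bsE _ cb.
rewrite -root_toC_toR -ce csE root_prod_XsubC.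
exact: mem_rem cb.
Qed.

End SalemToTrace.

(** * From trace polynomials to Salem numbers *)

Section TraceToSalem.
Variable R : realType.
Local Notation C := R[i].
Local Notation toQ := (map_poly (intr : int -> rat)).
Local Notation toR := (map_poly (intr : int -> R)).
Local Notation toC := (map_poly (intr : int -> C)).
Implicit Types (p q g : {poly int}).

Lemma reducible_factors p : (1 < size p)%N -> ~ irreducible_poly (toQ p) ->
  exists g1 g2, [/\ p = g1 * g2, (1 < size g1)%N & (1 < size g2)%N].
Proof.
move=> szp nip; apply: contrapT => nex; apply: nip; split; first by rewrite size_map_int.
move=> d szd /dvdpP_rat_int[p1 [a a0 dE] [r pE]].
have p0 : p != 0 by rewrite -size_poly_gt0 ltnW.
have p10 : p1 != 0 by apply: contraNneq p0 => h; rewrite pE h mul0r.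
have r0 : r != 0 by apply: contraNneq p0 => h; rewrite pE h mulr0.
have szp1 : (1 < size p1)%N.
  rewrite ltn_neqAle size_poly_gt0 p10 andbT eq_sym.
  by move: szd; rewrite dE size_scale // size_map_int.
have [szr|szr] := ltnP 1 (size r); first by case: nex; exists p1, r.
have rE := size1_polyC szr; have c0 : r`_0 != 0 by rewrite -polyC_eq0 -rE.
rewrite dE pE rE (eqp_trans (eqp_scale _ a0)) // eqp_sym mulrC mul_polyC map_polyZ.
by apply: eqp_scale; rewrite intr_eq0.
Qed.

(** The real quadratic equation has the roots z and 1 / z, and the conjugate of z is one of them. If
    it is 1 / z, then |z| = 1. If it is z, then z is a real r with (r + 1)^2 = x r, impossible for 0
    < x < 4. *)
Lemma quad_circle (x : R) (z : C) : 0 < x < 4 -> (z + 1) ^+ 2 - (x%:C)%C * z = 0 -> `|z| = 1.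
Proof.
move=> /andP[x0 x4] hz; have [z0 xE] := quad_root hz.
have hzc : (z^*%R + 1) ^+ 2 - (x%:C)%C * z^*%R = 0.
  have xr : (x%:C)%C^*%R = (x%:C)%C :> C by apply/CrealP/complex_realP; exists x.
  have e1 : (z + 1)^*%R = z^*%R + 1 :> C by rewrite rmorphD; congr (_ + _); apply: rmorph1.
  transitivity (((z + 1) ^+ 2 - (x%:C)%C * z)^*%R : C); last by rewrite hz; apply: rmorph0.
  apply/esym; apply: etrans (rmorphB _ _ _) _; congr (_ - _).
    by apply: etrans (rmorphXn _ _ _) _; congr (_ ^+ _).
  by apply: etrans (rmorphM _ _ _) _; congr (_ * _).
have : (z^*%R - z) * (z^*%R - z^-1) = 0.
  rewrite -hzc xE; move: (z^*%R) => v; field; exact: z0.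
move/eqP; rewrite mulf_eq0 !subr_eq0 => /orP[/eqP zr|/eqP zi]; last first.
  have : `|z| ^+ 2 == 1 by rewrite normCK zi divff.
  rewrite sqrf_eq1 => /orP[/eqP //|/eqP h].
  by have := normr_ge0 z; rewrite h oppr_ge0 ler10.
have /complex_realP[r rE] : z \is Num.real by apply/CrealP.
have : (r + 1) ^+ 2 - x * r = 0.
  apply: (@complexI R); rewrite rmorph0 -[RHS]hz rE.
  by rewrite rmorphB [X in X - _]rmorphXn [X in _ - X]rmorphM rmorphD rmorph1.
have r0 : r != 0 by apply: contraNneq z0 => h; rewrite rE h.
clear - x0 x4 r0 => e; exfalso.
have := sqr_ge0 (r - 1); have := sqr_ge0 (r + 1).
have [r1|r1|r1] := ltgtP r 0; last by rewrite r1 eqxx in r0.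
  have : x * r < 0 by rewrite pmulr_rlt0.
  by move: e; lra.
have : x * r < 4 * r by rewrite ltr_pM2r.
by move: e; rewrite !expr2; lra.
Qed.

Section OneTrace.
Variables (m : nat) (q : {poly int}) (a : seq R) (gam alpha : R).
Hypotheses (qm : q \is monic) (szq : size q = m.+2) (ha : roots_in_lt m 4 (toR q) a).
Hypotheses (rg : root (toR q) gam) (gam4 : 4 < gam).
Hypotheses (alpha1 : 1 < alpha) (alphaE : (alpha + 1) ^+ 2 = gam * alpha).
Let p := trlift m.+1 q.
Let aC : C := (alpha%:C)%C.

Lemma trace_poly_roots : toR q = \prod_(x <- gam :: a) ('X - x%:P).
Proof.
have [sza sa aI ar] := ha.
have := @all_roots_prod_XsubC _ (toR q) (gam :: a).
rewrite size_map_int szq uniq_rootsE /= sza rg ar => /(_ erefl erefl)->.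
  have : toR q \is monic by apply: monic_map.
  by rewrite monicE => /eqP ->; rewrite scale1r.
rewrite lt_sorted_uniq // andbT; apply/negP => gi.
by have /andP[_] := allP aI _ gi; rewrite ltNge ltW.
Qed.

Let cs : seq C := [seq (x%:C)%C | x <- gam :: a].

Let pC : toC p = \prod_(c <- cs) (('X + 1) ^+ 2 - c *: 'X).
Proof.
apply: trlift_toC_prod; first by rewrite size_map /=; case: ha => ->.
rewrite -toR_toC trace_poly_roots rmorph_prod big_map; apply: eq_bigr => x _.
by rewrite /= map_polyXsubC.
Qed.

Lemma salem_poly_root z : root (toC p) z -> [\/ z = aC, z = aC^-1 | `|z| = 1].
Proof.
have a0 : alpha != 0 by rewrite gt_eqF // (lt_trans _ alpha1).
have aC0 : aC != 0 by rewrite (inj_eq (@complexI R) alpha 0).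
rewrite pC rootE horner_prod prodf_seq_eq0 => /hasP[c /mapP[x xs ->]] /=.
rewrite horner_quad => /eqP hz; move: xs; rewrite inE => /predU1P[xg|xa]; last first.
  by apply: Or33; apply: quad_circle hz; case: ha => _ _ /allP/(_ _ xa).
have [z0 gE] := quad_root hz.
have : (z - aC) * (z - aC^-1) = 0.
  have -> : (z - aC) * (z - aC^-1) = (z + 1) ^+ 2 - (aC + 1) ^+ 2 / aC * z by field.
  rewrite (_ : (aC + 1) ^+ 2 / aC = (x%:C)%C) //.
  rewrite /aC -(rmorph1 (real_complex R)) -rmorphD -rmorphXn -fmorph_div alphaE.
  by rewrite mulfK // xg.
by move/eqP; rewrite mulf_eq0 !subr_eq0 => /orP[]/eqP ->; [apply: Or31 | apply: Or32].
Qed.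

Lemma root_alpha : root (toR p) alpha.
Proof.
have a0 : alpha != 0 by rewrite gt_eqF // (lt_trans _ alpha1).
rewrite (map_trlift (intr : {rmorphism int -> R})) rootE horner_trlift ?size_map_int ?szq //=.
by rewrite alphaE mulfK // (rootP rg) mulr0.
Qed.

Lemma p_monic : p \is monic /\ size p = (2 * m.+1).+1.
Proof. by apply: trlift_monic. Qed.

Lemma trace_salem : (0 < m)%N -> irreducible_poly (toQ p) ->
  salem_of_degree (2 * (m + 1)) alpha.
Proof.
move=> m0 ip; have [pm szp] := p_monic.
have a0 : 0 < alpha by apply: lt_trans alpha1.
have aC1 : 1 < aC by rewrite (ltcR 1).
have na : `|aC| = aC by rewrite ger0_norm // ler0c ltW.
exists p; split=> //.
- by split=> //; exact: root_alpha.
- by rewrite szp /= addn1.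
- move=> z /salem_poly_root[->|->|->] //; first by rewrite eqxx.
  by move=> _; rewrite normfV na invf_le1 ?(lt_trans ltr01 aC1) // ltW.
(* As m > 0, there is a root x of q in (0, 4), and it provides the conjugate on the unit circle. *)
have [sza sa aI ar] := ha.
case: a sza aI @cs pC => [|x a'] sza aI cs' pC'; first by rewrite -sza in m0.
have [z hz] := exists_quad_root ((x%:C)%C : C); exists z.
have xI : 0 < x < 4 by case/andP: aI.
have z1 := quad_circle xI hz; split=> //.
  by rewrite pC' rootE horner_prod prodf_seq_eq0; apply/hasP; exists (x%:C)%C;
    rewrite ?inE ?eqxx ?orbT //= horner_quad hz.
apply/eqP => h; move: z1; rewrite h -/aC na => h1.
by move: alpha1; rewrite (complexI h1) ltxx.
Qed.


Lemma trace_root (z : C) : z != 0 -> root (toC p) z -> root (toC q) ((z + 1) ^+ 2 / z).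
Proof.
move=> z0; rewrite (map_trlift (intr : {rmorphism int -> C})) !rootE /=.
by rewrite horner_trlift ?size_map_int ?szq // mulf_eq0 expf_eq0 (negPf z0).
Qed.

Let aC_unit : [/\ aC != 0, `|aC| = aC & 1 < aC].
Proof.
have a0 : 0 < alpha by apply: lt_trans alpha1.
split; first by rewrite (inj_eq (@complexI R) alpha 0) gt_eqF.
  by rewrite ger0_norm // ler0c ltW.
by rewrite (ltcR 1).
Qed.

Let root_norm_le1 z : root (toC p) z -> z != aC -> `|z| <= 1.
Proof.
have [aC0 na aC1] := aC_unit.
move=> /salem_poly_root[->|->|->] //; first by rewrite eqxx.
by move=> _; rewrite normfV na invf_le1 ?(lt_trans ltr01 aC1) // ltW.
Qed.

(** Ensures that in a factorization of p one factor does not vanish at alpha. Only gam > 4 lies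
    under alpha, and its quadratic has the distinct roots alpha and 1 / alpha. *)
Lemma alpha_simple_root : (toC p)^`().[aC] != 0.
Proof.
have [aC0 na aC1] := aC_unit.
pose gC : C := (gam%:C)%C.
have aE : (aC + 1) ^+ 2 = gC * aC.
  rewrite /aC /gC -(rmorph1 (real_complex R)) -rmorphD -rmorphXn alphaE.
  exact: rmorphM.
rewrite pC /cs /= big_cons derivM hornerD hornerM [X in _ + X]hornerM.
rewrite horner_quad -/gC aE subrr mul0r addr0; apply: mulf_neq0.
  rewrite derivB derivZ derivX expr2 derivM derivD derivX -polyC1 derivC addr0.
  rewrite mul1r mulr1 !hornerE /=.
  have -> : aC + 1 + aC + 1 - gC = (aC + 1) * (aC - 1) / aC.
    have -> : gC = (aC + 1) ^+ 2 / aC by rewrite aE mulfK.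
    by field; exact: aC0.
  rewrite !mulf_neq0 ?invr_eq0 // ?subr_eq0; last by rewrite gt_eqF.
  by rewrite gt_eqF // addr_gt0 // (lt_trans _ aC1).
rewrite horner_prod prodf_seq_neq0; apply/allP => _ /mapP[x xa ->] /=.
rewrite horner_quad aE -mulrBl mulf_neq0 // subr_eq0.
rewrite (inj_eq (@complexI R)) gt_eqF //; apply: lt_trans gam4.
by have [_ _ /allP/(_ _ xa)/andP[]] := ha.
Qed.

Let p_coef0 : p`_0 = 1.
Proof.
have [pm szp] := p_monic.
apply: (@intr_inj C); rewrite -(coef_map (intr : {rmorphism int -> C})) /= pC.
rewrite -horner_coef0 horner_prod big1_seq // => c _.
by rewrite horner_quad add0r expr1n mulr0 subr0.
Qed.

Lemma prod_le1_eq1 (s : seq C) : all (fun x => 0 <= x <= 1) s ->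
  \prod_(x <- s) x = 1 -> all (fun x => x == 1) s.
Proof.
elim: s => //= x s IH /andP[/andP[x0 x1] hs]; rewrite big_cons => e.
have h0 : 0 <= \prod_(y <- s) y by rewrite big_seq prodr_ge0 // => y /(allP hs)/andP[].
have h1 : \prod_(y <- s) y <= 1.
  by rewrite big_seq; apply: prodr_ile1 => y /(allP hs).
have x1' : x = 1.
  by apply/le_anti; rewrite x1 /=; have := ler_piMr x0 h1; rewrite e.
by move: e; rewrite x1' mul1r eqxx; apply: IH.
Qed.

Lemma norm_coef_prod (s : seq C) k : all (fun z => `|z| <= 1) s ->
  `|(\prod_(z <- s) ('X - z%:P))`_k| <= 2 ^+ size s.
Proof.
elim: s k => [|z s IH] k /=.
  by move=> _; rewrite big_nil coef1 expr0; case: eqP; rewrite ?normr1 ?normr0.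
case/andP => z1 hs; rewrite big_cons mulrBl coefB coefXM coefCM exprS.
apply: (le_trans (ler_normB _ _)); rewrite mulrDl mul1r; apply: lerD.
  by case: ifP => _; rewrite ?normr0 ?exprn_ge0 //; apply: IH.
rewrite normrM -[X in _ <= X]mul1r ler_pM //; exact: IH.
Qed.

(** g is a factor that does not vanish at alpha. All its roots have modulus at most 1, and its
    leading coefficient is a unit, so its coefficients are at most those of (X + 1)^(2 (m + 1)), and
    in particular at most the given power of 2. *)
Lemma trace_reducible : ~ irreducible_poly (toQ p) -> exists g (z : C),
  [/\ g != 0, (size g <= (2 * m.+1).+1)%N, forall k, `|g`_k| <= (2 ^ (2 * m.+1))%N%:Z,
      root (toC g) z & root (toR q) (complex.Re ((z + 1) ^+ 2 / z))].
Proof.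
move=> nip; have [pm szp] := p_monic; have [aC0 na aC1] := aC_unit.
have [|g1 [g2 [pE s1 s2]]] := reducible_factors _ nip; first by rewrite szp.
have wlog_g : exists g h, [/\ p = g * h, (1 < size g)%N & ~~ root (toC g) aC].
  have [r1|] := boolP (root (toC g1) aC); last by exists g1, g2.
  have [r2|] := boolP (root (toC g2) aC); last by exists g2, g1; rewrite mulrC.
  have := alpha_simple_root; rewrite pE rmorphM derivM hornerD !hornerM.
  by rewrite (rootP r1) (rootP r2) mulr0 mul0r addr0 eqxx.
have [g [h [gE sg ng]]] := wlog_g.
have p0 : p != 0 by apply: monic_neq0.
have g0 : g != 0 by apply: contraNneq p0 => e; rewrite gE e mul0r.
have h0 : h != 0 by apply: contraNneq p0 => e; rewrite gE e mulr0.
have szg : (size g <= (2 * m.+1).+1)%N.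
  rewrite -szp gE size_mul //; have : (0 < size h)%N by rewrite size_poly_gt0.
  by case: (size h) => // k _; rewrite addnS /= leq_addr.
have int_unit (x y : int) : x * y = 1 -> `|x| = 1.
  move=> e; have /eqP := congr1 absz e; rewrite abszM muln_eq1 => /andP[/eqP x1 _].
  by rewrite -abszE x1.
have lg : `|lead_coef g| = 1.
  apply: (int_unit _ (lead_coef h)); rewrite -lead_coefM -gE; exact/eqP.
have cg : `|g`_0| = 1.
  by apply: (int_unit _ (h`_0)); rewrite -coef0M -gE.
have [zs zsE] := closed_field_poly_normal (toC g).
have lC : `|lead_coef (toC g)| = 1.
  rewrite lead_coef_map_inj //; [|exact: intr_inj].
  by rewrite -intr_norm lg.
have szzs : (size zs).+1 = size g.
  have := size_map_int C g; rewrite zsE size_scale ?size_prod_XsubC //.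
  by rewrite -normr_eq0 lC oner_eq0.
have rzs z : z \in zs -> root (toC g) z.
  move=> zz; rewrite zsE rootZ; first by rewrite root_prod_XsubC.
  by rewrite -normr_eq0 lC oner_eq0.
have rp z : z \in zs -> root (toC p) z.
  by move=> /rzs rz; rewrite gE rmorphM rootM rz.
have zle z : z \in zs -> `|z| <= 1.
  move=> zz; apply: root_norm_le1; first exact: rp.
  by apply: contraNneq ng => <-; exact: rzs.
(* The constant coefficient is a unit as well. Moduli at most 1 with product 1 are all equal to
   1. *)
have prodn : \prod_(x <- [seq `|z| | z <- zs]) x = 1.
  rewrite big_map -normr_prod.
  have : `|(toC g)`_0| = 1.
    by rewrite (coef_map (intr : {rmorphism int -> C})) /= -intr_norm cg.
  rewrite zsE coefZ normrM lC mul1r -horner_coef0 horner_prod.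
  move=> e1; rewrite -[RHS]e1 !normr_prod; apply: eq_bigr => z _.
  by rewrite hornerXsubC sub0r normrN.
have all1 : all (fun x => x == 1) [seq `|z| | z <- zs].
  apply: prod_le1_eq1 => //; rewrite all_map; apply/allP => z zz /=.
  by rewrite normr_ge0 zle.
case: zs szzs rzs rp zle all1 zsE {prodn} => [|z zs] szzs rzs rp zle all1 zsE.
  by rewrite -szzs in sg.
have z1 : `|z| = 1 by move: all1 => /= /andP[/eqP].
have z0 : z != 0 by rewrite -normr_eq0 z1 oner_eq0.
exists g, z; split=> //; last first.
- rewrite -root_toC_toR -real_of_ge0; last by rewrite circle_trace // exprn_ge0.
  by apply: trace_root => //; apply: rp; rewrite mem_head.
- by apply: rzs; rewrite mem_head.
move=> k; rewrite -(ler_int C) intr_norm -(coef_map (intr : {rmorphism int -> C})) /=.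
rewrite zsE coefZ normrM lC mul1r.
apply: (le_trans (norm_coef_prod _ _)); first by apply/allP => y; apply: zle.
rewrite -natrX ler_nat leq_exp2l // -ltnS; apply: leq_trans szg.
by rewrite -szzs.
Qed.

End OneTrace.
End TraceToSalem.
(** * Counting *)

Section IntegerFamily.
Variable R : realType.
Local Notation C := R[i].
Local Notation toQ := (map_poly (intr : int -> rat)).
Local Notation toR := (map_poly (intr : int -> R)).
Local Notation toC := (map_poly (intr : int -> C)).
Implicit Types (p q g : {poly int}) (i : seq int).

(** The minus signs are such that division by - T gives the unshifted lattice family with u = 1. *)
Definition tracepoly (T : nat) i : {poly int} :=
  foldl (fun A j => 'X * A - j%:P) ('X - T%:Z%:P) i.

Definition noshift (A : {poly R}) : R := 0.

Lemma tracepoly_rcons T i j : tracepoly T (rcons i j) = 'X * tracepoly T i - j%:P.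
Proof. by rewrite /tracepoly foldl_rcons. Qed.

Lemma tracepoly_fam T i : (0 < T)%N ->
  - T%:R^-1 *: toR (tracepoly T i) = fam T%:R noshift (fam0 T%:R 1) i.
Proof.
move=> T0; have Tn0 : T%:R != 0 :> R by rewrite pnatr_eq0 -lt0n.
elim/last_ind: i => [|i j IH].
  rewrite /fam /fam0 /tracepoly /= map_polyXsubC -!mul_polyC.
  apply/polyP => k; rewrite coefCM !coefB coefCM coefX !coefC.
  case: k => [|[|k]] /=; [by field|ring|ring].
rewrite tracepoly_rcons fam_rcons -IH /step /noshift addr0.
rewrite rmorphB rmorphM /= map_polyX map_polyC /= -!mul_polyC.
by rewrite mulrBr polyCM !polyCN; ring.
Qed.

Lemma size_tracepoly T i : tracepoly T i \is monic /\ size (tracepoly T i) = (size i).+2.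
Proof.
elim/last_ind: i => [|i j [mo sz]].
  by rewrite /tracepoly /= monicXsubC size_XsubC.
have p0 : tracepoly T i != 0 by apply: monic_neq0.
have szX : size ('X * tracepoly T i) = (size i).+3 by rewrite mulrC size_mulX // sz.
have lt : (size (- j%:P : {poly int})%R < size ('X * tracepoly T i)%R)%N.
  by rewrite szX size_polyN ltnS (leq_trans (size_polyC_leq1 _)).
rewrite tracepoly_rcons size_rcons; split; last by rewrite size_polyDl.
rewrite monicE lead_coefDl // -monicE monicMr //; exact: monicX.
Qed.

Lemma tracepoly_surj q (T : nat) m : q \is monic -> size q = m.+2 -> q`_m = - T%:Z ->
  exists2 i, size i = m & q = tracepoly T i.
Proof.
elim: m q => [|m IH] q qm szq qT.
  exists [::] => //; rewrite /tracepoly /=; apply/polyP => k.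
  rewrite coefB coefX coefC; case: k => [|[|k]]; rewrite ?subr0 ?sub0r //.
    by move: qm; rewrite monicE lead_coefE szq => /eqP.
  by rewrite nth_default // szq.
have qE : q = 'X * drop_poly 1 q - (- q`_0)%:P.
  apply/polyP => k; rewrite coefB coefXM coef_drop_poly addn1 coefC.
  by case: k => [|k] /=; rewrite ?sub0r ?opprK ?subr0.
have szd : size (drop_poly 1 q) = m.+2 by rewrite size_drop_poly szq subn1.
have [|//||i szi iE] := IH (drop_poly 1 q).
- rewrite monicE lead_coefE szd coef_drop_poly addn1.
  by move: qm; rewrite monicE lead_coefE szq.
- by rewrite coef_drop_poly addn1.
exists (rcons i (- q`_0)); first by rewrite size_rcons szi.
by rewrite tracepoly_rcons -iE.
Qed.

Lemma tracepoly_inj T T' i i' : size i = size i' -> tracepoly T i = tracepoly T' i' ->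
  T = T' /\ i = i'.
Proof.
elim/last_ind: i i' => [|i j IH] i'; case/lastP: i' => [|i' j'] //=;
  rewrite ?size_rcons // => e.
  move=> /(congr1 (fun p : {poly int} => p`_0)).
  by rewrite /tracepoly /= !coefB !coefX !coefC !sub0r => /oppr_inj [->].
rewrite !tracepoly_rcons => h; have hk k := congr1 (fun p : {poly int} => p`_k) h.
have jj : j = j'.
  by have := hk 0%N; rewrite !coefB !coefXM !coefC !sub0r => /oppr_inj.
have [||-> ->] := IH i'; rewrite ?jj //; first by case: e.
by apply/polyP => k; have := hk k.+1; rewrite !coefB !coefXM !coefC !subr0.
Qed.

Lemma tracepoly_entries T i j : j \in i -> exists k, (tracepoly T i)`_k = - j.
Proof.
elim/last_ind: i => // i j' IH; rewrite mem_rcons inE tracepoly_rcons => /predU1P[->|/IH[k kE]].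
  by exists 0%N; rewrite coefB coefXM coefC sub0r.
by exists k.+1; rewrite coefB coefXM coefC subr0.
Qed.

Lemma good_tracepoly T i m : (0 < T)%N -> 
  reflect (exists a, roots_in_lt m 4 (toR (tracepoly T i)) a)
    (good m 4 (fam T%:R noshift (fam0 T%:R 1) i)).
Proof.
move=> T0; have Tn0 : - T%:R^-1 != 0 :> R by rewrite oppr_eq0 invr_eq0 pnatr_eq0 -lt0n.
rewrite -tracepoly_fam //; have [mo sz] := size_tracepoly T i.
have q0 : toR (tracepoly T i) != 0 by rewrite -size_poly_eq0 size_map_int sz.
apply: (iffP (goodP _ _ _)); first by rewrite scaler_eq0 negb_or Tn0.
  case=> a [h1 h2 h3 h4]; exists a; split=> //.
  by apply: sub_all h4 => x; rewrite rootZ.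
case=> a [h1 h2 h3 h4]; exists a; split=> //.
by apply: sub_all h4 => x; rewrite rootZ.
Qed.

Lemma tracepoly_factor T i m a : (0 < T)%N -> size i = m ->
  roots_in_lt m 4 (toR (tracepoly T i)) a ->
  toR (tracepoly T i) = \prod_(x <- a) ('X - x%:P) * ('X - (T%:R - \sum_(x <- a) x)%:P).
Proof.
move=> T0 szi ha; have [mo sz] := size_tracepoly T i.
have Tn0 : T%:R != 0 :> R by rewrite pnatr_eq0 -lt0n.
have TR : 0 < T%:R :> R by rewrite ltr0n.
have [sza sa aI ar] := ha.
have sh := @shape_fam R T%:R TR noshift 1 i; rewrite szi in sh.
have ar' : all (root (fam T%:R noshift (fam0 T%:R 1) i)) a.
  rewrite -tracepoly_fam //; apply: sub_all ar => x; rewrite rootZ //.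
  by rewrite oppr_eq0 invr_eq0.
have := shape_factor sh sza (lt_sorted_uniq sa) ar'; rewrite -tracepoly_fam // => e.
have -> : toR (tracepoly T i) = - T%:R *: (- T%:R^-1 *: toR (tracepoly T i)).
  by rewrite scalerA mulrNN divff // scale1r.
rewrite e scalerAr; congr (_ * _).
apply/polyP => k; rewrite coefZ !coefB coefZ coefX !coefC.
by case: k => [|[|k]] /=; [field | field | ring].
Qed.

Definition goodcount (M m T : nat) : nat :=
  count (fun i => good m 4 (fam T%:R noshift (fam0 (T%:R : R) 1) i)) (box M m).

(** The window is proportional to T since [covers] bounds M / T from below, here by a constant as
    there is no shift. [Kn] stays free because other bounds will constrain it too. *)
Lemma goodcount_asymptotics m : exists K0 : R, forall Kn : nat, K0 <= Kn%:R ->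
  exists2 C1 : R, 0 <= C1 & forall T, (0 < T)%N ->
  `|(goodcount (Kn * T) m.+1 T)%:R - simplexint m.+1 4 [::] * T%:R ^+ m.+1| <= C1 * T%:R ^+ m.
Proof.
have [K [C0 [K0 C00 h]]] := lattice_avg_estimate R m.+1 0 0.
exists K => Kn hKn; pose I : R := simplexint m.+1 4 [::].
pose err T := `|(goodcount (Kn * T) m.+1 T)%:R - I * T%:R ^+ m.+1|.
(* [lattice_avg_estimate] applies for T above 4 (m + 2). The finitely many smaller T are absorbed in
   the constant. *)
pose T0 := (4 * m.+2).+1.
exists (C0 + \sum_(T < T0) err T) => [|T Tp].
  by apply: addr_ge0 => //; apply: sumr_ge0 => T _; apply: normr_ge0.
rewrite -/(err T) mulrDl.
have Tm : 1 <= T%:R ^+ m :> R by rewrite exprn_ege1 // ler1n.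
have s0 : 0 <= \sum_(T < T0) err T by apply: sumr_ge0 => k _; apply: normr_ge0.
have [TT0|TT0] := ltnP T T0.
  apply: (@le_trans _ _ (\sum_(T < T0) err T)).
    by rewrite (bigD1 (Ordinal TT0)) //= lerDl; apply: sumr_ge0 => k _; apply: normr_ge0.
  apply: (@le_trans _ _ ((\sum_(T < T0) err T) * T%:R ^+ m)); first by rewrite ler_peMr.
  by rewrite lerDr mulr_ge0 // exprn_ge0.
have TR : 0 < T%:R :> R by rewrite ltr0n.
have := h T%:R 1 4 [::] noshift (Kn * T)%N.
case/(_ _ _ _ _ _ _ _)/wrap; rewrite ?add0n ?ltr_nat ?mul0r ?subr0 //.
- by rewrite lexx andbT.
- move=> A _ _; rewrite /noshift normr0 add0r natrM mulfK //.
  by rewrite pnatr_eq0 -lt0n.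
have -> : lattice_avg T%:R (Kn * T) m.+1 noshift 1 4 [::] =
    T%:R ^- m.+1 * (goodcount (Kn * T) m.+1 T)%:R.
  rewrite /lattice_avg /goodcount -sum1_count natr_sum [in RHS]big_mkcond; congr (_ * _).
  by apply: eq_bigr => i _; rewrite big_nil mulr1; case: ifP.
move=> e; apply: (@le_trans _ _ (C0 * T%:R ^+ m)); last first.
  by rewrite lerDl mulr_ge0 // exprn_ge0.
have Tm1 : 0 < T%:R ^+ m.+1 :> R by rewrite exprn_gt0.
have -> : err T = T%:R ^+ m.+1 * `|T%:R ^- m.+1 * (goodcount (Kn * T) m.+1 T)%:R - I|.
  rewrite /err -{2}(gtr0_norm Tm1) -normrM mulrBr mulrA divff ?gt_eqF // mul1r.
  by rewrite [I * _]mulrC.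
have -> : C0 * T%:R ^+ m = T%:R ^+ m.+1 * (C0 / T%:R).
  by rewrite exprS; field; rewrite gt_eqF.
by rewrite ler_pM2l.
Qed.

Definition rootcount (M m T : nat) (x : R) : nat :=
  count (fun i => root (toR (tracepoly T i)) x) (box M m).

Lemma size_box M m : size (box M m) = ((2 * M).+1 ^ m)%N.
Proof.
elim: m => // m IH.
by rewrite (size_allpairs (@rcons int) (box M m) (zrange M)) IH expnSr size_map size_iota.
Qed.

(* The last coordinate is determined by the others. *)
Lemma rootcount_le M m T x : (rootcount M m.+1 T x <= (2 * M).+1 ^ m)%N.
Proof.
rewrite -size_box /rootcount -sum1_count big_mkcond big_box /= -sum1_size.
apply: leq_sum => i _; rewrite -big_mkcond sum1_count.
have h j : root (toR (tracepoly T (rcons i j))) x = (j%:~R == x * (toR (tracepoly T i)).[x]).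
  rewrite tracepoly_rcons rmorphB rmorphM /= map_polyX map_polyC rootE !hornerE.
  by rewrite subr_eq0 eq_sym.
have [[j0 /eqP j0E]|nj] := pselect (exists j0 : int, j0%:~R == x * (toR (tracepoly T i)).[x]).
  rewrite (@eq_count _ _ (pred1 j0)); last by move=> j /=; rewrite h -j0E eqr_int.
  by rewrite count_uniq_mem ?zrange_uniq // leq_b1.
rewrite (@eq_count _ _ pred0) ?count_pred0 // => j; rewrite h.
by apply/negP => e; apply: nj; exists j.
Qed.

End IntegerFamily.

(** * Summation over T *)

Section PowerSums.
Variable R : realFieldType.

Lemma exprD_le (c : R) n : 0 <= c ->
  exists2 D, 0 <= D & forall H, 1 <= H -> (H + c) ^+ n.+1 <= H ^+ n.+1 + D * H ^+ n.
Proof.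
move=> c0; elim: n => [|n [D D0 IH]].
  by exists c => // H H1; rewrite !expr1 expr0 mulr1.
exists (c + D + c * D); first by rewrite !addr_ge0 // mulr_ge0.
move=> H H1; have H0 : 0 <= H by apply: le_trans H1.
rewrite exprS; apply: (@le_trans _ _ ((H + c) * (H ^+ n.+1 + D * H ^+ n))).
  by apply: ler_wpM2l; [apply: addr_ge0 | apply: IH].
rewrite -subr_ge0.
have -> : H ^+ n.+2 + (c + D + c * D) * H ^+ n.+1 - (H + c) * (H ^+ n.+1 + D * H ^+ n) =
    c * D * H ^+ n * (H - 1) by rewrite !exprS; ring.
by rewrite !mulr_ge0 ?exprn_ge0 ?subr_ge0.
Qed.

(** Telescopes (k + 1)^(m+1) - k^(m+1), which lies between (m + 1) k^m and (m + 1) (k + 1)^m. *)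
Lemma sum_powers m N : (N%:R : R) ^+ m.+1 <= m.+1%:R * \sum_(1 <= T < N.+1) (T%:R : R) ^+ m
   <= (N.+1%:R : R) ^+ m.+1.
Proof.
have step (k : nat) (x := k%:R : R) (y := k.+1%:R : R) :
    (m.+1%:R * x ^+ m <= y ^+ m.+1 - x ^+ m.+1) &&
    (y ^+ m.+1 - x ^+ m.+1 <= m.+1%:R * y ^+ m).
  have yx : y = x + 1 by rewrite natr1.
  have eqs : y ^+ m.+1 - x ^+ m.+1 = \sum_(i < m.+1) y ^+ (m - i) * x ^+ i.
    by rewrite subrXX {1}yx addrAC subrr add0r mul1r.
  have e (z : R) : m.+1%:R * z = \sum_(i < m.+1) z by rewrite sumr_const card_ord mulr_natl.
  have xy : x <= y by rewrite yx lerDl.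
  have x0 : 0 <= x by rewrite ler0n.
  have y0 : 0 <= y by rewrite ler0n.
  rewrite eqs !e; apply/andP; split; apply: ler_sum => i _;
    have im : (i <= m)%N by rewrite -ltnS.
    have -> : x ^+ m = x ^+ (m - i) * x ^+ i by rewrite -exprD subnK.
    by rewrite ler_pM ?exprn_ge0 // lerXn2r ?nnegrE.
  have -> : y ^+ m = y ^+ (m - i) * y ^+ i by rewrite -exprD subnK.
  by rewrite ler_pM ?exprn_ge0 // lerXn2r ?nnegrE.
elim: N => [|N /andP[IH1 IH2]].
  by rewrite big_geq // mulr0 expr0n /= lexx exprn_ge0.
rewrite big_nat_recr //= mulrDr.
have /andP[h1 _] := step N.+1; have /andP[_ h2] := step N.
by apply/andP; split; move: IH1 IH2 h1 h2; lra.
Qed.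

(** Here N is the integer part of H. For T <= N the asymptotics of p is needed. The c further values
    of T allow for T exceeding alpha by a bounded amount; only some of their polynomials have alpha
    <= H, but an upper bound is enough, as each contributes O(H^(m+1)). *)
Lemma count_asymptotics m (I C1 C2 : R) (c : nat) : 0 <= I -> 0 <= C1 -> 0 <= C2 ->
  exists C : R, forall (p : nat -> R) (H : R) N, 1 <= H -> N%:R <= H -> H < N.+1%:R ->
  (forall T, (0 < T)%N -> (T <= N)%N -> `|p T - I * T%:R ^+ m.+1| <= C1 * T%:R ^+ m) ->
  (forall T, (N < T)%N -> 0 <= p T <= I * T%:R ^+ m.+1 + C2 * T%:R ^+ m) ->
  `|\sum_(1 <= T < (N + c).+1) p T - I / m.+2%:R * H ^+ m.+2| <= C * H ^+ m.+1.
Proof.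
move=> I0 C10 C20.
have [D D0 hD] := @exprD_le 1 m.+1 ler01.
exists (C1 + I * D + c%:R * ((I + C2) * (1 + c%:R) ^+ m.+1)) => p H N H1 NH HN hp1 hp2.
have H0 : 0 <= H by apply: le_trans H1.
have N1 : (1 <= N)%N by have := le_lt_trans H1 HN; rewrite ltr1n.
rewrite (@big_cat_nat _ _ _ N.+1) //=; last by rewrite ltnS leq_addr.
set S1 := \sum_(1 <= T < N.+1) p T; set S2 := \sum_(N.+1 <= T < _) p T.
pose S := \sum_(1 <= T < N.+1) T%:R ^+ m.+1 : R.
have e1 : `|S1 - I * S| <= C1 * H ^+ m.+1.
  rewrite mulr_sumr -sumrB; apply: (le_trans (ler_norm_sum _ _ _)).
  apply: (@le_trans _ _ (\sum_(1 <= T < N.+1) C1 * N%:R ^+ m)).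
    rewrite !big_nat; apply: ler_sum => T /andP[T0 TN].
    apply: (le_trans (hp1 T T0 TN)); apply: ler_wpM2l => //.
    by rewrite lerXn2r ?nnegrE // ler_nat.
  rewrite sumr_const_nat subn1 /= -mulrnAr; apply: ler_wpM2l => //.
  rewrite -mulr_natr -exprSr lerXn2r ?nnegrE //.
have e2 : `|I * S - I / m.+2%:R * H ^+ m.+2| <= I * D * H ^+ m.+1.
  have -> : I * S - I / m.+2%:R * H ^+ m.+2 = I / m.+2%:R * (m.+2%:R * S - H ^+ m.+2).
    by rewrite mulrBr [in RHS]mulrA divfK // pnatr_eq0.
  have q0 : 0 <= I / m.+2%:R by rewrite mulr_ge0 // invr_ge0.
  have q1 : I / m.+2%:R <= I by rewrite ler_pdivrMr ?ltr0n // ler_peMr // ler1n.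
  rewrite normrM ger0_norm // -mulrA; apply: ler_pM => //.
  have /andP[s1 s2] := sum_powers m.+1 N; rewrite -/S in s1 s2.
  have d1 := hD H H1.
  have d2 : (N%:R + 1) ^+ m.+2 <= N%:R ^+ m.+2 + D * N%:R ^+ m.+1 :> R.
    by apply: hD; rewrite ler1n.
  have d3 : D * N%:R ^+ m.+1 <= D * H ^+ m.+1.
    by apply: ler_wpM2l => //; rewrite lerXn2r ?nnegrE.
  have d4 : N.+1%:R ^+ m.+2 <= (H + 1) ^+ m.+2.
    by rewrite lerXn2r ?nnegrE ?addr_ge0 // -natr1 lerD2r.
  have d5 : H ^+ m.+2 <= (N%:R + 1) ^+ m.+2.
    by rewrite natr1 lerXn2r ?nnegrE // ltW.
  rewrite ler_norml; apply/andP; split; lra.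
have e3 : 0 <= S2 <= c%:R * ((I + C2) * (1 + c%:R) ^+ m.+1) * H ^+ m.+1.
  apply/andP; split.
    by rewrite /S2 big_nat sumr_ge0 // => T /andP[NT _]; have /andP[] := hp2 T NT.
  apply: (@le_trans _ _ (\sum_(N.+1 <= T < (N + c).+1) (I + C2) * ((1 + c%:R) ^+ m.+1 * H ^+ m.+1))).
    rewrite /S2 !big_nat; apply: ler_sum => T /andP[NT Tc].
    have /andP[_ h] := hp2 T NT; apply: (le_trans h).
    have TH : T%:R <= (1 + c%:R) * H.
      apply: (@le_trans _ _ (N%:R + c%:R)); first by rewrite -natrD ler_nat.
      by rewrite mulrDl mul1r lerD // ler_peMr.
    have Tm : T%:R ^+ m.+1 <= (1 + c%:R) ^+ m.+1 * H ^+ m.+1.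
      by rewrite -exprMn lerXn2r ?nnegrE // mulr_ge0 // addr_ge0.
    have Tm' : T%:R ^+ m <= T%:R ^+ m.+1 :> R.
      by rewrite ler_weXn2l // ler1n (leq_trans _ NT).
    rewrite [X in _ <= X]mulrDl; apply: lerD; first exact: ler_wpM2l.
    by apply: ler_wpM2l => //; apply: le_trans Tm.
  rewrite sumr_const_nat subSS addKn -[X in X <= _]mulr_natl.
  by rewrite !mulrA lexx.
have /andP[e4 e5] := e3.
have -> : S1 + S2 - I / m.+2%:R * H ^+ m.+2 =
   (S1 - I * S) + (I * S - I / m.+2%:R * H ^+ m.+2) + S2 by ring.
apply: (le_trans (ler_normD _ _)); rewrite 2!mulrDl; apply: lerD; last by rewrite ger0_norm.
by apply: (le_trans (ler_normD _ _)); apply: lerD.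
Qed.

End PowerSums.

(** * Salem numbers as lattice points *)

Section SalemCount.
Variable R : realType.
Local Notation C := R[i].
Local Notation toQ := (map_poly (intr : int -> rat)).
Local Notation toR := (map_poly (intr : int -> R)).
Local Notation toC := (map_poly (intr : int -> C)).
Implicit Types (p q g : {poly int}) (i : seq int).

Lemma ltz0_absz (x : int) : x < 0 -> x = - (absz x)%:Z /\ (0 < absz x)%N.
Proof. lia. Qed.

Lemma int_minpoly_uniq p p' (x : R) : is_int_minpoly p x -> is_int_minpoly p' x -> p = p'.
Proof.
move=> [pm ip rp] [pm' ip' rp'].
have dv : toQ p %| toQ p'.
  apply: contraT => ndv; have := irreducible_poly_coprime (toQ p') ip; rewrite ndv.
  rewrite -(coprimep_map (ratr : {rmorphism rat -> R})) /=.
  have toQR r : map_poly (ratr : rat -> R) (toQ r) = toR r.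
    by rewrite -map_poly_comp; apply: eq_map_poly => k /=; rewrite ratr_int.
  by rewrite !toQR => /coprimep_root/(_ rp); rewrite (rootP rp') eqxx.
have : toQ p %= toQ p'.
  by apply: ip'.2 dv; rewrite neq_ltn orbC; case: ip => ->.
rewrite eqp_monic ?monic_map // => /eqP e; apply/polyP => k.
have := congr1 (fun r : {poly rat} => r`_k) e; rewrite !coef_map_id0 //.
exact: intr_inj.
Qed.

Lemma salem_root_uniq d p (x y : R) : salem_of_degree d x -> is_int_minpoly p x ->
  root (toR p) y -> 1 < y -> y = x.
Proof.
move=> [p' [mp _ x1 hle _]] mp' ry y1.
rewrite -(int_minpoly_uniq mp mp') -root_toC_toR in ry.
apply: (@complexI R); apply/eqP; apply: contraT => /(hle _ ry).
rewrite ger0_norm; last by rewrite ler0c (le_trans ler01 (ltW y1)).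
by rewrite (lecR y 1) leNgt y1.
Qed.

(** The coefficient lists of all such g form a [box], and Z collects the traces of all their
    roots. *)
Lemma circle_traces n : exists Z : seq R, forall g (z : C), g != 0 -> (size g <= n.+1)%N ->
  (forall k, `|g`_k| <= (2 ^ n)%N%:Z) -> root (toC g) z ->
  complex.Re ((z + 1) ^+ 2 / z) \in Z.
Proof.
have /choice[f hf] : forall g, exists zs : seq C, g != 0 -> forall z, root (toC g) z -> z \in zs.
  move=> g; have [zs zsE] := closed_field_poly_normal (toC g); exists zs => g0 z.
  rewrite zsE rootZ ?root_prod_XsubC //.
  by rewrite lead_coef_eq0 -size_poly_eq0 size_map_int size_poly_eq0.
exists (flatten [seq [seq complex.Re ((z + 1) ^+ 2 / z) | z <- f (Poly s)] | s <- box (2 ^ n) n.+1]).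
move=> g z g0 szg hg rz; apply/flatten_mapP.
have gE : Poly (mkseq (fun k => g`_k) n.+1) = g.
  apply/polyP => k; rewrite coef_Poly; have [kn|kn] := ltnP k n.+1; first by rewrite nth_mkseq.
  by rewrite !nth_default ?size_mkseq // (leq_trans szg).
exists (mkseq (fun k => g`_k) n.+1).
  rewrite mem_box size_mkseq eqxx /mkseq all_map; apply/allP => k _; exact: hg.
by rewrite gE; apply: map_f; apply: hf.
Qed.

Section FixedDegree.
Variables (m : nat) (Kn : nat).
Hypothesis m0 : (0 < m)%N.
Hypothesis Kn5 : (2 * 5 ^ m <= Kn)%N.

Definition salem_at (H : R) (t : nat * seq int) (alpha : R) :=
  [/\ salem_of_degree (2 * (m + 1)) alpha, alpha <= H &
      is_int_minpoly (trlift m.+1 (tracepoly t.1 t.2)) alpha].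

Lemma trace_gt4 (alpha : R) : 1 < alpha -> 4 < (alpha + 1) ^+ 2 / alpha.
Proof.
move=> a1; have a0 : 0 < alpha by apply: lt_trans a1.
rewrite ltr_pdivlMr // -subr_gt0 (_ : _ - _ = (alpha - 1) ^+ 2); last by ring.
by rewrite exprn_gt0 // subr_gt0.
Qed.

(** By Vieta T is gam plus the m roots in (0, 4), and gam = alpha + 2 + 1 / alpha is at most H + 3,
    whence the range of T. The coefficients of q are at most 5^m (1 + gam) by [bounded_prod_XsubC],
    and 1 + gam <= 2 T, which explains the lower bound on [Kn]. *)
Lemma salem_in_box (H alpha : R) (N : nat) : H < N.+1%:R ->
  salem_of_degree (2 * (m + 1)) alpha -> alpha <= H ->
  exists T i, [/\ (0 < T < (N + (4 * m + 4)).+1)%N, i \in box (Kn * T) m & salem_at H (T, i) alpha].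
Proof.
move=> HN sal aH; have a1 : 1 < alpha by case: sal => ? [].
have a0 : 0 < alpha by apply: lt_trans a1.
have [q [qm szq mp rg [a ha]]] := salem_trace sal.
set gam := (alpha + 1) ^+ 2 / alpha in rg.
have g4 : 4 < gam by apply: trace_gt4.
have qE := trace_poly_roots qm szq ha rg g4.
have [sza sa aI ar] := ha.
have qtop : - (q`_m)%:~R = gam + \sum_(x <- a) x.
  have := @coefPn_prod_XsubC _ (gam :: a); rewrite /= sza -qE => /(_ isT).
  by rewrite coef_map_id0 // big_cons => ->; rewrite opprK.
have suma0 : 0 <= \sum_(x <- a) x.
  by rewrite big_seq sumr_ge0 // => x /(allP aI)/andP[/ltW].
have suma4 : \sum_(x <- a) x <= m%:R * 4.
  by rewrite -sza; apply: sum_le; apply: sub_all aI => x /andP[_ /ltW].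
have qneg : q`_m < 0.
  by rewrite -(ltrz0 R) -oppr_gt0 qtop; apply: lt_le_trans (lt_trans _ g4) _; rewrite // lerDl.
pose T := absz q`_m.
have [TE T0] := ltz0_absz qneg; rewrite -/T in TE T0.
have TR : T%:R = gam + \sum_(x <- a) x by rewrite -qtop TE rmorphN opprK.
have [i szi iE] := tracepoly_surj qm szq TE.
have ai : alpha^-1 <= 1 by rewrite invf_le1 // ltW.
have gE : gam = alpha + 2 + alpha^-1 by rewrite /gam; field; rewrite gt_eqF.
have gT : 1 + gam <= 2 * T%:R.
  have : 1 <= T%:R :> R by rewrite ler1n.
  by move: TR suma0; lra.
exists T, i; split; last by split=> //; rewrite -iE.
- rewrite T0 ltnS -ltnS -(ltr_nat R) TR.
  have : N.+1%:R + m%:R * 4 + 3 <= (N + (4 * m + 4)).+1%:R :> R.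
    by rewrite -natrM -!natrD ler_nat mulnC !addSn addnA ltnS leq_add2l.
  by move: HN aH suma4 ai; rewrite gE; lra.
rewrite mem_box szi eqxx /=; apply/allP => j /(tracepoly_entries T)[k].
rewrite -iE => kE; rewrite -normrN -kE.
have b1 : bounded (1 + gam) ('X - gam%:P).
  apply/boundedP; first by lra.
  move=> [|[|l]]; rewrite coefB coefX coefC /= ?sub0r ?subr0 ?normrN ?normr1 ?normr0.
  - by rewrite ger0_norm; lra.
  - by lra.
  by lra.
have g0 : 0 <= 1 + gam by lra.
have a4 : all (fun x => `|x| <= 4) a.
  by apply: sub_all aI => x /andP[x0 x4]; rewrite ger0_norm ltW.
have := bounded_prod_XsubC g0 a4 b1; rewrite sza.
rewrite (_ : _ * ('X - _) = toR q); last by rewrite qE big_cons mulrC.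
have K5 : 0 <= 5 ^+ m * (1 + gam) by rewrite mulr_ge0 // exprn_ge0.
move=> /(boundedP _ K5)/(_ k); rewrite coef_map_id0 // -intr_norm => hk.
rewrite -(ler_int R); apply: (le_trans hk); apply: (@le_trans _ _ (5 ^+ m * (2 * T%:R))).
  by rewrite ler_wpM2l // exprn_ge0.
have : (2 * 5 ^ m * T)%:R <= (Kn * T)%:R :> R by rewrite ler_nat leq_mul2r Kn5 orbT.
by rewrite !natrM natrX -pmulrn natrM; apply: le_trans; rewrite mulrA [5 ^+ m * 2]mulrC.
Qed.

Lemma salem_at_good H T i (alpha : R) : (0 < T)%N -> size i = m -> salem_at H (T, i) alpha ->
  good m 4 (fam T%:R (@noshift R) (fam0 T%:R 1) i).
Proof.
move=> T0 szi [sal _ mp]; have [q [qm szq mp' _ ha]] := salem_trace sal.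
have [mo sz] := size_tracepoly T i; rewrite szi in sz.
apply/good_tracepoly => //.
by rewrite -(trlift_inj _ _ (int_minpoly_uniq mp' mp)) ?szq ?sz.
Qed.

Lemma salem_at_inj H t t' (alpha : R) : size t.2 = m -> size t'.2 = m ->
  salem_at H t alpha -> salem_at H t' alpha -> t = t'.
Proof.
case: t t' => [T i] [T' i'] /= szi szi' [_ _ mp] [_ _ mp'].
have [_ sz] := size_tracepoly T i; have [_ sz'] := size_tracepoly T' i'.
have e := int_minpoly_uniq mp mp'.
have le1 : (size (tracepoly T i) <= m.+2)%N by rewrite sz szi.
have le2 : (size (tracepoly T' i') <= m.+2)%N by rewrite sz' szi'.
by have [-> ->] := tracepoly_inj (etrans szi (esym szi')) (trlift_inj le1 le2 e).
Qed.

(** The last root gam is T minus m roots in (0, 4). So T >= 4 m + 5 forces gam > 4, as needed for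
    alpha > 1, and alpha < gam <= T <= H. *)
Lemma good_salem_or_root (Z : seq R) (H : R) T i :
  (forall g (z : C), g != 0 -> (size g <= (2 * m.+1).+1)%N ->
  (forall k, `|g`_k| <= (2 ^ (2 * m.+1))%N%:Z) -> root (toC g) z ->
  complex.Re ((z + 1) ^+ 2 / z) \in Z) ->
  (4 * m + 5 <= T)%N -> T%:R <= H -> size i = m ->
  good m 4 (fam T%:R (@noshift R) (fam0 T%:R 1) i) ->
  (exists alpha, salem_at H (T, i) alpha) \/ has (root (toR (tracepoly T i))) Z.
Proof.
move=> hZ Tm TH szi; have T0 : (0 < T)%N by apply: leq_trans Tm; rewrite addnS.
case/(good_tracepoly _ _ _ T0) => a ha.
have [mo sz] := size_tracepoly T i; rewrite szi in sz.
have qE := tracepoly_factor T0 szi ha.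
have [sza sa aI ar] := ha.
pose gam := T%:R - \sum_(x <- a) x.
have suma0 : 0 <= \sum_(x <- a) x.
  by rewrite big_seq sumr_ge0 // => x /(allP aI)/andP[/ltW].
have suma4 : \sum_(x <- a) x <= m%:R * 4.
  by rewrite -sza; apply: sum_le; apply: sub_all aI => x /andP[_ /ltW].
have TR : 4 * m%:R + 5 <= T%:R :> R by rewrite -natrM -natrD ler_nat.
have g4 : 4 < gam by rewrite /gam; lra.
have gT : gam <= T%:R by rewrite /gam; lra.
have rg : root (toR (tracepoly T i)) gam.
  by rewrite qE rootM root_XsubC eqxx orbT.
(* The difference (x + 1)^2 - gam x is 4 - gam < 0 at 1 and 2 gam + 1 > 0 at gam. *)
have [alpha /andP[a1 ag] aE] : exists2 x : R, 1 < x < gam & (x + 1) ^+ 2 = gam * x.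
  have g1 : 1 <= gam by lra.
  have [|x] := @poly_ivtoo _ (('X + 1) ^+ 2 - gam *: 'X : {poly R}) 1 gam g1.
    rewrite !hornerD !hornerN !hornerZ !hornerX !horner_exp !hornerD !hornerX -polyC1 !hornerC.
    by rewrite pmulr_llt0; [lra | rewrite !expr2; nra].
  rewrite in_itv /= => hx /rootP; rewrite hornerD hornerN hornerZ hornerX horner_exp hornerD.
  rewrite hornerX -polyC1 hornerC => /eqP; rewrite subr_eq0 => /eqP.
  by exists x.
have [ip|nip] := pselect (irreducible_poly (toQ (trlift m.+1 (tracepoly T i)))).
  left; exists alpha; split.
  - exact: (trace_salem mo sz ha rg g4 a1 aE m0 ip).
  - by rewrite (le_trans (ltW ag)) // (le_trans gT).
  have [pm _] := p_monic mo sz.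
  by split=> //; apply: (root_alpha sz rg a1 aE).
right; have [g [z [g0 szg hg rz rx]]] := trace_reducible mo sz ha rg g4 a1 aE nip.
apply/hasP; exists (complex.Re ((z + 1) ^+ 2 / z)) => //.
exact: hZ hg rz.
Qed.

End FixedDegree.
End SalemCount.

(** * Comparison of the two counts and conclusion *)

Section SalemSeq.
Variable R : realType.

Lemma simplexint4_ge0 m : 0 <= simplexint m (4 : R) [::].
Proof.
rewrite simplexint4 mulr_ge0 // prodr_ge0 // => k _.
by rewrite mulr_ge0 // invr_ge0.
Qed.

Definition salem_count (m Kn : nat) (H : R) (T : nat) : nat :=
  count (fun i => `[< exists alpha, salem_at m H (T, i) alpha >]) (box (Kn * T) m).

(** The minimal polynomial determines the pair (T, i), and a Salem number is the only root greater
    than 1 of its minimal polynomial. So choosing one number for each pair that carries one lists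
    each Salem number once. *)
Lemma salem_seq m Kn N (H : R) : (0 < m)%N -> (2 * 5 ^ m <= Kn)%N -> H < N.+1%:R ->
  exists s : seq R, [/\ uniq s,
    forall alpha, alpha \in s <-> salem_of_degree (2 * (m + 1)) alpha /\ alpha <= H &
    size s = (\sum_(1 <= T < (N + (4 * m + 4)).+1) salem_count m Kn H T)%N].
Proof.
move=> m0 hKn HN.
have /choice[f hf] : forall t, exists alpha, (exists beta, salem_at m H t beta) ->
    salem_at m H t alpha.
  move=> t; have [[b hb]|nb] := pselect (exists beta, salem_at m H t beta).
    by exists b.
  by exists 0 => /nb.
pose L := [seq (T, i) | T <- index_iota 1 (N + (4 * m + 4)).+1, i <- box (Kn * T) m].
pose P t := `[< exists alpha, salem_at m H t alpha >].
have LP T i : ((T, i) \in L) = (0 < T < (N + (4 * m + 4)).+1)%N && (i \in box (Kn * T) m).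
  apply/allpairsPdep/idP => [[T' [i' [hT hi [-> ->]]]]|/andP[hT hi]].
    by rewrite hi andbT; move: hT; rewrite mem_index_iota.
  by exists T, i; split=> //; rewrite mem_index_iota.
have uL : uniq L.
  apply: allpairs_uniq_dep; rewrite ?iota_uniq //; first by move=> T _; apply: box_uniq.
  by move=> [T i] [T' i'] _ _ /= [-> ->].
have szL t : t \in L -> size t.2 = m.
  by case: t => T i; rewrite LP => /andP[_ /size_of_box].
exists (map f (filter P L)); split.
- rewrite map_inj_in_uniq ?filter_uniq // => t t'.
  rewrite !mem_filter => /andP[/asboolP Pt tL] /andP[/asboolP Pt' tL'] e.
  apply: (salem_at_inj (szL _ tL) (szL _ tL') (hf _ Pt)).
  by rewrite e; apply: hf.
- move=> alpha; split.
    move=> /mapP[t]; rewrite mem_filter => /andP[/asboolP Pt _] ->.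
    by have [] := hf _ Pt.
  move=> [sal aH]; have [T [i [hT hi st]]] := salem_in_box hKn HN sal aH.
  have Pt : exists beta, salem_at m H (T, i) beta by exists alpha.
  apply/mapP; exists (T, i).
    by rewrite mem_filter LP hT hi /= andbT; apply/asboolP.
  have [sal' aH' mp'] := hf _ Pt; have [_ _ mp] := st.
  have a1 : 1 < alpha by case: sal => ? [].
  by apply: (salem_root_uniq sal' mp') => //; case: mp.
rewrite size_map size_filter -sum1_count big_mkcond big_allpairs_dep.
by apply: eq_bigr => T _; rewrite /salem_count -sum1_count [RHS]big_mkcond.
Qed.

(** B covers the finitely many T too small for [good_salem_or_root], through G, and the reducible
    polynomials: these vanish at one of the points of Z, and each point costs at most (2 Kn T + 1)^m
    <= (3 Kn T)^m of them. *)
Lemma salem_count_estimate m (Kn : nat) : (2 * 5 ^ m.+1 <= Kn)%N -> (0 < Kn)%N ->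
  exists2 B : R, 0 <= B & forall (H : R) (T : nat), (0 < T)%N ->
    (salem_count m.+1 Kn H T <= goodcount R (Kn * T) m.+1 T)%N /\
    (T%:R <= H -> (goodcount R (Kn * T) m.+1 T)%:R <=
       (salem_count m.+1 Kn H T)%:R + B * T%:R ^+ m).
Proof.
move=> hKn Kn0.
have [Z hZ] := circle_traces R (2 * m.+2).
pose G : R := \sum_(T < 4 * m.+1 + 5) (goodcount R (Kn * T) m.+1 T)%:R.
have G0 : 0 <= G by apply: sumr_ge0.
exists (G + (size Z)%:R * (3 * Kn%:R) ^+ m).
  by apply: addr_ge0 => //; apply: mulr_ge0 => //; apply: exprn_ge0; apply: mulr_ge0.
move=> H T T0.
have Tm : 1 <= T%:R ^+ m :> R by rewrite exprn_ege1 // ler1n.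
split.
  rewrite /salem_count /goodcount -!size_filter; apply: uniq_leq_size.
    by rewrite filter_uniq // box_uniq.
  move=> i; rewrite !mem_filter => /andP[/asboolP[alpha ha] hi]; rewrite hi andbT.
  exact: (salem_at_good T0 (size_of_box hi) ha).
move=> TH; rewrite mulrDl.
have b0 : 0 <= (size Z)%:R * (3 * Kn%:R) ^+ m * T%:R ^+ m :> R.
  by apply: mulr_ge0; [apply: mulr_ge0 => //; apply: exprn_ge0; apply: mulr_ge0 | apply: exprn_ge0].
have [TT|TT] := ltnP T (4 * m.+1 + 5).
  apply: (@le_trans _ _ (G * T%:R ^+ m)).
    apply: (@le_trans _ _ G); last by rewrite ler_peMr.
    by rewrite /G (bigD1 (Ordinal TT)) //= lerDl; apply: sumr_ge0.
  by rewrite addrCA lerDl addr_ge0.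
have GT0 : 0 <= G * T%:R ^+ m by rewrite mulr_ge0 // exprn_ge0.
apply: (@le_trans _ _ ((salem_count m.+1 Kn H T)%:R + (size Z)%:R * (3 * Kn%:R) ^+ m * T%:R ^+ m));
  last by rewrite lerD2l lerDr.
have hcount : (goodcount R (Kn * T) m.+1 T <= salem_count m.+1 Kn H T +
    \sum_(x <- Z) rootcount (Kn * T) m.+1 T x)%N.
  rewrite /goodcount /salem_count /rootcount.
  apply: (@leq_trans (count (predU (fun i => `[< exists alpha, salem_at m.+1 H (T, i) alpha >])
     (fun i => has (root (map_poly (intr : int -> R) (tracepoly T i))) Z)) (box (Kn * T) m.+1))).
    rewrite -!size_filter; apply: uniq_leq_size; first by rewrite filter_uniq // box_uniq.
    move=> i; rewrite !mem_filter => /andP[gi hi]; rewrite hi andbT /=.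
    have [sal|->] := good_salem_or_root (isT : (0 < m.+1)%N) hZ TT TH (size_of_box hi) gi;
      last by rewrite orbT.
    by apply/orP; left; apply/asboolP.
  apply: (@leq_trans (count (fun i => `[< exists alpha, salem_at m.+1 H (T, i) alpha >]) (box (Kn * T) m.+1) +
     count (fun i => has (root (map_poly (intr : int -> R) (tracepoly T i))) Z) (box (Kn * T) m.+1))).
    by rewrite -count_predUI leq_addr.
  rewrite leq_add2l; elim: (Z) => [|x s IHs] /=.
    by rewrite big_nil leqn0; apply/eqP; apply: count_pred0.
  rewrite big_cons; apply: leq_trans (leq_add (leqnn _) IHs).
  by rewrite -count_predUI leq_addr.
apply: (@le_trans _ _ (salem_count m.+1 Kn H T + \sum_(x <- Z) rootcount (Kn * T) m.+1 T x)%:R).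
  by rewrite ler_nat.
rewrite natrD lerD2l natr_sum -mulrA -exprMn.
apply: (@le_trans _ _ (\sum_(x <- Z) (3 * Kn%:R * T%:R) ^+ m)); last first.
  by rewrite big_const_seq count_predT iter_addr_0 [X in _ <= X]mulr_natl lexx.
apply: ler_sum => x _; apply: (@le_trans _ _ (((2 * (Kn * T)).+1 ^ m)%N)%:R).
  by rewrite ler_nat rootcount_le.
rewrite natrX lerXn2r ?nnegrE ?mulr_ge0 // -!natrM ler_nat.
have : (0 < Kn * T)%N by rewrite muln_gt0 Kn0.
by lia.
Qed.

End SalemSeq.

Theorem theorem1 (R : realType) (m : nat) (hm : (1 <= m)%N) :
  exists (C H0 : R), forall H : R, 1 < H -> H0 <= H ->
    exists s : seq R,
      [/\ uniq s,
          (forall alpha : R,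
             alpha \in s <-> (salem_of_degree (2 * (m + 1)) alpha /\ alpha <= H))
        & `|(size s)%:R - omega R m * H ^+ (m + 1)| <= C * H ^+ m].
Proof.
case: m hm => // m hm.
have [K0 hK0] := goodcount_asymptotics R m.
(* A sum, so as to exceed both the bound needed to find all Salem numbers in the box and the one
   needed for the lattice asymptotics. *)
pose Kn := (2 * 5 ^ m.+1 + (Num.truncn K0).+1)%N.
have Kn5 : (2 * 5 ^ m.+1 <= Kn)%N by rewrite leq_addr.
have Kn0 : (0 < Kn)%N by rewrite /Kn addnS.
have KnK : K0 <= Kn%:R.
  by rewrite (le_trans (ltW (truncnS_gt K0))) // ler_nat leq_addl.
have [C1 C10 hC1] := hK0 Kn KnK.
have [B B0 hB] := @salem_count_estimate R m Kn Kn5 Kn0.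
pose I : R := simplexint m.+1 4 [::].
have I0 : 0 <= I by apply: simplexint4_ge0.
have [C hC] := count_asymptotics m (4 * m.+1 + 4) I0 (addr_ge0 C10 B0) C10.
exists C, 1 => H H1 _.
have H0 : 0 <= H by apply: ltW (lt_trans _ H1).
pose N := Num.truncn H.
have NH : N%:R <= H by rewrite truncn_le.
have HN : H < N.+1%:R by apply: truncnS_gt.
have [s [us hs szs]] := @salem_seq R m.+1 Kn N H hm Kn5 HN.
exists s; split=> //.
(* The integral I is the density at each T, and the division comes from summing I T^(m+1) over T <=
   H. *)
have -> : omega R m.+1 = I / m.+2%:R by rewrite /omega /I simplexint4 addn1 mulrAC.
rewrite szs natr_sum !addn1.
apply: (hC (fun T => (salem_count m.+1 Kn H T)%:R) H N (ltW H1) NH HN).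
- move=> T T0 TN; have [h1 h2] := hB H T T0.
  have TH : T%:R <= H by apply: le_trans NH; rewrite ler_nat.
  have {}h2 := h2 TH; have := hC1 T T0; rewrite -/I !ler_norml => /andP[h3 h4].
  rewrite -(ler_nat R) in h1; rewrite mulrDl.
  have BT : 0 <= B * T%:R ^+ m by rewrite mulr_ge0 // exprn_ge0.
  by apply/andP; split; lra.
move=> T NT; have T0 : (0 < T)%N by apply: leq_trans NT.
have [h1 _] := hB H T T0; rewrite ler0n /=.
rewrite -(ler_nat R) in h1; apply: (le_trans h1).
have := hC1 T T0; rewrite -/I ler_norml => /andP[h3 h4].
by lra.
Qed.
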